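(* Let $d\ge 2$, $\beta>0$, $C>0$. There exist constants $K,\alpha,\kappa>0$ depending only on $d,\beta,C$ such that the following holds. Let $n\ge 1$ and suppose that the random field Ising model (RFIM) on $\Lambda_n=[-n,n]^d\cap\mathbb{Z}^d$ at inverse temperature $\beta$ satisfies $\mathrm{WSM}(C)$. Then for every $\delta>0$, with $\mathbb{P}_h$-probability at least $1-\delta$: for all test functions $\varphi:\{-1,+1\}^{\Lambda_n}\to\mathbb{R}$ and all $t>0$, $$\mathrm{Var}_{\mu_{\Lambda_n}}(P_t\varphi)\;\le\;\frac{K\,n^{\kappa}\,\mathrm{osc}(\varphi)^2}{\delta\,t^{\alpha}} .$$
   Context: $\mathbb{Z}^d$ is viewed as a graph with nearest-neighbour adjacency; a finite $\Lambda\subset\mathbb{Z}^d$ also denotes the induced subgraph. The external field $h=(h_u)_{u\in\Lambda}$ consists of i.i.d. real random variables with a symmetric distribution; $\mathbb{P}_h,\mathbb{E}_h$ denote its law and expectation. Given $h$, the RFIM on $\Lambda$ is the probability measure on $\{-1,+1\}^\Lambda$ $$\mu_\Lambda(\sigma)\propto\exp\Big(\beta\sum_{(u,v)\in E(\Lambda)}\sigma_u\sigma_v+\sum_{u\in\Lambda}h_u\sigma_u\Big).$$ For $A\subseteq\Lambda$, $\partial A$ is the exterior vertex boundary of $A$ in $\Lambda$ (vertices of $\Lambda\setminus A$ adjacent to $A$). For $\tau\in\{-1,+1\}^{\partial A}$, $\mu_A^\tau$ is the law of $\sigma_A=(\sigma_u)_{u\in A}$ under $\mu_\Lambda(\,\cdot\mid\sigma_{\partial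 A}=\tau)$; $\mu_A^{+},\mu_A^{-}$ correspond to $\tau\equiv +1$ and $\tau\equiv-1$. $B_r(o)$ is the $\ell_\infty$-ball of radius $r$ around $o$ in $\mathbb{Z}^d$. $d_{\mathrm{TV}}$ is total variation distance. The RFIM on $\Lambda$ satisfies $\mathrm{WSM}(C)$ if for all $o\in\Lambda$ and all $r\ge1$, $$\mathbb{E}_h\Big[d_{\mathrm{TV}}\big(\mu^{+}_{B_r(o)\cap\Lambda}(\sigma_o\in\cdot),\,\mu^{-}_{B_r(o)\cap\Lambda}(\sigma_o\in\cdot)\big)\Big]\le Ce^{-r/C}.$$ Continuous-time Glauber dynamics $(X_t)_{t\ge0}$ (for a given $h$): each vertex $v$ has an independent rate-1 Poisson clock, and when it rings $\sigma_v$ is resampled from its conditional law under $\mu_{\Lambda_n}$ given the current values of all other spins. $P_t\varphi(\sigma)=\mathbb{E}[\varphi(X_t)\mid X_0=\sigma]$. $\mathrm{Var}_\mu(\varphi)=\mu(\varphi^2)-\mu(\varphi)^2$ and $\mathrm{osc}(\varphi)=\max\varphi-\min\varphi$. *)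

(* Defs.v *)
From HB Require Import structures.
From mathcomp Require Import all_boot all_order all_algebra finmap.
From mathcomp Require Import all_classical all_reals all_analysis.
From mathcomp Require Import zify.

Set Implicit Arguments.
Unset Strict Implicit.
Unset Printing Implicit Defensive.

Import Order.TTheory GRing.Theory Num.Theory.
Import numFieldTopology.Exports.

Local Open Scope classical_set_scope.
Local Open Scope ring_scope.

Section lattice.
Variable d : nat.

Definition site := {ffun 'I_d -> int}.

Definition adj (x y : site) : bool := \sum_(i < d) `|x i - y i| == 1.

Definition box (n : nat) : {fset site} :=
  [fset ([ffun i => (f i)%:Z - n%:Z] : site) |
     f : {ffun 'I_d -> 'I_(n.*2.+1)} in predT]%fset.

Lemma in_box n (x : site) : (x \in box n) = [forall i, `|x i| <= n%:Z].
Proof.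
apply/imfsetP/forallP => [[f _ ->] i|xn].
  by rewrite ffunE; have := ltn_ord (f i); move: (val (f i)) => k /=; lia.
have fP i : (absz (x i + n%:Z)%R < n.*2.+1)%N by have := xn i; lia.
exists [ffun i => Ordinal (fP i)] => //.
by apply/ffunP => i; rewrite !ffunE /=; have := xn i; lia.
Qed.

End lattice.

Section rfim.
Variables (R : realType) (d : nat) (L : {fset site d}) (beta : R).
Implicit Types (A : {set L}) (h : L -> R).

(* A spin configuration; [true] encodes the spin +1 and [false] the spin -1. *)
Definition conf := {ffun L -> bool}.

Definition spin (b : bool) : R := if b then 1 else -1.

(* The factor 1/2 compensates for each edge of L being counted in both
   orientations. *)
Definition weight h (s : conf) : R :=
  expR (beta * (2^-1 * \sum_(u : L) \sum_(v : L | adj (val u) (val v))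
                          spin (s u) * spin (s v))
        + \sum_(u : L) h u * spin (s u)).

Definition gibbs h (s : conf) : R := weight h s / \sum_(s' : conf) weight h s'.

Definition gibbs_mean (mu : conf -> R) (f : conf -> R) : R := \sum_(s : conf) mu s * f s.

Definition gibbs_var (mu : conf -> R) (f : conf -> R) : R :=
  gibbs_mean mu (fun s => f s ^+ 2) - gibbs_mean mu f ^+ 2.

Definition cond_law (mu : conf -> R) (F : {set conf}) (s : conf) : R :=
  (s \in F)%:R * mu s / \sum_(s' in F) mu s'.

Definition spin_law (mu : conf -> R) (o : L) (b : bool) : R :=
  \sum_(s : conf | s o == b) mu s.

Definition boundary A : {set L} :=
  [set u : L | (u \notin A) && [exists v in A, adj (val u) (val v)]]%SET.

(* The law under h of the configuration given that it equals tau on the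
   boundary of A (only the values of tau there matter); the image of this law
   under restriction to A is mu_A^tau. *)
Definition gibbs_bc h A (tau : conf) : conf -> R :=
  cond_law (gibbs h) [set s : conf | [forall u in boundary A, s u == tau u]]%SET.

Definition constc (b : bool) : conf := [ffun=> b].

Definition linf_ball (o : L) (r : nat) : {set L} :=
  [set u : L | [forall i, `|val u i - val o i| <= r%:Z]]%SET.

Definition dTV (T : finType) (p q : T -> R) : R :=
  \big[Num.max/0]_(A : {set T}) `|\sum_(x in A) p x - \sum_(x in A) q x|.

Definition WSM d0 (Omega : measurableType d0) (P : probability Omega R)
    (H : L -> {RV P >-> R}) (C : R) : Prop :=
  forall (o : L) (r : nat), (1 <= r)%N ->
  ('E_P[fun w => let h := fun u => H u w in
      dTV (spin_law (gibbs_bc h (linf_ball o r) (constc true)) o)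
          (spin_law (gibbs_bc h (linf_ball o r) (constc false)) o)]
   <= (C * expR (- (r%:R / C)))%:E)%E.

(* max phi - min phi; the seed of the iterated max and min is one of the
   values of phi. *)
Definition osc (phi : conf -> R) : R :=
  \big[Num.max/phi (constc true)]_(s : conf) phi s
  - \big[Num.min/phi (constc true)]_(s : conf) phi s.

End rfim.

Definition mutually_independent (R : realType) d (T : measurableType d)
    (P : probability T R) (I : choiceType) (X : I -> T -> R) : Prop :=
  forall (J : {fset I}) (B : I -> set R), (forall i, measurable (B i)) ->
  P (\bigcap_(i in [set` J]) (X i @^-1` B i))
  = (\prod_(i <- J) P (X i @^-1` B i))%E.

Record iid_symmetric (R : realType) (I : choiceType) d (T : measurableType d)
    (P : probability T R) (H : I -> {RV P >-> R}) : Prop := IidSymmetric {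
  iid_independent : mutually_independent P (fun u => H u : T -> R);
  iid_identical : forall u v (B : set R), measurable B ->
    distribution P (H u) B = distribution P (H v) B;
  iid_sym : forall u (B : set R), measurable B ->
    P (H u @^-1` B) = P ((fun w => - H u w) @^-1` B) }.

Section glauber.
Variables (R : realType) (d : nat) (L : {fset site d}) (beta : R) (h : L -> R).
Variables (d1 : measure_display) (S : measurableType d1) (Q : probability S R).

(* [N v t] is the number of rings of the clock of v during [0, t], and
   [U v k] the randomness used at the k-th ring of this clock. *)
Variables (N : L -> R -> {RV Q >-> nat}) (U : L -> nat -> {RV Q >-> R}).

Record clock_paths : Prop := ClockPaths {
  clock0 : forall v w, N v 0 w = 0%N;
  clock_nondecreasing : forall v w (s t : R), 0 <= s <= t -> (N v s w <= N v t w)%N;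
  clock_right_continuous : forall v w (t : R), 0 <= t ->
    \forall s \near t^'+, N v s w = N v t w }.

(* The increments of the clocks over consecutive time intervals, together
   with all the marks. *)
Definition increments_and_marks (tt : nat -> R) (i : (L * nat) + (L * nat))
    (w : S) : R :=
  match i with
  | inl (v, j) => (N v (tt j.+1) w)%:R - (N v (tt j) w)%:R
  | inr (v, k) => U v k w
  end.

Record poisson_clocks : Prop := PoissonClocks {
  poisson_paths : clock_paths;
  poisson_increments : forall v (s t : R) k, 0 <= s < t ->
    Q [set w | N v t w = (N v s w + k)%N] = (poisson_pmf (t - s) k)%:E;
  marks_uniform : forall v k (B : set R), measurable B ->
    distribution Q (U v k) B = uniform_prob (@ltr01 R) B;
  clocks_marks_independent : forall tt : nat -> R,
    0 <= tt 0%N -> {homo tt : i j / (i <= j)%N >-> i <= j} ->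
    mutually_independent Q (increments_and_marks tt) }.

(* The probability of the spin +1 at v given that all the other spins are
   those of s. *)
Definition plus_prob (v : L) (s : conf L) : R :=
  spin_law (cond_law (gibbs beta h)
    [set s' : conf L | [forall u, (u != v) ==> (s' u == s u)]]%SET) v true.

Definition rings_at (v : L) (t : R) (w : S) : Prop :=
  0 < t /\ \forall s \near t^'-, (N v s w < N v t w)%N.

(* [X s0 t] is the state at time t of the dynamics started from s0.  By the
   properties of the paths of the clocks, the last three fields determine it;
   the resampling at a ring uses the configuration just before the ring. *)
Record glauber (X : conf L -> R -> S -> conf L) : Prop := Glauber {
  glauber_clocks : poisson_clocks;
  glauber_measurable : forall s0 (t : R) s, 0 <= t -> measurable [set w | X s0 t w = s];
  glauber_start : forall s0 w, X s0 0 w = s0;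
  glauber_constant : forall s0 v (s t : R) w, 0 <= s <= t -> N v s w = N v t w ->
    X s0 t w v = X s0 s w v;
  glauber_resample : forall s0 v (t : R) w, rings_at v t w ->
    \forall s \near t^'-,
      X s0 t w v = (U v (N v t w) w < plus_prob v (X s0 s w)) }.

Definition semigroup (X : conf L -> R -> S -> conf L) (t : R)
    (phi : conf L -> R) (s0 : conf L) : R :=
  fine 'E_Q[fun w => phi (X s0 t w)].

End glauber.

(* Main.v *)
Require Import Defs.
From HB Require Import structures.
From mathcomp Require Import all_boot all_order all_algebra finmap.
From mathcomp Require Import all_classical all_reals all_analysis.
From mathcomp Require Import measurable_realfun.
From mathcomp Require Import zify ring lra.

(** Why the variance decays polynomially. Write [N] for the number of sites. The proof goes from
    weak mixing on average over the field to a weak Poincaré inequality for the Gibbs measure of a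
    typical field, which is then fed into the dynamics.

    Typical fields. At a fixed scale [r], let the gap at [x] be the difference of the probabilities
    of a plus at [x] under plus and minus boundary conditions on the ball of radius [r]. It only
    depends on the field in that ball. Hence the sites whose gap exceeds a small [eps] are rare, by
    weak mixing and Markov's inequality, and are independent when far apart. Products of [J] gaps
    along closed walks visiting far apart points therefore have an exponentially small expectation,
    smaller than the inverse number of such walks, and outside an event of probability [delta] the
    sum of these products is at most [e * N / delta * exp (- J)] for all [J] ([disorder_event]).

    From gaps to influences. Reveal two monotonically coupled samples that initially disagree at one
    site. Their final disagreements form a connected set, and the products of gaps at far apart sites
    are supermartingales during the exploration, so they bound the probability that the set contains
    these sites ([disagreement_law]). A connected set of many sites contains a closed walk through
    many far apart points ([spread_walk]). The total influence of a site thus exceeds a multiple of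
    [J] with a probability of order [exp (- J)] only, and this remains true in a system where any set
    of sites is frozen to a sample of the measure itself ([rowsum_tail]), because the gaps are
    supermartingales under that freezing as well ([mean_gap_prod]).

    Weak Poincaré inequality. Freeze uniformly random sites one by one. As spin correlations are
    nonnegative, the fraction of the variance of [f] lost in one step is at most of the order of the
    influences divided by [N] ([freeze_cvar]). Influences larger than the logarithm of the inverse
    relative variance can be ignored, so each step multiplies this logarithm by at most
    [1 + O(1 / N)]: after a constant times [N] steps a power of the variance survives
    ([freeze_lower_bound]). By then the unfrozen sites form clusters of logarithmic size
    ([freeze_percolation]), which are independent, and within which the variance is at most
    exponential in the size times the Dirichlet form ([cvar_small_clusters]). Altogether, a function
    of oscillation [w] and variance at least [x * w ^ 2] has a Dirichlet form at least
    [w ^ 2 * (x / B) ^ Theta] with [B] of order [N ^ 3 / delta] ([weak_poincare]).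

    Dynamics. Cut the time into short intervals and keep the realisations with at most one ring in
    each: the law of the dynamics dominates that of a chain resampling one site at a time
    ([history_law_ge]), with an error that vanishes with the length of the intervals
    ([semigroup_variance]). The variance along the chain decreases by the Dirichlet form, hence by
    time [t] it is below the level [x] at which the inequality only provides a Dirichlet form of
    [3 / t] ([variance_decay]); this [x] is [B * (3 / t) ^ (1 / Theta)]. *)

Set Implicit Arguments.
Unset Strict Implicit.
Unset Printing Implicit Defensive.

Import Order.TTheory GRing.Theory Num.Theory.
Import numFieldTopology.Exports.

Local Open Scope ring_scope.

(* Until further notice [set0], [setU], etc. and their lemmas are those of finite sets. *)
From mathcomp Require Import fintype finset.

(** * Finite spin systems and conditional expectations *)

Section Configurations.
Variable L : finType.
Local Notation config := {ffun L -> bool}.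
Implicit Types (s t : config) (x y : L) (V W B : {set L}).

Definition agree V s t := [forall x in V, s x == t x].

Definition upd s y b : config := [ffun x => if x == y then b else s x].

Definition mix B s t : config := [ffun x => if x \in B then s x else t x].

Lemma agreeP V s t : reflect {in V, forall x, s x = t x} (agree V s t).
Proof. exact: eqfun_inP. Qed.

Lemma agree_refl V s : agree V s s.
Proof. by apply/agreeP. Qed.

Lemma agree_sym V s t : agree V s t = agree V t s.
Proof. by apply/agreeP/agreeP => st x xV; rewrite st. Qed.

Lemma agree_trans V s t r : agree V s t -> agree V t r -> agree V s r.
Proof. by move=> /agreeP st /agreeP tr; apply/agreeP => x xV; rewrite st ?tr. Qed.

Lemma agree_eql V s t r : agree V s t -> agree V s r = agree V t r.
Proof.
move=> st; apply/idP/idP; last exact: agree_trans.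
by apply: agree_trans; rewrite agree_sym.
Qed.

Lemma agreeS V W s t : V \subset W -> agree W s t -> agree V s t.
Proof. by move=> /subsetP VW /agreeP st; apply/agreeP => x /VW /st. Qed.

Lemma agree0 s t : agree set0 s t.
Proof. by apply/agreeP => x; rewrite inE. Qed.

Lemma agree_upd V s y b : y \notin V -> agree V (upd s y b) s.
Proof.
by move=> yV; apply/agreeP => x xV; rewrite ffunE; case: eqP xV yV => // -> ->.
Qed.

Lemma upd_id s y : upd s y (s y) = s.
Proof. by apply/ffunP => x; rewrite ffunE; case: eqP => // ->. Qed.

Lemma updE s y b : upd s y b y = b.
Proof. by rewrite ffunE eqxx. Qed.

Lemma agree_updU V s t y : agree V t s -> agree (y |: V) t (upd s y (t y)).
Proof.
move=> /agreeP ts; apply/agreeP => x; rewrite in_setU1 ffunE.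
by case: eqP => [->|_ /=] // /ts.
Qed.

End Configurations.

Section Conditioning.
Variables (R : realFieldType) (L : finType).
Local Notation config := {ffun L -> bool}.
Variable mu : config -> R.
Hypotheses (mu_gt0 : forall s, 0 < mu s) (mu_sum1 : \sum_s mu s = 1).
Implicit Types (s t : config) (x y : L) (V W B S : {set L}) (f g : config -> R).

Definition mean f := \sum_s mu s * f s.

Definition marginal V s := \sum_(t | agree V t s) mu t.

(** The conditional expectation of [f] given the spins in [V], as a function of a configuration
    [s] of which only the spins in [V] matter. *)
Definition cexp V f s := (\sum_(t | agree V t s) mu t * f t) / marginal V s.

(** The conditional probability of a plus at [x]. *)
Definition plus V s x := cexp V (fun t => (t x)%:R) s.

Lemma marginal_gt0 V s : 0 < marginal V s.
Proof.
rewrite /marginal (bigD1 s) ?agree_refl //= ltr_pwDl ?mu_gt0 //.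
by apply: sumr_ge0 => t _; apply: ltW.
Qed.
Hint Resolve marginal_gt0 : core.

Lemma marginal_neq0 V s : marginal V s != 0.
Proof. by rewrite gt_eqF. Qed.
Hint Resolve marginal_neq0 : core.

Lemma eq_marginal V s t : agree V s t -> marginal V s = marginal V t.
Proof.
move=> st; apply: eq_bigl => r.
by rewrite agree_sym (agree_eql _ st) agree_sym.
Qed.

Lemma cexp_agree V f s t : agree V s t -> cexp V f s = cexp V f t.
Proof.
move=> st; rewrite /cexp (eq_marginal st); congr (_ / _); apply: eq_bigl => r.
by rewrite agree_sym (agree_eql _ st) agree_sym.
Qed.

Lemma eq_cexp V f g s :
  (forall t, agree V t s -> f t = g t) -> cexp V f s = cexp V g s.
Proof. by move=> fg; congr (_ / _); apply: eq_bigr => t /fg ->. Qed.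

Lemma cexpD V f g s : cexp V (fun t => f t + g t) s = cexp V f s + cexp V g s.
Proof.
by rewrite /cexp -mulrDl -big_split; congr (_ / _); apply: eq_bigr => t _; rewrite mulrDr.
Qed.

Lemma cexpMl V f g s : (forall t, agree V t s -> g t = g s) ->
  cexp V (fun t => g t * f t) s = g s * cexp V f s.
Proof.
move=> gV; rewrite /cexp mulrA; congr (_ / _); rewrite mulr_sumr.
by apply: eq_bigr => t /gV ->; rewrite mulrCA.
Qed.

Lemma cexpZ V a f s : cexp V (fun t => a * f t) s = a * cexp V f s.
Proof. exact: (@cexpMl V f (fun=> a)). Qed.

Lemma cexpB V f g s : cexp V (fun t => f t - g t) s = cexp V f s - cexp V g s.
Proof.
by rewrite -mulN1r -cexpZ -cexpD; apply: eq_cexp => t _; rewrite mulN1r.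
Qed.

Lemma cexp_cst V a s : cexp V (fun=> a) s = a.
Proof. by rewrite /cexp -mulr_suml -/(marginal V s) mulrAC mulfV ?mul1r. Qed.

Lemma cexp_sum V (I : finType) (P : pred I) (F : I -> config -> R) s :
  cexp V (fun t => \sum_(i | P i) F i t) s = \sum_(i | P i) cexp V (F i) s.
Proof.
rewrite /cexp -mulr_suml exchange_big /=; congr (_ / _).
by apply: eq_bigr => t _; rewrite mulr_sumr.
Qed.

Lemma cexp_id V f s : (forall t, agree V t s -> f t = f s) -> cexp V f s = f s.
Proof. by move=> fV; rewrite (eq_cexp (g := fun=> f s)) ?cexp_cst. Qed.

Lemma ler_cexp V f g s :
  (forall t, agree V t s -> f t <= g t) -> cexp V f s <= cexp V g s.
Proof.
move=> fg; rewrite ler_pM2r ?invr_gt0 //; apply: ler_sum => t /fg.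
by rewrite ler_pM2l.
Qed.

Lemma cexp_ge0 V f s : (forall t, agree V t s -> 0 <= f t) -> 0 <= cexp V f s.
Proof. by move=> f0; rewrite -(cexp_cst V 0 s); apply: ler_cexp. Qed.

Lemma cexp_tower V W f s : V \subset W -> cexp V (cexp W f) s = cexp V f s.
Proof.
move=> VW; congr (_ / _).
transitivity (\sum_(t | agree V t s) \sum_(r | agree W r t)
    mu t * (mu r * f r / marginal W t)).
  by apply: eq_bigr => t _; rewrite /cexp mulr_suml mulr_sumr.
rewrite (exchange_big_dep (fun r => agree V r s)) /=; last first.
  by move=> t r ts /(agreeS VW) rt; apply: agree_trans ts.
apply: eq_bigr => r rs.
transitivity (\sum_(t | agree W t r) mu t * (mu r * f r / marginal W r)).
  apply: eq_big => t.
    rewrite (agree_sym W r t); apply: andb_idl => tr.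
    by apply: agree_trans rs; apply: agreeS VW _.
  by case/andP => _ rt; rewrite (eq_marginal rt).
by rewrite -mulr_suml -/(marginal W r) mulrCA mulfV ?mulr1.
Qed.

Lemma meanE f s : mean f = cexp set0 f s.
Proof.
have Z1 : marginal set0 s = 1 by rewrite -mu_sum1; apply: eq_bigl => t; rewrite agree0.
by rewrite /cexp Z1 divr1; apply: eq_bigl => t; rewrite agree0.
Qed.

Let s0 : config := [ffun=> true].

Lemma mean_cexp V f : mean (cexp V f) = mean f.
Proof. by rewrite !(meanE _ s0) cexp_tower ?sub0set. Qed.

Lemma eq_mean f g : f =1 g -> mean f = mean g.
Proof. by move=> fg; apply: eq_bigr => s _; rewrite fg. Qed.

Lemma meanD f g : mean (fun t => f t + g t) = mean f + mean g.
Proof. by rewrite !(meanE _ s0) cexpD. Qed.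

Lemma meanB f g : mean (fun t => f t - g t) = mean f - mean g.
Proof. by rewrite !(meanE _ s0) cexpB. Qed.

Lemma meanZ a f : mean (fun t => a * f t) = a * mean f.
Proof. by rewrite !(meanE _ s0) cexpZ. Qed.

Lemma mean_cst a : mean (fun=> a) = a.
Proof. by rewrite (meanE _ s0) cexp_cst. Qed.

Lemma mean_sum (I : finType) (P : pred I) (F : I -> config -> R) :
  mean (fun t => \sum_(i | P i) F i t) = \sum_(i | P i) mean (F i).
Proof. by rewrite (meanE _ s0) cexp_sum; apply: eq_bigr => i _; rewrite -meanE. Qed.

Lemma ler_mean f g : (forall t, f t <= g t) -> mean f <= mean g.
Proof. by move=> fg; rewrite !(meanE _ s0) ler_cexp. Qed.

Lemma mean_ge0 f : (forall t, 0 <= f t) -> 0 <= mean f.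
Proof. by move=> f0; rewrite (meanE _ s0) cexp_ge0. Qed.

Lemma plus_in V s x : x \in V -> plus V s x = (s x)%:R.
Proof. by move=> xV; rewrite /plus cexp_id // => t /agreeP ->. Qed.

Lemma plus_ge0 V s x : 0 <= plus V s x.
Proof. by apply: cexp_ge0 => t _; rewrite ler0n. Qed.

Lemma plus_le1 V s x : plus V s x <= 1.
Proof. by rewrite -(cexp_cst V 1 s); apply: ler_cexp => t _; rewrite lern1 leq_b1. Qed.

(** The tower property when one more site [y] is revealed. *)
Lemma cexp_reveal V f s y :
  cexp V f s = plus V s y * cexp (y |: V) f (upd s y true)
             + (1 - plus V s y) * cexp (y |: V) f (upd s y false).
Proof.
rewrite -(cexp_tower f s (subsetUr [set y] V)).
set a := cexp _ _ (upd s y true); set b := cexp _ _ (upd s y false).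
rewrite (eq_cexp (g := fun t => b + (a - b) * (t y)%:R)).
  by rewrite cexpD cexp_cst cexpZ -/(plus V s y); ring.
move=> t ts; rewrite (cexp_agree f (agree_updU y ts)).
by case: (t y); rewrite /a /b /=; ring.
Qed.

Lemma plus_reveal V s y x :
  plus V s x = plus V s y * plus (y |: V) (upd s y true) x
             + (1 - plus V s y) * plus (y |: V) (upd s y false) x.
Proof. exact: cexp_reveal. Qed.

(** The tower property, drawing the sites of [S] before the spin at [y]. *)
Lemma mean_reveal S y f : (forall s t, agree (y |: S) s t -> f s = f t) ->
  mean f = mean (fun s => plus S s y * f (upd s y true) + (1 - plus S s y) * f (upd s y false)).
Proof.
move=> fS; rewrite -(mean_cexp S f); apply: eq_mean => s.
rewrite (cexp_reveal _ _ _ y); congr (_ * _ + _ * _); apply: cexp_id => t.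
  by move/fS.
by move/fS.
Qed.

End Conditioning.

(** * Monotonicity and the spatial Markov property *)

Section Monotonicity.
Variables (R : realFieldType) (L : finType).
Local Notation config := {ffun L -> bool}.
Variable mu : config -> R.
Hypothesis mu_gt0 : forall s, 0 < mu s.
Implicit Types (s t : config) (x y : L) (V : {set L}).

Definition join s t : config := [ffun x => s x || t x].
Definition meet s t : config := [ffun x => s x && t x].

Definition fkg_lattice := forall s t, mu s * mu t <= mu (join s t) * mu (meet s t).

Local Notation marginal := (marginal mu).
Local Notation plus := (plus mu).

Lemma marginal_reveal V s y : y \notin V ->
  marginal V s = marginal (y |: V) (upd s y true) + marginal (y |: V) (upd s y false).
Proof.
move=> yV; rewrite -[LHS]/(\sum_(t | agree V t s) mu t) (bigID (fun t : config => t y)) /=.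
have split b : \sum_(t | agree V t s && (t y == b)) mu t = marginal (y |: V) (upd s y b).
  apply: eq_bigl => t; apply/andP/idP => [[ts /eqP <-]|tsb]; first exact: agree_updU.
  split; last by have /agreeP/(_ y) := tsb; rewrite setU11 updE => ->.
  apply: agree_trans (agree_upd s b yV); apply: agreeS tsb; exact: subsetUr.
congr (_ + _); rewrite -split; apply: eq_bigl => t; congr (_ && _).
  by rewrite eqb_id.
by rewrite eqbF_neg.
Qed.

Lemma plus_marginal V s x : x \notin V ->
  plus V s x = marginal (x |: V) (upd s x true) / marginal V s.
Proof.
move=> xV; congr (_ / _); rewrite (bigID (fun t : config => t x)) /= addrC big1 ?add0r.
  apply: eq_big => t; last by case/andP => _ ->; rewrite mulr1.
  apply/andP/idP => [[ts tx]|tsb]; first by have := agree_updU x ts; rewrite tx.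
  split; last by have /agreeP/(_ x) := tsb; rewrite setU11 updE => ->.
  apply: agree_trans (agree_upd s true xV); apply: agreeS tsb; exact: subsetUr.
by move=> t /andP[_ /negPf ->]; rewrite mulr0.
Qed.

(** The two-point case of the four functions theorem: both mixed products are at most
    [P = c1 * d0] and their product is at most [P * Q], where [Q = c0 * d1], so that their sum is
    at most [P + Q]. *)
Lemma four_functions2 (a1 a0 b1 b0 c1 c0 d1 d0 : R) :
  0 < a1 -> 0 < a0 -> 0 < b1 -> 0 < b0 -> 0 < c1 -> 0 < c0 -> 0 < d1 -> 0 < d0 ->
  a1 * b1 <= c1 * d1 -> a0 * b0 <= c0 * d0 -> a1 * b0 <= c1 * d0 -> a0 * b1 <= c1 * d0 ->
  (a1 + a0) * (b1 + b0) <= (c1 + c0) * (d1 + d0).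
Proof.
move=> a1p a0p b1p b0p c1p c0p d1p d0p h11 h00 h10 h01.
set P := c1 * d0 in h10 h01 *; set Q := c0 * d1.
have Pp : 0 < P by apply: mulr_gt0.
have uv : (a1 * b0) * (a0 * b1) <= P * Q.
  have -> : (a1 * b0) * (a0 * b1) = (a1 * b1) * (a0 * b0) by ring.
  have -> : P * Q = (c1 * d1) * (c0 * d0) by rewrite /P /Q; ring.
  by apply: ler_pM => //; rewrite ltW ?mulr_gt0.
have : (a1 * b0) + (a0 * b1) <= P + Q.
  rewrite -(ler_pM2l Pp).
  have : 0 <= (P - a1 * b0) * (P - a0 * b1) by rewrite mulr_ge0 ?subr_ge0.
  by nra.
have -> : (c1 + c0) * (d1 + d0) = c1 * d1 + c0 * d0 + (P + Q) by rewrite /P /Q; ring.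
by nra.
Qed.

Hypothesis mu_lattice : fkg_lattice.

(** Summing out one site preserves the lattice condition, so that every marginal has it. *)
Lemma marginal_lattice V s t :
  marginal V s * marginal V t <= marginal V (join s t) * marginal V (meet s t).
Proof.
have [n] := ubnP #|~: V|; elim: n V s t => // n IH V s t Vn.
have [VT|[y yV]] := set_0Vmem (~: V).
  have single r : marginal V r = mu r.
    rewrite /marginal (big_pred1 r) // => r'; apply/agreeP/eqP => [rr|-> //].
    by apply/ffunP => x; apply: rr; move/setP/(_ x): VT; rewrite !inE => /negbFE.
  by rewrite !single mu_lattice.
have {}yV' : y \notin V by move: yV; rewrite inE.
rewrite !(fun r => marginal_reveal r yV').
have IHy s' t' : marginal (y |: V) s' * marginal (y |: V) t' <=
    marginal (y |: V) (join s' t') * marginal (y |: V) (meet s' t').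
  apply: IH; rewrite -ltnS; apply: leq_trans Vn; rewrite ltnS; apply: proper_card.
  rewrite properE; apply/andP; split.
    by apply/subsetP => x; rewrite !inE negb_or => /andP[].
  by apply/subsetPn; exists y => //; rewrite !inE eqxx.
have jE b b' : join (upd s y b) (upd t y b') = upd (join s t) y (b || b').
  by apply/ffunP => x; rewrite !ffunE; case: eqP.
have mE b b' : meet (upd s y b) (upd t y b') = upd (meet s t) y (b && b').
  by apply/ffunP => x; rewrite !ffunE; case: eqP.
apply: four_functions2; rewrite ?marginal_gt0 //.
- by have := IHy (upd s y true) (upd t y true); rewrite jE mE.
- by have := IHy (upd s y false) (upd t y false); rewrite jE mE.
- by have := IHy (upd s y true) (upd t y false); rewrite jE mE.
- by have := IHy (upd s y false) (upd t y true); rewrite jE mE.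
Qed.

(** Sites of [V] where [s] and [t] differ are raised to plus: the lattice condition of the
    marginal on [x |: V] says that this can only increase the odds of a plus at [x]. *)
Lemma plus_mono V s t x : {in V, forall y, s y -> t y} -> plus V s x <= plus V t x.
Proof.
move=> st; have [xV|xV] := boolP (x \in V).
  rewrite !plus_in // ler_nat; move: (st x xV).
  by case: (s x) (t x) => [] [] //= /(_ isT).
rewrite !plus_marginal // ler_pdivrMr ?marginal_gt0 // mulrAC ler_pdivlMr ?marginal_gt0 //.
rewrite !(fun r => marginal_reveal r xV) mulrDr mulrDr mulrC lerD2l.
have := marginal_lattice (x |: V) (upd s x true) (upd t x false).
set m := marginal (x |: V); rewrite (mulrC (m (upd t x true))).
suff [-> ->] : m (join (upd s x true) (upd t x false)) = m (upd t x true) /\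
    m (meet (upd s x true) (upd t x false)) = m (upd s x false).
  by rewrite [leRHS]mulrC.
split; apply: eq_marginal => //; apply/agreeP => y; rewrite in_setU1 !ffunE;
  case: eqP => //= _ /st; by case: (s y) (t y) => [] [] // /(_ isT).
Qed.

End Monotonicity.

Section Markov.
Variables (R : realFieldType) (L : finType) (e : rel L).
Local Notation config := {ffun L -> bool}.
Variable mu : config -> R.
Hypothesis mu_gt0 : forall s, 0 < mu s.
Implicit Types (s t : config) (x y : L) (V W B S : {set L}) (f g : config -> R).

Definition bdry B : {set L} := [set u | (u \notin B) && [exists v in B, e u v]].

(** The spatial Markov property, in a form free of sums: inside and outside of [B] can be
    exchanged between two configurations equal on the boundary of [B]. *)
Definition markov_swap := forall B s t, agree (bdry B) s t ->
  mu s * mu t = mu (mix B s t) * mu (mix B t s).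

Hypothesis mu_swap : markov_swap.

Local Notation cexp := (cexp mu).
Local Notation marginal := (marginal mu).
Local Notation plus := (plus mu).

(** Given its values on a set [V0] that shields [B], the law inside [B] ignores the other
    revealed spins: exchanging two samples inside [B] is an involution that preserves the
    product of their weights. *)
Lemma markov_agree V0 V B g s t : bdry B \subset V0 -> V0 \subset V -> V :&: B \subset V0 ->
  (forall r r', agree (V0 :|: B) r r' -> g r = g r') -> agree V0 s t -> cexp V g s = cexp V g t.
Proof.
move=> BV0 V0V VB gB st.
apply/eqP; rewrite eqr_div ?marginal_neq0 //; apply/eqP.
rewrite ![_ * marginal _ _]mulr_suml.
pose cond (p : config * config) := agree V p.1 s && agree V p.2 t.
pose swap (p : config * config) := (mix B p.2 p.1, mix B p.1 p.2).
have swapK : involutive swap.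
  case=> r r'; rewrite /swap /=; congr (_, _); apply/ffunP => x; rewrite !ffunE;
  by case: (x \in B).
have swap_cond p : cond p -> cond (swap p).
  case: p => r r' /andP[/= /agreeP rs /agreeP rt]; rewrite /cond /=.
  apply/andP; split; apply/agreeP => x xV; rewrite ffunE; case: ifP => xB.
  - have xV0 : x \in V0 by apply: (subsetP VB); rewrite inE xV.
    by rewrite rt // -(agreeP _ _ _ st).
  - exact: rs.
  - have xV0 : x \in V0 by apply: (subsetP VB); rewrite inE xV.
    by rewrite rs // (agreeP _ _ _ st).
  - exact: rt.
transitivity (\sum_(p | cond p) mu p.1 * mu p.2 * g p.1).
  rewrite -(pair_big (fun r => agree V r s) (fun r => agree V r t)
     (fun r r' => mu r * mu r' * g r)) /=.
  apply: eq_bigr => r _; rewrite mulr_sumr; apply: eq_bigr => r' _; ring.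
transitivity (\sum_(p | cond p) mu p.1 * mu p.2 * g p.2); last first.
  rewrite -(pair_big (fun r => agree V r s) (fun r => agree V r t)
     (fun r r' => mu r * mu r' * g r')) /= exchange_big /=.
  apply: eq_bigr => r' _; rewrite mulr_sumr; apply: eq_bigr => r _; ring.
rewrite (reindex_inj (inv_inj swapK)) /=; apply: eq_big => [p|p cp].
  by apply/idP/idP => /swap_cond //; rewrite swapK.
have {}cp : cond p by move/swap_cond: cp; rewrite swapK.
case: p cp => r r' /andP[/= rs rt].
have rr : agree V0 r r'.
  apply: agree_trans (agreeS V0V rs) _; apply: agree_trans st _.
  by rewrite agree_sym (agreeS V0V rt).
rewrite [mu (mix _ _ _) * _]mulrC -(mu_swap (agreeS BV0 rr)); congr (_ * _).
apply: gB; apply/agreeP => x; rewrite inE ffunE; case: ifP => // _ /orP[xV0|//].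
by move/agreeP: rr => ->.
Qed.

Lemma markov_restrict V0 V B g s : bdry B \subset V0 -> V0 \subset V -> V :&: B \subset V0 ->
  (forall r r', agree (V0 :|: B) r r' -> g r = g r') -> cexp V g s = cexp V0 g s.
Proof.
move=> BV0 V0V VB gB; rewrite -(cexp_tower mu_gt0 _ _ V0V); symmetry.
by apply: cexp_id => // t ts; apply: (@markov_agree V0 V B).
Qed.

Lemma plus_markov V0 V B x s : bdry B \subset V0 -> V0 \subset V -> V :&: B \subset V0 ->
  x \in B -> plus V s x = plus V0 s x.
Proof.
move=> BV0 V0V VB xB; apply: (@markov_restrict _ _ B) => // r r' /agreeP -> //.
by rewrite inE xB orbT.
Qed.

End Markov.

(** * Disagreement percolation *)

Section Disagreement.
Variables (R : realFieldType) (L : finType) (e : rel L).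
Local Notation config := {ffun L -> bool}.
Variable mu : config -> R.
Hypotheses (mu_gt0 : forall s, 0 < mu s) (mu_sum1 : \sum_s mu s = 1).
Hypotheses (mu_lattice : fkg_lattice mu) (mu_swap : markov_swap e mu).
Implicit Types (s t : config) (x y z o : L) (V W B S A D C : {set L}).

Local Notation cexp := (cexp mu).
Local Notation mean := (mean mu).
Local Notation plus := (plus mu).
Local Notation bdry := (bdry e).

Definition cst (b : bool) : config := [ffun=> b].

(** Probability of a plus at [x] when the boundary of [B] is frozen to [b] and the sites of
    [V] inside [B] are frozen to [s]: an extremal boundary condition for [B]. *)
Definition shell b B V s x := plus (bdry B :|: (V :&: B)) (mix (bdry B) (cst b) s) x.

Lemma shell_agree b B V s t x : agree (V :&: B) s t -> shell b B V s x = shell b B V t x.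
Proof.
move=> /agreeP st; apply: cexp_agree => //; apply/agreeP => y; rewrite in_setU !ffunE.
by case: ifP => //= _ /st.
Qed.

Lemma shell_mono b B V s t x : {in V :&: B, forall y, s y -> t y} ->
  shell b B V s x <= shell b B V t x.
Proof.
move=> st; apply: plus_mono => // y; rewrite in_setU !ffunE.
by case: ifP => //= _ /st.
Qed.

Lemma shell_le B V s x : shell false B V s x <= shell true B V s x.
Proof. by apply: plus_mono => // y _; rewrite !ffunE; case: ifP. Qed.

(** Whatever is revealed outside [B], averaging over the boundary of [B] lies between freezing
    it to minus and freezing it to plus. *)
Lemma shell_bounds B V s y : y \in B ->
  shell false B V s y <= plus V s y <= shell true B V s y.
Proof.
move=> yB.
have E b : shell b B V s y = plus (V :|: bdry B) (mix (bdry B) (cst b) s) y.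
  symmetry; apply: (plus_markov mu_gt0 mu_swap (B := B)) => //.
  - exact: subsetUl.
  - rewrite subUset subsetUr; apply: subset_trans (subsetIl _ _) (subsetUl _ _).
  - apply/subsetP => x; rewrite !inE => /andP[/orP[->|xbd] xB].
      by rewrite xB orbT.
    by rewrite xbd.
have tower : plus V s y = cexp V (fun t => plus (V :|: bdry B) t y) s.
  by symmetry; apply: cexp_tower => //; apply: subsetUl.
rewrite !E tower; apply/andP; split.
  apply: le_trans (_ : cexp V (fun=> plus (V :|: bdry B) (mix (bdry B) (cst false) s) y) s <= _).
    by rewrite cexp_cst.
  apply: ler_cexp => // t /agreeP ts; apply: plus_mono => // x.
  by rewrite in_setU ffunE; case: ifP => [_|_]; rewrite ?ffunE // orbF => /ts ->.
apply: le_trans (_ : cexp V (fun=> plus (V :|: bdry B) (mix (bdry B) (cst true) s) y) s <= _).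
  apply: ler_cexp => // t /agreeP ts; apply: plus_mono => // x.
  by rewrite in_setU ffunE; case: ifP => [_|_]; rewrite ?ffunE // orbF => /ts ->.
by rewrite cexp_cst.
Qed.

Lemma shell_in b B V s x : x \in V :&: B -> shell b B V s x = (s x)%:R.
Proof.
move=> xVB; have xB : x \in B by move: xVB; rewrite inE => /andP[].
rewrite /shell plus_in //; last by rewrite inE xVB orbT.
by rewrite ffunE inE xB.
Qed.

Lemma shell_reveal b B V s y x : y \in B ->
  shell b B V s x = shell b B V s y * shell b B (y |: V) (upd s y true) x
     + (1 - shell b B V s y) * shell b B (y |: V) (upd s y false) x.
Proof.
move=> yB; rewrite /shell (plus_reveal mu_gt0 _ _ y).
have ybd : y \notin bdry B by rewrite inE yB.
have -> : bdry B :|: (y |: V) :&: B = y |: (bdry B :|: V :&: B).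
  by apply/setP => z; rewrite !inE; case: (eqVneq z y) => [->|] //=; rewrite yB orbT.
have E c : mix (bdry B) (cst b) (upd s y c) = upd (mix (bdry B) (cst b) s) y c.
  by apply/ffunP => z; rewrite !ffunE; case: (eqVneq z y) => [->|//]; rewrite (negPf ybd).
by rewrite !E.
Qed.

Lemma shell_out b B V s y c x : y \notin B ->
  shell b B (y |: V) (upd s y c) x = shell b B V s x.
Proof.
move=> yB; rewrite /shell.
have -> : bdry B :|: (y |: V) :&: B = bdry B :|: V :&: B.
  by apply/setP => z; rewrite !inE; case: (eqVneq z y) => [->|] //=; rewrite (negPf yB) !andbF.
apply: cexp_agree => //; apply/agreeP => z; rewrite in_setU !ffunE; case: ifP => //= _.
by rewrite inE; case: (eqVneq z y) => // ->; rewrite (negPf yB) andbF.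
Qed.

Variable ball : L -> {set L}.
Hypothesis ball_self : forall x, x \in ball x.

(** The largest probability that two monotonically coupled samples, of which [s] and [t] are
    the parts already revealed, disagree at [x], whatever is revealed outside [ball x]. *)
Definition gap V s t x := shell true (ball x) V s x - shell false (ball x) V t x.

Lemma gap_agree V s t s' t' x : agree (V :&: ball x) s s' -> agree (V :&: ball x) t t' ->
  gap V s t x = gap V s' t' x.
Proof. by move=> ss tt; rewrite /gap (shell_agree _ _ ss) (shell_agree _ _ tt). Qed.

Lemma gap_ge0 V s t x : {in V, forall y, t y -> s y} -> 0 <= gap V s t x.
Proof.
move=> ts; rewrite subr_ge0; apply: le_trans (shell_le _ _ _ _).
by apply: shell_mono => y; rewrite inE => /andP[/ts].
Qed.

Lemma gap_out V s t y c c' x : y \notin ball x ->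
  gap (y |: V) (upd s y c) (upd t y c') x = gap V s t x.
Proof. by move=> yB; rewrite /gap !shell_out. Qed.

(** The gap is a supermartingale as the two coupled samples are revealed, because the
    extremal boundary conditions dominate the law of the revealed spins. *)
Lemma gap_step V s t y x : {in V, forall z, t z -> s z} -> y \in ball x ->
  plus V t y * gap (y |: V) (upd s y true) (upd t y true) x
  + (plus V s y - plus V t y) * gap (y |: V) (upd s y true) (upd t y false) x
  + (1 - plus V s y) * gap (y |: V) (upd s y false) (upd t y false) x
  <= gap V s t x.
Proof.
move=> ts yB; have /andP[_] := shell_bounds V s yB; have /andP[+ _] := shell_bounds V t yB.
rewrite /gap (shell_reveal true V s x yB) (shell_reveal false V t x yB).
set p := plus V s y; set q := plus V t y.
set P := shell true _ V s y; set Q := shell false _ V t y.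
set a1 := shell true _ _ (upd s y true) x; set a0 := shell true _ _ (upd s y false) x.
set b1 := shell false _ _ (upd t y true) x; set b0 := shell false _ _ (upd t y false) x.
move=> Qq pP.
have a01 : a0 <= a1.
  by apply: shell_mono => z _; rewrite !ffunE; case: eqP.
have b01 : b0 <= b1.
  by apply: shell_mono => z _; rewrite !ffunE; case: eqP.
have : 0 <= (P - p) * (a1 - a0) by rewrite mulr_ge0 ?subr_ge0.
have : 0 <= (q - Q) * (b1 - b0) by rewrite mulr_ge0 ?subr_ge0.
by nra.
Qed.

Definition separated A := {in A &, forall x y, x != y -> [disjoint ball x & ball y]}.

Lemma upd_order V s t y (b b' : bool) : {in V, forall z, t z -> s z} -> (b' -> b) ->
  {in y |: V, forall z, upd t y b' z -> upd s y b z}.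
Proof. by move=> ts bb z; rewrite in_setU1 !ffunE; case: eqP => // _ /ts. Qed.

(** The balls of separated sites are disjoint, so that revealing one spin affects at most one
    factor of the product. *)
Lemma gap_prod_step A V s t y : separated A -> {in V, forall z, t z -> s z} ->
  plus V t y * \prod_(x in A) gap (y |: V) (upd s y true) (upd t y true) x
  + (plus V s y - plus V t y) * \prod_(x in A) gap (y |: V) (upd s y true) (upd t y false) x
  + (1 - plus V s y) * \prod_(x in A) gap (y |: V) (upd s y false) (upd t y false) x
  <= \prod_(x in A) gap V s t x.
Proof.
move=> sepA ts.
have [/exists_inP[x xA yx]|/exists_inPn noy] := boolP [exists x in A, y \in ball x].
  rewrite !(bigD1 x xA) /=.
  have E c c' : \prod_(z in A | z != x) gap (y |: V) (upd s y c) (upd t y c') z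
              = \prod_(z in A | z != x) gap V s t z.
    apply: eq_bigr => z /andP[zA zx]; apply: gap_out.
    by have := disjointFr (sepA _ _ xA zA _) yx; rewrite eq_sym => ->.
  rewrite !E !mulrA -!mulrDl; apply: ler_wpM2r; last exact: gap_step.
  by apply: prodr_ge0 => z _; apply: gap_ge0.
have E c c' : \prod_(z in A) gap (y |: V) (upd s y c) (upd t y c') z
            = \prod_(z in A) gap V s t z.
  by apply: eq_bigr => z /noy; apply: gap_out.
by rewrite !E; lra.
Qed.

(** Freezing sites to random values drawn from [mu] itself does not spoil weak mixing: the
    product of the gaps is a supermartingale when the sites of [S] are revealed one by one. *)
Lemma mean_gap_prod A S s0 : separated A ->
  mean (fun s => \prod_(x in A) gap S s s x) <= \prod_(x in A) gap set0 s0 s0 x.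
Proof.
move=> sepA; have [n] := ubnP #|S|; elim: n S => // n IH S Sn.
have [->|[y yS]] := set_0Vmem S.
  rewrite (eq_mean _ (g := fun=> \prod_(x in A) gap set0 s0 s0 x)) ?mean_cst // => s.
  by apply: eq_bigr => x _; apply: gap_agree; apply/agreeP => z; rewrite !inE.
have SE : S = y |: (S :\ y) by rewrite setD1K.
have {}Sn : (#|S :\ y| < n)%N by move: Sn; rewrite (cardsD1 y S) yS.
apply: le_trans (IH _ Sn); rewrite {1}SE.
rewrite (mean_reveal mu_gt0 mu_sum1 (S := S :\ y) (y := y)); last first.
  move=> s t st; apply: eq_bigr => x _.
  by apply: gap_agree; apply: agreeS st; apply: subsetIl.
apply: ler_mean => // s; apply: le_trans (gap_prod_step y sepA _) => [|//].
by rewrite subrr mul0r addr0.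
Qed.

Definition differ V s t := [set x in V | s x != t x].

(** [D] contains [D0] and is connected to it, in terms of cuts: every proper subset of [D]
    containing [D0] has an edge to the rest of [D]. *)
Definition cut_connected (D0 D : {set L}) := D0 \subset D /\
  forall C, D0 \subset C -> C \subset D -> C != D -> exists z z', [/\ z \in C, z' \in D :\: C & e z z'].

Lemma cut_connectedU D0 D y z : z \in D0 -> e z y ->
  cut_connected (y |: D0) D -> cut_connected D0 D.
Proof.
move=> zD0 zy [D0D cutD]; split; first by apply: subset_trans D0D; apply: subsetUr.
move=> C D0C CD CnD; have [yC|yC] := boolP (y \in C).
  by apply: cutD => //; rewrite subUset sub1set yC.
exists z, y; split => //; first exact: (subsetP D0C).
by rewrite inE yC (subsetP D0D) ?setU11.
Qed.

(** Exploring the sites next to known disagreements, two monotonically coupled samples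
    disagree on a random set which is connected to the initial disagreements and whose
    marginals are the differences of the marginals of the samples; the supermartingale
    property of the gaps bounds the probability that it contains given separated sites. *)
Lemma disagreement_law V s t : {in V, forall z, t z -> s z} ->
  exists q : {set L} -> R, [/\ forall D, 0 <= q D,
    forall D, q D != 0 -> cut_connected (differ V s t) D,
    forall j, \sum_(D : {set L} | j \in D) q D = plus V s j - plus V t j &
    forall A, separated A -> \sum_(D : {set L} | A \subset D) q D <= \prod_(x in A) gap V s t x].
Proof.
have [n] := ubnP #|~: V|; elim: n V s t => // n IH V s t Vn ts.
have [/existsP[y /andP[yV /exists_inP[z zD zy]]]|noy] :=
    boolP [exists y, (y \notin V) && [exists z in differ V s t, e z y]].
  have Vy : (#|~: (y |: V)| < n)%N.
    rewrite -ltnS; apply: leq_trans Vn; rewrite ltnS; apply: proper_card.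
    rewrite properE; apply/andP; split.
      by apply/subsetP => x; rewrite !inE negb_or => /andP[].
    by apply/subsetPn; exists y; rewrite ?inE ?eqxx.
  have [q1 [q1p q1c q1m q1A]] := IH _ _ _ Vy (upd_order ts (b := true) (b' := true) id).
  have [q2 [q2p q2c q2m q2A]] := IH _ _ _ Vy (upd_order ts (b := true) (b' := false) (fun=> isT)).
  have [q3 [q3p q3c q3m q3A]] := IH _ _ _ Vy (upd_order ts (b := false) (b' := false) id).
  pose c1 := plus V t y; pose c2 := plus V s y - plus V t y; pose c3 := 1 - plus V s y.
  have c1p : 0 <= c1 by apply: plus_ge0.
  have c2p : 0 <= c2 by rewrite subr_ge0 plus_mono.
  have c3p : 0 <= c3 by rewrite subr_ge0 plus_le1.
  have lin (P : pred {set L}) : \sum_(D | P D) (c1 * q1 D + c2 * q2 D + c3 * q3 D)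
      = c1 * (\sum_(D | P D) q1 D) + c2 * (\sum_(D | P D) q2 D) + c3 * (\sum_(D | P D) q3 D).
    by rewrite !big_split /= -!mulr_sumr.
  exists (fun D => c1 * q1 D + c2 * q2 D + c3 * q3 D); split.
  - by move=> D; apply: addr_ge0; [apply: addr_ge0|]; apply: mulr_ge0.
  - move=> D; have [q1D|q1D] := eqVneq (q1 D) 0; last first.
      move=> _; suff -> : differ V s t = differ (y |: V) (upd s y true) (upd t y true).
        exact: q1c.
      apply/setP => x; rewrite !inE !ffunE.
      by have [->|] := eqVneq x y; rewrite ?(negPf yV).
    have [q3D|q3D] := eqVneq (q3 D) 0; last first.
      move=> _; suff -> : differ V s t = differ (y |: V) (upd s y false) (upd t y false).
        exact: q3c.
      apply/setP => x; rewrite !inE !ffunE.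
      by have [->|] := eqVneq x y; rewrite ?(negPf yV).
    rewrite q1D q3D !mulr0 add0r addr0 mulf_eq0 negb_or => /andP[_ /q2c].
    suff -> : differ (y |: V) (upd s y true) (upd t y false) = y |: differ V s t.
      exact: cut_connectedU zD zy.
    apply/setP => x; rewrite !inE !ffunE.
    by have [->|] := eqVneq x y.
  - move=> j; rewrite lin q1m q2m q3m (plus_reveal mu_gt0 V s y j) (plus_reveal mu_gt0 V t y j).
    by rewrite /c1 /c2 /c3; ring.
  - move=> A sepA; rewrite lin; apply: le_trans (gap_prod_step y sepA ts).
    by apply: lerD; [apply: lerD|]; apply: ler_wpM2l => //; [apply: q1A|apply: q2A|apply: q3A].
pose D0 := differ V s t.
have D0P (P : pred {set L}) : \sum_(D | P D) (D == D0)%:R = (P D0)%:R :> R.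
  rewrite big_mkcond /= (bigD1 D0) //= eqxx big1 ?addr0; first by case: (P D0).
  by move=> D /negPf ->; case: (P D).
exists (fun D => (D == D0)%:R); split.
- by move=> D; rewrite ler0n.
- move=> D; rewrite pnatr_eq0 eqb0 negbK => /eqP ->; split=> // C D0C CD0.
  by rewrite eqEsubset D0C CD0.
- move=> j; rewrite D0P; have [jV|jV] := boolP (j \in V).
    rewrite !plus_in // inE jV /=; move: (ts j jV).
    by case: (s j) (t j) => [] [] //=; rewrite ?subrr ?subr0 // => /(_ isT).
  rewrite inE (negPf jV) /=; apply/esym/eqP; rewrite subr_eq0; apply/eqP.
  (* No revealed disagreement touches an unrevealed site. *)
  apply: (markov_agree mu_gt0 mu_swap (V0 := bdry (~: V)) (B := ~: V)) => //.
  - by apply/subsetP => x; rewrite !inE negbK => /andP[].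
  - by rewrite setICr sub0set.
  - by move=> r r' /agreeP -> //; rewrite !inE jV orbT.
  - apply/agreeP => x; rewrite !inE negbK => /andP[xV /exists_inP[y yV xy]].
    apply/eqP; apply: contraNT noy => sx; apply/existsP; exists y.
    by rewrite inE in yV; rewrite yV; apply/exists_inP; exists x; rewrite ?inE ?xV.
- move=> A _; rewrite D0P; have [/subsetP AD|_] := boolP (A \subset D0); last first.
    by apply: prodr_ge0 => x _; apply: gap_ge0.
  rewrite big1 // => x xA; move: (AD x xA); rewrite inE => /andP[xV sx].
  rewrite /gap !shell_in ?inE ?xV ?ball_self //.
  by move: (ts x xV) sx; case: (s x) (t x) => [] [] //=; rewrite ?subr0 // => /(_ isT).
Qed.

End Disagreement.

(** * Spread walks and influences *)

Section Walks.
Variables (L : finType) (e near hop : rel L) (K : nat).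
Implicit Types (x y z o a : L) (p : seq L) (A C W : {set L}).

(** The [hop]-walks of [m] steps from [o], without their starting point. *)
Fixpoint walks (m : nat) o : seq (seq L) :=
  if m is m'.+1 then flatten [seq [seq x :: p | p <- walks m' x] | x <- enum (hop o)]
  else [:: [::]].

Lemma mem_walks m o p : size p = m -> path hop o p -> p \in walks m o.
Proof.
elim: m o p => [|m IH] o [|x p] //= [sp] /andP[ox xp].
by apply/flatten_mapP; exists x; rewrite ?mem_enum // map_f // IH.
Qed.

Lemma size_walks m o (Delta : nat) : (forall x, #|hop x| <= Delta)%N ->
  (size (walks m o) <= Delta ^ m)%N.
Proof.
move=> deg; elim: m o => [|m IH] o //=.
rewrite size_flatten /shape -map_comp expnS.
apply: (@leq_trans (size (enum (hop o)) * Delta ^ m)); last by rewrite -cardE leq_mul2r deg orbT.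
elim: (enum _) => //= x r IHr; rewrite mulSn leq_add // size_map; exact: IH.
Qed.

Definition trace o p := [set x in o :: p].

Definition spread j o p := (#|trace o p| == j.+1) &&
  [forall x in trace o p, forall y in trace o p, (x != y) ==> ~~ near x y].

Hypotheses (near_refl : reflexive near) (near_sym : symmetric near).
Hypothesis near_card : forall a, (#|[set z | near a z]| <= K)%N.
Hypothesis near_hop : forall a z z', near a z -> e z z' -> hop a z' && hop z' a.

(** As long as the points already chosen do not have all of [W] near them, some edge of [W] leads
    to a point far from all of them, and an excursion to that point can be inserted in the walk
    at the cost of two steps. *)
Lemma spread_walk W o j : cut_connected e [set o] W -> (K * j < #|W|)%N ->
  exists p, [/\ p \in walks (2 * j) o, trace o p \subset W & spread j o p].
Proof.
move=> [oW cutW]; have {}oW : o \in W by rewrite -sub1set.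
suff main : (K * j < #|W|)%N -> exists p,
    [/\ size p = (2 * j)%N, path hop o p, trace o p \subset W & spread j o p].
  by move=> /main[p [sp hp pW sprp]]; exists p; split=> //; apply: mem_walks.
elim: j => [_|j IH jW].
  exists [::]; split=> //.
    by apply/subsetP => x; rewrite !inE => /eqP ->.
  rewrite /spread (_ : trace o [::] = [set o]); last by apply/setP => x; rewrite !inE.
  rewrite cards1 eqxx /=; apply/forall_inP => x /set1P ->; apply/forall_inP => y /set1P ->.
  by rewrite eqxx.
have [|p [sp hp /subsetP pW /andP[/eqP cardp /forall_inP sepp]]] := IH.
  by apply: leq_ltn_trans jW; rewrite leq_mul2l leqnSn orbT.
pose U := \bigcup_(a in trace o p) [set z | near a z].
have cardU : (#|U| <= K * j.+1)%N.
  apply: leq_trans (_ : \sum_(a in trace o p) #|[set z | near a z]| <= _)%N.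
    by rewrite /U; elim/big_rec2: _ => [|a m B _ IHB]; rewrite ?cards0 //;
       apply: leq_trans (leq_card_setU _ _) _; rewrite leq_add2l.
  apply: leq_trans (_ : \sum_(a in trace o p) K <= _)%N; first exact: leq_sum.
  by rewrite sum_nat_const cardp mulnC.
have oU : o \in U by apply/bigcupP; exists o; rewrite !inE ?eqxx.
have [|||z [z' [/setIP[zW /bigcupP[a ap]]]]] := cutW (W :&: U).
- by rewrite sub1set inE oW.
- exact: subsetIl.
- apply: contraTneq jW => WU; rewrite -leqNgt; apply: leq_trans cardU.
  by rewrite subset_leq_card // -WU subsetIr.
rewrite !inE negb_and => az /andP[/orP[/negPf->//|z'U] z'W] zz'.
have far b : b \in trace o p -> ~~ near b z'.
  by move=> bp; apply: contra z'U => bz; apply/bigcupP; exists b => //; rewrite inE.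
have /andP[az' z'a] := near_hop az zz'.
have {}ap : a \in o :: p by rewrite inE in ap.
move: sp hp pW cardp sepp far; case/splitPl: ap => p1 p2 lastp1 sp hp pW cardp sepp far.
exists (p1 ++ [:: z', a & p2]).
have E : trace o (p1 ++ [:: z', a & p2]) = z' |: trace o (p1 ++ p2).
  apply/setP => x; rewrite !inE !mem_cat !inE.
  have : (x == a) -> (x == o) || (x \in p1).
    by move/eqP ->; rewrite -lastp1 -in_cons mem_last.
  case: (x == o) (x \in p1) (x \in p2) (x == z') (x == a) => [] [] [] [] [] //=.
  by move/(_ isT).
have z'p : z' \notin trace o (p1 ++ p2).
  by apply/negP => /far; rewrite near_refl.
split.
- by rewrite size_cat /= !addnS -size_cat sp mulnS.
- by move: hp; rewrite !cat_path /= lastp1 az' z'a => /andP[-> ->].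
- by rewrite E subUset sub1set z'W; apply/subsetP.
- rewrite /spread E cardsU1 z'p cardp eqxx /=.
  apply/forall_inP => x /setU1P xp; apply/forall_inP => y /setU1P yp; apply/implyP => xy.
  case: xp yp xy => [->|xp] [->|yp]; rewrite ?eqxx // => xy.
  + by rewrite near_sym far.
  + exact: far.
  + by move/forall_inP: (sepp x xp) => /(_ y yp) /implyP ->.
Qed.

End Walks.

Section RowSums.
Variables (R : realFieldType) (L : finType) (e near hop : rel L) (K : nat).
Local Notation config := {ffun L -> bool}.
Variables (mu : config -> R) (ball : L -> {set L}).
Hypotheses (mu_gt0 : forall s, 0 < mu s) (mu_sum1 : \sum_s mu s = 1).
Hypotheses (mu_lattice : fkg_lattice mu) (mu_swap : markov_swap e mu).
Hypotheses (near_refl : reflexive near) (near_sym : symmetric near).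
Hypothesis near_card : forall a, (#|[set z | near a z]| <= K)%N.
Hypothesis near_hop : forall a z z', near a z -> e z z' -> hop a z' && hop z' a.
Hypothesis ball_self : forall x, x \in ball x.
Hypothesis ball_near : forall x y, ~~ near x y -> [disjoint ball x & ball y].
Implicit Types (s t : config) (x y z o : L) (S A D : {set L}).

Local Notation mean := (mean mu).
Local Notation plus := (plus mu).
Local Notation gap := (gap e mu ball).

(** Total influence of the spin at [o] when the sites of [S] are frozen to [s]. *)
Definition rowsum S s o :=
  \sum_j (plus (o |: S) (upd s o true) j - plus (o |: S) (upd s o false) j).

(** The union bound over walks that controls the probability of a disagreement set of size
    proportional to [J]; the starting point [o] disagrees by assumption and is not charged. *)
Definition walk_sum J o (w : L -> R) :=
  \sum_(p <- walks hop (2 * J) o | spread near J o p) \prod_(x in trace o p :\ o) w x.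

Lemma spread_separated J o p : spread near J o p -> separated ball (trace o p).
Proof.
case/andP => _ /forall_inP sep x y xp yp xy; apply: ball_near.
by move/forall_inP: (sep x xp) => /(_ y yp) /implyP ->.
Qed.

(** The row sum is the expected number of disagreements created by flipping [o]. If it exceeds
    [2 * K * J], more than half of it comes from disagreement sets of more than [K * J] sites,
    which have at most [#|L|] sites and contain the trace of a spread walk. *)
Lemma rowsum_walk_sum S s o J : (0 < J)%N -> o \notin S -> (2 * K * J)%:R < rowsum S s o ->
  1 <= #|L|%:R * walk_sum J o (gap S s s).
Proof.
move=> J0 oS.
have K0 : (0 < K)%N.
  by apply: leq_trans (near_card o); apply/card_gt0P; exists o; rewrite inE.
have ord : {in o |: S, forall z, upd s o false z -> upd s o true z}.
  by move=> z _; rewrite !ffunE; case: eqP.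
have [q [q0 qc qm qA]] := disagreement_law mu_gt0 mu_lattice mu_swap ball_self ord.
have q1 : \sum_D q D <= 1.
  have sep0 : separated ball set0 by move=> x y; rewrite inE.
  have := qA _ sep0; rewrite big_set0; apply: le_trans; rewrite le_eqVlt; apply/orP; left.
  by apply/eqP; apply: eq_bigl => D; rewrite sub0set.
have -> : rowsum S s o = \sum_D q D * #|D|%:R.
  rewrite /rowsum (eq_bigr (fun j => \sum_(D : {set L} | j \in D) q D)) => [|j _]; last by rewrite qm.
  rewrite (exchange_big_dep xpredT) //=; apply: eq_bigr => D _.
  by rewrite sumr_const mulr_natr.
pose big D := (K * J < #|D|)%N.
have split : \sum_D q D * #|D|%:R <= (K * J)%:R + #|L|%:R * \sum_(D | big D) q D.
  rewrite (bigID big) /= addrC; apply: lerD.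
    apply: le_trans (_ : \sum_(D | ~~ big D) q D * (K * J)%:R <= _).
      apply: ler_sum => D; rewrite -leqNgt => DK; apply: ler_wpM2l => //; by rewrite ler_nat.
    rewrite -mulr_suml -[leRHS]mul1r; apply: ler_wpM2r; first by rewrite ler0n.
    apply: le_trans q1; rewrite [leRHS](bigID big) /= lerDr; exact: sumr_ge0.
  rewrite mulrC mulr_suml; apply: ler_sum => D _; apply: ler_wpM2l => //.
  by rewrite ler_nat max_card.
have tail : \sum_(D | big D) q D <= walk_sum J o (gap S s s).
  have step p : spread near J o p ->
      \sum_(D : {set L} | trace o p :\ o \subset D) q D <= \prod_(x in trace o p :\ o) gap S s s x.
    move=> /spread_separated sep.
    have sepo : separated ball (trace o p :\ o).
      by move=> x y /setD1P[_ xp] /setD1P[_ yp]; apply: sep.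
    apply: le_trans (qA _ sepo) _; rewrite le_eqVlt; apply/orP; left; apply/eqP.
    apply: eq_bigr => x /setD1P[xo xp]; apply: gap_out.
    have op : o \in trace o p by rewrite !inE eqxx.
    by have := sep _ _ xp op xo => /disjointFl ->.
  rewrite /walk_sum; apply: le_trans (ler_sum _ (fun p => @step p)).
  rewrite (eq_bigr (fun p => \sum_(D : {set L}) (trace o p :\ o \subset D)%:R * q D)) => [|p _]; last first.
    rewrite [LHS]big_mkcond /=; apply: eq_bigr => D _.
    by case: ifP; rewrite ?mul1r ?mul0r.
  rewrite exchange_big /= [leLHS]big_mkcond /=; apply: ler_sum => D _.
  have nn p : 0 <= (trace o p :\ o \subset D)%:R * q D by rewrite mulr_ge0 ?ler0n.
  case: ifP => [bD|_]; last by apply: sumr_ge0.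
  have [->|qD] := eqVneq (q D) 0.
    by apply: sumr_ge0 => p _; rewrite mulr0.
  have Dc : cut_connected e [set o] D.
    suff <- : differ (o |: S) (upd s o true) (upd s o false) = [set o] by apply: qc.
    apply/setP => x; rewrite !inE !ffunE; case: eqVneq => //= _.
    by rewrite eqxx andbF.
  have [p [pw pD pS]] := spread_walk near_refl near_sym near_card near_hop Dc bD.
  rewrite (big_rem p pw) /= pS (subset_trans (subsetDl _ _) pD) mul1r lerDl.
  exact: sumr_ge0.
move=> big_row; have : (2 * K * J)%:R <= (K * J)%:R + #|L|%:R * walk_sum J o (gap S s s) :> R.
  apply: le_trans (ltW big_row) (le_trans split _).
  by rewrite lerD2l ler_wpM2l ?ler0n.
have -> : (2 * K * J = K * J + K * J)%N by lia.
rewrite natrD lerD2l; apply: le_trans; rewrite ler1n muln_gt0; exact/andP.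
Qed.

Lemma gap_sym_ge0 S s x : 0 <= gap S s s x.
Proof. exact: gap_ge0. Qed.

Lemma walk_sum_ge0 J o w : (forall x, 0 <= w x) -> 0 <= walk_sum J o w.
Proof. by move=> w0; apply: sumr_ge0 => p _; apply: prodr_ge0. Qed.

(** When [S] is frozen to a sample of [mu], averaging removes [S] from the gaps, so that large
    row sums are as unlikely as the weak mixing of [mu] alone makes them. *)
Lemma rowsum_tail S s0 J : (0 < J)%N ->
  mean (fun s => [exists o, (o \notin S) && ((2 * K * J)%:R < rowsum S s o)]%:R)
  <= #|L|%:R * \sum_o walk_sum J o (gap set0 s0 s0).
Proof.
move=> J0; apply: le_trans (_ : mean (fun s => #|L|%:R * \sum_o walk_sum J o (gap S s s)) <= _).
  apply: ler_mean => // s; case: existsP => [[ o /andP[oS big]]|_] /=.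
    apply: le_trans (rowsum_walk_sum J0 oS big) _; rewrite ler_wpM2l ?ler0n //.
    rewrite (bigD1 o) //= lerDl; apply: sumr_ge0 => o' _.
    by apply: walk_sum_ge0 => x; apply: gap_sym_ge0.
  rewrite mulr_ge0 ?ler0n // sumr_ge0 // => o _.
  by apply: walk_sum_ge0 => x; apply: gap_sym_ge0.
rewrite meanZ // ler_wpM2l ?ler0n // mean_sum //; apply: ler_sum => o _.
rewrite /walk_sum (eq_mean _ (g := fun s => \sum_(p < size (walks hop (2 * J) o) | 
   spread near J o (nth [::] (walks hop (2 * J) o) p))
   \prod_(x in trace o (nth [::] (walks hop (2 * J) o) p) :\ o) gap S s s x)); last first.
  by move=> s; rewrite (big_nth [::]) big_mkord.
rewrite mean_sum // (big_nth [::]) big_mkord; apply: ler_sum => i sp.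
apply: mean_gap_prod => // x y /setD1P[_ xp] /setD1P[_ yp].
exact: (spread_separated sp).
Qed.

End RowSums.

(** * Spectral independence and random freezing *)

Section Variance.
Variables (R : realFieldType) (L : finType).
Local Notation config := {ffun L -> bool}.
Variable mu : config -> R.
Hypotheses (mu_gt0 : forall s, 0 < mu s) (mu_sum1 : \sum_s mu s = 1).
Implicit Types (s t : config) (x y z o : L) (V W S A D : {set L}) (f g : config -> R).

Local Notation cexp := (cexp mu).
Local Notation mean := (mean mu).
Local Notation plus := (plus mu).

Definition cov S f g s := cexp S (fun t => f t * g t) s - cexp S f s * cexp S g s.

(** Expected conditional variance of [f] given the spins in [S]. *)
Definition cvar f S := mean (fun s => f s ^+ 2) - mean (fun s => cexp S f s ^+ 2).

Lemma covC S f g s : cov S f g s = cov S g f s.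
Proof. by rewrite /cov [_ * cexp S g s]mulrC; congr (_ - _); apply: eq_cexp => t _; rewrite mulrC. Qed.

Lemma cov_ge0 S f s : 0 <= cov S f f s.
Proof.
have : 0 <= cexp S (fun t => (f t - cexp S f s) * (f t - cexp S f s)) s.
  by apply: cexp_ge0 => // t _; rewrite -expr2 sqr_ge0.
rewrite (eq_cexp _ (g := fun t => f t * f t - (2 * cexp S f s * f t - cexp S f s ^+ 2))).
  by rewrite !cexpB // cexpZ // cexp_cst // => H; apply: le_trans H _; rewrite /cov; lra.
by move=> t _; ring.
Qed.

Lemma cov_sumr S f (P : pred L) (c : L -> R) (X : L -> config -> R) s :
  cov S f (fun t => \sum_(i | P i) c i * X i t) s = \sum_(i | P i) c i * cov S f (X i) s.
Proof.
rewrite /cov cexp_sum // (eq_cexp _ (g := fun t => \sum_(i | P i) c i * (f t * X i t))); last first.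
  by move=> t _; rewrite mulr_sumr; apply: eq_bigr => i _; rewrite mulrCA.
rewrite cexp_sum // mulr_sumr -sumrB; apply: eq_bigr => i _.
by rewrite !cexpZ //; ring.
Qed.

Lemma cov_sub S f g (a : R) s :
  cov S (fun t => f t - a * g t) (fun t => f t - a * g t) s
  = cov S f f s - 2 * a * cov S f g s + a ^+ 2 * cov S g g s.
Proof.
rewrite /cov (eq_cexp _ (g := fun t => f t * f t + (a ^+ 2 * (g t * g t) - 2 * a * (f t * g t)))).
  by rewrite !(cexpB, cexpZ, cexpD); ring.
by move=> t _; ring.
Qed.

Local Notation bit i := (fun t : config => (t i)%:R : R).

Definition flip_diff S f s i := cexp (i |: S) f (upd s i true) - cexp (i |: S) f (upd s i false).

Lemma cov_bit S f s i : cov S f (bit i) s = plus S s i * (1 - plus S s i) * flip_diff S f s i.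
Proof.
rewrite /cov -/(plus S s i) (cexp_reveal mu_gt0 S (fun t => f t * _) s i).
rewrite (cexp_reveal mu_gt0 S f s i) /flip_diff.
have E b : cexp (i |: S) (fun t => f t * (t i)%:R) (upd s i b) = b%:R * cexp (i |: S) f (upd s i b).
  rewrite (eq_cexp _ (g := fun t => b%:R * f t)) ?cexpZ // => t /agreeP ->.
    by rewrite updE mulrC.
  exact: setU11.
by rewrite !E /=; ring.
Qed.

(** The part of the conditional variance of [f] given [S] that the spin at [i] explains. *)
Definition loss S i f s := cexp S (fun t => cexp (i |: S) f t ^+ 2) s - cexp S f s ^+ 2.

Lemma lossE S i f s :
  loss S i f s = plus S s i * (1 - plus S s i) * flip_diff S f s i ^+ 2.
Proof.
rewrite /loss !(cexp_reveal mu_gt0 S _ s i) /flip_diff.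
have E b : cexp (i |: S) (fun t => cexp (i |: S) f t ^+ 2) (upd s i b)
    = cexp (i |: S) f (upd s i b) ^+ 2.
  by rewrite cexp_id // => t tb; congr (_ ^+ 2); apply: cexp_agree.
by rewrite !E; ring.
Qed.

Lemma loss_le S i f s : loss S i f s <= cov S f f s.
Proof.
rewrite /loss /cov -expr2 lerD2r -(cexp_tower mu_gt0 (fun t => f t * f t) s (subsetUr [set i] S)).
by apply: ler_cexp => // t _; have := cov_ge0 (i |: S) f t; rewrite /cov -expr2 subr_ge0.
Qed.

Lemma cvarE S f : cvar f S = mean (cov S f f).
Proof.
rewrite /cov meanB // mean_cexp //; congr (_ - _); apply: eq_mean => s; exact: expr2.
Qed.

Lemma cvar_ge0 S f : 0 <= cvar f S.
Proof. by rewrite cvarE; apply: mean_ge0 => // s; apply: cov_ge0. Qed.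

Lemma cvarB S i f : cvar f S - cvar f (i |: S) = mean (loss S i f).
Proof.
by rewrite /cvar /loss meanB // mean_cexp //; ring.
Qed.

Lemma cov_osc S f s (a w : R) : (forall t, a <= f t <= a + w) -> cov S f f s <= w ^+ 2.
Proof.
move=> fw; have := cexp_ge0 mu_gt0 (V := S) (f := fun t => w ^+ 2 - (f t - a) ^+ 2) (s := s).
have -> : cexp S (fun t => w ^+ 2 - (f t - a) ^+ 2) s
    = w ^+ 2 - (cov S f f s + (cexp S f s - a) ^+ 2).
  rewrite (eq_cexp _ (g := fun t => w ^+ 2 - (f t * f t - (2 * a * f t - a ^+ 2)))).
    by rewrite !cexpB // !cexpZ // !cexp_cst // /cov; ring.
  by move=> t _; ring.
move=> H; have {}H := H _; rewrite subr_ge0 in H; apply: le_trans (H _).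
  by rewrite lerDl sqr_ge0.
by move=> t _; rewrite subr_ge0; have /andP[a1 a2] := fw t; rewrite ler_sqr ?nnegrE; lra.
Qed.

Lemma cvar_osc S f (a w : R) : (forall t, a <= f t <= a + w) -> cvar f S <= w ^+ 2.
Proof.
move=> fw; rewrite cvarE -(mean_cst mu_gt0 mu_sum1 (w ^+ 2)); apply: ler_mean => // s.
exact: cov_osc fw.
Qed.

Hypothesis mu_lattice : fkg_lattice mu.

Local Notation rowsum := (rowsum mu).

(** Spectral independence. Since the covariances of the spins are nonnegative, the largest
    eigenvalue of the covariance matrix relative to its diagonal is at most the largest row
    sum of influences, and by duality this bounds the variance explained by single spins. *)
Lemma sum_loss_rowsum S f s (lam : R) : 0 < lam ->
  (forall o, o \notin S -> rowsum S s o <= lam) -> \sum_i loss S i f s <= lam * cov S f f s.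
Proof.
move=> lam0 row; pose c := flip_diff S f s; pose V i := plus S s i * (1 - plus S s i).
have V0 i : 0 <= V i by rewrite mulr_ge0 ?subr_ge0 ?plus_ge0 ?plus_le1.
have -> : \sum_i loss S i f s = \sum_(i | i \notin S) c i ^+ 2 * V i.
  rewrite (bigID (mem S)) /= big1 ?add0r.
    by apply: eq_bigr => i _; rewrite lossE mulrC.
  by move=> i iS; rewrite lossE plus_in //; case: (s i); rewrite ?subrr ?(mulr0, mul0r).
set Q := \sum_(i | _) _.
pose X t := \sum_(i | i \notin S) c i * (t i)%:R : R.
have fX : cov S f X s = Q.
  by rewrite cov_sumr; apply: eq_bigr => i _; rewrite cov_bit -/(c i) -/(V i); ring.
pose C i j := cov S (bit i) (bit j) s.
have CC i j : C i j = C j i by apply: covC.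
have CE i j : C j i = V i * (plus (i |: S) (upd s i true) j - plus (i |: S) (upd s i false) j).
  by rewrite /C cov_bit.
have C0 i j : 0 <= C i j.
  rewrite CE mulr_ge0 // subr_ge0; apply: plus_mono => // z _.
  by rewrite !ffunE; case: eqP.
have XX : cov S X X s <= lam * Q.
  rewrite cov_sumr; under eq_bigr => i _ do rewrite covC cov_sumr mulr_sumr.
  apply: le_trans (_ : \sum_(i | i \notin S) \sum_(j | j \notin S)
     (c i ^+ 2 * C j i / 2 + c j ^+ 2 * C i j / 2) <= _).
    apply: ler_sum => i _; apply: ler_sum => j _; rewrite -/(C i j) [C j i]CC.
    have := C0 i j; have : 0 <= (c i - c j) ^+ 2 by apply: sqr_ge0.
    move=> sq Cij; have := mulr_ge0 sq Cij; nra.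
  under eq_bigr => i _ do rewrite big_split /=.
  rewrite big_split /= [X in _ + X]exchange_big /= -big_split /= mulr_sumr.
  apply: ler_sum => i iS; rewrite -big_split /=.
  under eq_bigr => j _ do rewrite -splitr CE mulrA.
  rewrite -mulr_sumr mulrC; apply: ler_wpM2r; first by rewrite mulr_ge0 ?sqr_ge0.
  apply: le_trans (row i iS); rewrite [leRHS](bigID (fun j => j \notin S)) /= lerDl.
  apply: sumr_ge0 => j _; rewrite subr_ge0; apply: plus_mono => // z _.
  by rewrite !ffunE; case: eqP.
have := cov_ge0 S (fun t => f t - lam^-1 * X t) s; rewrite cov_sub fX.
have XX' : lam^-1 ^+ 2 * cov S X X s <= lam^-1 * Q.
  have -> : lam^-1 * Q = lam^-1 ^+ 2 * (lam * Q) by field; rewrite gt_eqF.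
  by rewrite ler_wpM2l ?sqr_ge0.
move=> ge0; have : lam^-1 * Q <= cov S f f s by lra.
by rewrite mulrC ler_pdivrMr // mulrC.
Qed.

(** The row sums are moderate except with probability [b], in which case the trivial bound
    [w ^+ 2] on each of the [#|L|] terms is used. *)
Lemma sum_drop S f (lam a w b : R) : 0 < lam -> (forall t, a <= f t <= a + w) ->
  mean (fun s => [exists o, (o \notin S) && (lam < rowsum S s o)]%:R) <= b ->
  \sum_i (cvar f S - cvar f (i |: S)) <= lam * cvar f S + #|L|%:R * w ^+ 2 * b.
Proof.
move=> lam0 fw bad.
have bad' := ler_wpM2l (mulr_ge0 (ler0n R #|L|) (sqr_ge0 w)) bad.
apply: le_trans (lerD (lexx _) bad').
have -> : \sum_i (cvar f S - cvar f (i |: S)) = mean (fun s => \sum_i loss S i f s).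
  by rewrite mean_sum //; apply: eq_bigr => i _; apply: cvarB.
rewrite cvarE -!meanZ // -meanD //.
apply: ler_mean => // s; case: existsP => [_|good] /=.
  rewrite mulr1; apply: le_trans (_ : #|L|%:R * w ^+ 2 <= _).
    rewrite -sum1_card natr_sum mulr_suml; apply: ler_sum => i _; rewrite mul1r.
    exact: le_trans (loss_le _ _ _ _) (cov_osc _ _ fw).
  by rewrite lerDr mulr_ge0 ?cov_ge0 // ltW.
rewrite mulr0 addr0; apply: sum_loss_rowsum => // o oS; rewrite leNgt; apply/negP => big.
by apply: good; exists o; rewrite oS.
Qed.

(** One step of random freezing: with probability 1/4, a uniform site is added to [S]. The
    laziness keeps the relative loss of variance in one step away from 1. *)
Definition freeze (F : {set L} -> R) S := 3 / 4 * F S + (4 * #|L|%:R)^-1 * \sum_i F (i |: S).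

Lemma ler_freeze m (F G : {set L} -> R) S :
  (forall T, F T <= G T) -> iter m freeze F S <= iter m freeze G S.
Proof.
elim: m S => [|m IH] S FG //=; rewrite /freeze; apply: lerD.
  by rewrite ler_wpM2l ?IH //; lra.
rewrite ler_wpM2l ?invr_ge0 ?mulr_ge0 ?ler0n //; apply: ler_sum => i _; exact: IH.
Qed.

Lemma freezeD m (F G : {set L} -> R) (a b : R) S :
  iter m freeze (fun T => a * F T + b * G T) S = a * iter m freeze F S + b * iter m freeze G S.
Proof.
elim: m S => [|m IH] S //=; rewrite /freeze IH (eq_bigr _ (fun i _ => IH (i |: S))).
by rewrite big_split /= -!mulr_sumr; ring.
Qed.

Hypothesis L0 : (0 < #|L|)%N.

Lemma freeze_cst m (a : R) S : iter m freeze (fun=> a) S = a.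
Proof.
elim: m S => [|m IH] S //=; rewrite /freeze IH (eq_bigr _ (fun i _ => IH (i |: S))).
rewrite sumr_const -mulr_natl; field.
by rewrite pnatr_eq0 -lt0n.
Qed.

Lemma freeze_sum m (I : eqType) (r : seq I) (P : pred I) (F : I -> {set L} -> R) S :
  iter m freeze (fun T => \sum_(i <- r | P i) F i T) S = \sum_(i <- r | P i) iter m freeze (F i) S.
Proof.
elim: m S => [|m IH] S //=; rewrite /freeze IH (eq_bigr _ (fun i _ => IH (i |: S))).
by rewrite exchange_big /= !mulr_sumr -big_split.
Qed.

(** A uniform site explains on average a fraction of the variance of the order of the row sums
    divided by [#|L|]; that it explains at most all of it gives the minimum with [#|L|]. *)
Lemma freeze_cvar m f (lam a w b : R) : 0 < lam -> (forall t, a <= f t <= a + w) -> 0 <= b ->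
  (forall S, mean (fun s => [exists o, (o \notin S) && (lam < rowsum S s o)]%:R) <= b) ->
  (1 - Num.min lam #|L|%:R / (4 * #|L|%:R)) * iter m freeze (cvar f) set0 - w ^+ 2 * b / 4
  <= iter m.+1 freeze (cvar f) set0.
Proof.
move=> lam0 fw b0 bad; rewrite iterSr.
set z := 1 - _; have N0 : 0 < #|L|%:R :> R by rewrite ltr0n.
apply: le_trans (_ : iter m freeze (fun S => z * cvar f S + (- (w ^+ 2 * b / 4)) * 1) set0 <= _).
  by rewrite freezeD freeze_cst mulr1.
apply: ler_freeze => S; rewrite mulr1 /freeze.
have -> : \sum_i cvar f (i |: S) = #|L|%:R * cvar f S - \sum_i (cvar f S - cvar f (i |: S)).
  rewrite [X in _ - X]sumrB sumr_const -[cvar f S *+ _]mulr_natl; ring.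
have v0 := cvar_ge0 S f.
have drop1 := sum_drop lam0 fw (bad S).
have drop2 : \sum_i (cvar f S - cvar f (i |: S)) <= #|L|%:R * cvar f S.
  rewrite -sum1_card natr_sum mulr_suml; apply: ler_sum => i _.
  by rewrite mul1r gerBl cvar_ge0.
have wb : 0 <= #|L|%:R * w ^+ 2 * b by apply: mulr_ge0 => //; apply: mulr_ge0; rewrite ?ler0n ?sqr_ge0.
set Dr := \sum_i _ in drop1 drop2 *.
have {drop1 drop2} drop : Dr <= Num.min lam #|L|%:R * cvar f S + #|L|%:R * w ^+ 2 * b.
  by rewrite /Num.min; case: ifP => _ //; apply: le_trans drop2 _; rewrite lerDl.
have {}drop : (4 * #|L|%:R)^-1 * Dr <=
    Num.min lam #|L|%:R / (4 * #|L|%:R) * cvar f S + w ^+ 2 * b / 4.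
  have -> : Num.min lam #|L|%:R / (4 * #|L|%:R) * cvar f S + w ^+ 2 * b / 4
     = (4 * #|L|%:R)^-1 * (Num.min lam #|L|%:R * cvar f S + #|L|%:R * w ^+ 2 * b).
    by field; rewrite gt_eqF.
  by rewrite ler_wpM2l ?invr_ge0 ?mulr_ge0 ?ler0n.
have -> : 3 / 4 * cvar f S + (4 * #|L|%:R)^-1 * (#|L|%:R * cvar f S - Dr) =
    cvar f S - (4 * #|L|%:R)^-1 * Dr by field; rewrite gt_eqF.
by rewrite /z mulrBl mul1r; lra.
Qed.

End Variance.

(** * Variance of small unfrozen clusters *)

Section Clusters.
Variables (R : realFieldType) (L : finType) (e : rel L).
Local Notation config := {ffun L -> bool}.
Variable mu : config -> R.
Hypotheses (mu_gt0 : forall s, 0 < mu s) (mu_sum1 : \sum_s mu s = 1).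
Hypotheses (e_sym : symmetric e) (mu_swap : markov_swap e mu).
Implicit Types (s t : config) (x y z i : L) (V W S T X Y C D : {set L}) (f g : config -> R).

Local Notation cexp := (cexp mu).
Local Notation mean := (mean mu).
Local Notation plus := (plus mu).
Local Notation cvar := (cvar mu).
Local Notation bdry := (bdry e).

Lemma mean_cexpM V f g : mean (fun s => cexp V f s * g s) = mean (fun s => cexp V f s * cexp V g s).
Proof.
rewrite -(mean_cexp mu_gt0 mu_sum1 V); apply: eq_mean => s; apply: cexpMl => t; exact: cexp_agree.
Qed.

Lemma cvar_proj V f : cvar f V = mean (fun s => (f s - cexp V f s) ^+ 2).
Proof.
rewrite (eq_mean _ (g := fun s => f s ^+ 2 - (2 * (cexp V f s * f s) - cexp V f s ^+ 2))).
  rewrite !meanB // meanZ // mean_cexpM /cvar.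
  rewrite -(eq_mean _ (fun s => expr2 (cexp V f s))); ring.
by move=> s; ring.
Qed.

(** Independent blocks: if [B] and [T] partition the sites outside [S] and have no edge
    between them, the projections on [S :|: B] and on [S :|: T] commute with product the
    projection on [S], which makes the variance subadditive. *)
Lemma cvar_blocks S B T f : ~: S = B :|: T -> [disjoint B & T] -> bdry B \subset S ->
  cvar f S <= cvar f (S :|: B) + cvar f (S :|: T).
Proof.
move=> SBT dBT BS; pose PB := cexp (S :|: B) f; pose PT := cexp (S :|: T) f; pose P := cexp S f.
have BnS x : x \in B -> x \notin S by move=> xB; move/setP/(_ x): SBT; rewrite !inE xB.
have PTPB s : cexp (S :|: T) PB s = P s.
  rewrite (markov_restrict mu_gt0 mu_swap (V0 := S) (B := B)) //.
  - by apply: cexp_tower => //; apply: subsetUl.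
  - exact: subsetUl.
  - apply/subsetP => x; rewrite !inE => /andP[/orP[//|xT] xB].
    by have := disjointFr dBT xB; rewrite xT.
  - by move=> r r' rr; apply: cexp_agree.
have PP W g s : S \subset W -> cexp S (cexp W g) s = cexp S g s.
  by move=> SW; apply: cexp_tower.
have SB : S \subset S :|: B by apply: subsetUl.
have ST : S \subset S :|: T by apply: subsetUl.
have PBf : mean (fun s => PB s * f s) = mean (fun s => PB s ^+ 2).
  by rewrite mean_cexpM; apply: eq_mean => s; rewrite expr2.
have PTf : mean (fun s => PT s * f s) = mean (fun s => PT s ^+ 2).
  by rewrite mean_cexpM; apply: eq_mean => s; rewrite expr2.
have Pf g : (forall s, cexp S g s = P s) -> mean (fun s => P s * g s) = mean (fun s => P s ^+ 2).
  by move=> gP; rewrite mean_cexpM; apply: eq_mean => s; rewrite gP expr2.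
have PTPB2 : mean (fun s => PT s * PB s) = mean (fun s => P s ^+ 2).
  rewrite mean_cexpM -(Pf PT); last by move=> s; apply: PP.
  by apply: eq_mean => s; rewrite PTPB mulrC.
have : 0 <= mean (fun s => (f s - PB s - PT s + P s) ^+ 2) by apply: mean_ge0 => // s; apply: sqr_ge0.
rewrite (eq_mean _ (g := fun s => (f s ^+ 2 + PB s ^+ 2 + PT s ^+ 2 + P s ^+ 2)
  + 2 * (PT s * PB s) + 2 * (P s * f s) - 2 * (PB s * f s) - 2 * (PT s * f s)
  - 2 * (P s * PB s) - 2 * (P s * PT s))); last by move=> s; ring.
rewrite !(meanB, meanD, meanZ) // PBf PTf PTPB2 !Pf //; try by move=> s; apply: PP.
by rewrite /cvar -/PB -/PT -/P; lra.
Qed.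

(** The conditional probabilities of a spin given all the others vary by a factor at most
    [k0]: the external field cancels in their ratios. *)
Variable k0 : R.
Hypothesis plus_ratio : forall i s t, plus (~: [set i]) s i <= k0 * plus (~: [set i]) t i /\
  1 - plus (~: [set i]) s i <= k0 * (1 - plus (~: [set i]) t i).

Local Notation k := (1 + 2 * k0 ^+ 2).

Lemma k_ge1 : 1 <= k.
Proof. by rewrite lerDl mulr_ge0 // sqr_ge0. Qed.

(** Freezing one site costs a bounded factor: the component of [f] along the spin at [i]
    retains a fraction [k0 ^- 2] of its norm after subtracting its average over that spin
    given all the others. *)
Lemma cvar_site S i f : i \notin S -> cvar f S <= k * (cvar f (i |: S) + cvar f (~: [set i])).
Proof.
move=> iS; pose Q := cexp (~: [set i]); pose Pi := cexp (i |: S) f; pose P := cexp S f.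
pose c s := flip_diff mu S f s i; pose p s := plus S s i; pose q s := plus (~: [set i]) s i.
have Si : S \subset ~: [set i] by rewrite subsetC sub1set inE.
have PiE s : Pi s = cexp (i |: S) f (upd s i false) + c s * (s i)%:R.
  rewrite /Pi /c /flip_diff -{1}(upd_id s i).
  by case: (s i); rewrite ?mulr1 ?mulr0 ?addr0 // addrC subrK.
have gE s : Pi s - P s = c s * ((s i)%:R - p s).
  by rewrite PiE /P (cexp_reveal mu_gt0 S f s i) -/(p s) /c /flip_diff; ring.
have updS s t b : agree S t s -> agree (i |: S) (upd t i b) (upd s i b).
  by move=> /agreeP ts; apply/agreeP => x; rewrite in_setU1 !ffunE; case: eqP => // _ /ts.
have c_agree s t : agree S t s -> c t = c s.
  by move=> ts; rewrite /c /flip_diff !(cexp_agree _ _ (updS _ _ _ ts)).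
have p_agree s t : agree S t s -> p t = p s by move=> ts; apply: cexp_agree.
have q_agree s t : agree (~: [set i]) t s -> q t = q s by move=> ts; apply: cexp_agree.
have QgE s : Q (fun t => Pi t - P t) s = c s * (q s - p s).
  rewrite /Q (eq_cexp _ (g := fun t => (c t * (t i)%:R) - c t * p t)); last first.
    by move=> t _; rewrite gE; ring.
  rewrite cexpB // (@cexpMl _ _ _ _ _ c); last by move=> t /(agreeS Si)/c_agree.
  rewrite (@cexp_id _ _ mu mu_gt0 _ (fun t => c t * p t)); last first.
    by move=> t /(agreeS Si) ts; rewrite (c_agree _ _ ts) (p_agree _ _ ts).
  by rewrite -/(plus (~: [set i]) s i) -/(q s); ring.
have lossE' : cvar f S - cvar f (i |: S) = mean (fun s => c s ^+ 2 * (p s * (1 - p s))).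
  by rewrite cvarB //; apply: eq_mean => s; rewrite lossE // mulrC.
have pq s : p s * (1 - p s) <= k0 ^+ 2 * (q s * (1 - q s)).
  have pE : p s = cexp S q s by rewrite /q /plus cexp_tower.
  have p1 : p s <= k0 * q s.
    rewrite pE -(cexp_cst mu_gt0 S (k0 * q s) s); apply: ler_cexp => // t _.
    by case: (plus_ratio i t s).
  have p2 : 1 - p s <= k0 * (1 - q s).
    rewrite pE -{1}(cexp_cst mu_gt0 S 1 s) -cexpB // -(cexp_cst mu_gt0 S (k0 * (1 - q s)) s).
    by apply: ler_cexp => // t _; case: (plus_ratio i t s).
  have -> : k0 ^+ 2 * (q s * (1 - q s)) = (k0 * q s) * (k0 * (1 - q s)) by ring.
  by apply: ler_pM => //; rewrite ?subr_ge0 ?plus_ge0 ?plus_le1.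
have res : mean (fun s => c s ^+ 2 * (q s * (1 - q s))) = cvar (fun t => Pi t - P t) (~: [set i]).
  rewrite cvar_proj.
  rewrite [RHS](eq_mean _ (g := fun s => c s ^+ 2 * ((s i)%:R - q s) ^+ 2)); last first.
    by move=> s; rewrite -[cexp _ _ _]/(Q (fun t => Pi t - P t) s) QgE gE; ring.
  rewrite -(mean_cexp mu_gt0 mu_sum1 (~: [set i]) (fun s => c s ^+ 2 * ((s i)%:R - q s) ^+ 2)).
  apply: eq_mean => s; rewrite (@cexpMl _ _ _ _ _ (fun t => c t ^+ 2)); last first.
    by move=> t /(agreeS Si)/c_agree ->.
  rewrite (eq_cexp _ (g := fun t => (1 - 2 * q s) * (t i)%:R + q s ^+ 2)); last first.
    by move=> t /q_agree ->; case: (t i) => /=; ring.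
  by rewrite cexpD // cexpZ // cexp_cst // -/(plus (~: [set i]) s i) -/(q s); ring.
have bound : cvar (fun t => Pi t - P t) (~: [set i])
    <= 2 * cvar f (~: [set i]) + 2 * cvar f (i |: S).
  have proj_le g : cvar g (~: [set i]) <= mean (fun s => g s ^+ 2).
    by rewrite /cvar gerBl; apply: mean_ge0 => // s; apply: sqr_ge0.
  have -> : cvar f (i |: S) = mean (fun s => (f s - Pi s) ^+ 2) by rewrite cvar_proj.
  apply: le_trans (lerD (lexx _) (ler_wpM2l (ler0n _ 2) (proj_le (fun s => f s - Pi s)))).
  rewrite !cvar_proj -!meanZ // -meanD //; apply: ler_mean => // s.
  have -> : cexp (~: [set i]) (fun t => Pi t - P t) s = Q Pi s - P s.
    rewrite cexpB //; congr (_ - _); apply: cexp_id => // t ts.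
    by apply: cexp_agree => //; apply: agreeS ts.
  rewrite cexpB // -/(Q f s) -/(Q Pi s).
  set u := f s - Q f s; set v := f s - Pi s - (Q f s - Q Pi s).
  have -> : Pi s - P s - (Q Pi s - P s) = u - v by rewrite /u /v; ring.
  have : 0 <= (u + v) ^+ 2 by apply: sqr_ge0.
  by nra.
have : cvar f S - cvar f (i |: S) <= k0 ^+ 2 * (2 * cvar f (~: [set i]) + 2 * cvar f (i |: S)).
  rewrite lossE'; apply: le_trans (ler_wpM2l (sqr_ge0 k0) bound).
  rewrite -res -meanZ //; apply: ler_mean => // s; rewrite [leRHS]mulrCA.
  by rewrite ler_wpM2l ?sqr_ge0.
have v1 := cvar_ge0 mu_gt0 mu_sum1 (i |: S) f; have v2 := cvar_ge0 mu_gt0 mu_sum1 (~: [set i]) f.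
by have := sqr_ge0 k0; nra.
Qed.

Lemma cvar_full f : cvar f setT = 0.
Proof.
rewrite /cvar; apply/eqP; rewrite subr_eq0; apply/eqP/eq_mean => s; congr (_ ^+ 2).
rewrite cexp_id // => t /agreeP st; congr f; apply/ffunP => x.
by rewrite st // inE.
Qed.

(** Freezing the sites outside [S] one after the other. *)
Lemma cvar_sites S f : cvar f S <= k ^+ #|~: S| * \sum_(i in ~: S) cvar f (~: [set i]).
Proof.
have [n] := ubnP #|~: S|; elim: n S => // n IH S Sn.
have [/eqP S0|[i]] := set_0Vmem (~: S).
  move: S0; rewrite -setCT (inj_eq (@setC_inj _)) => /eqP ->.
  by rewrite cvar_full setCT cards0 big_set0 mulr0.
move=> iS; have iS' : i \notin S by rewrite inE in iS.
have SE : ~: (i |: S) = ~: S :\ i by apply/setP => x; rewrite !inE negb_or andbC.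
have cS : #|~: S| = #|~: (i |: S)|.+1 by rewrite SE (cardsD1 i (~: S)) iS.
have Sn' : (#|~: (i |: S)| < n)%N by rewrite -ltnS -cS.
have {}IH := IH _ Sn'.
apply: le_trans (cvar_site f iS') _; rewrite cS (exprS k) -mulrA.
rewrite ler_pM2l ?(lt_le_trans ltr01 k_ge1) // (big_setD1 i iS) /= -SE mulrDr addrC.
apply: lerD; last exact: IH.
by apply: ler_peMl; [apply: cvar_ge0|apply: exprn_ege1; apply: k_ge1].
Qed.

(** The cluster of [i] outside [S], grown one site at a time. *)
Lemma cut_connected_cluster S i : i \notin S -> exists C, [/\ cut_connected e [set i] C,
  C \subset ~: S & forall z y, z \in C -> e z y -> y \notin S -> y \in C].
Proof.
move=> iS; suff main C : cut_connected e [set i] C -> C \subset ~: S -> exists C,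
    [/\ cut_connected e [set i] C, C \subset ~: S &
        forall z y, z \in C -> e z y -> y \notin S -> y \in C].
  apply: (main [set i]); last by rewrite sub1set inE.
  by split=> // C iC Ci; rewrite eqEsubset iC Ci.
have [n] := ubnP #|~: S :\: C|; elim: n C => // n IH C Cn [iC cutC] CS.
have [/existsP[z /existsP[y /and4P[zC zy yS yC]]]|closed] :=
  boolP [exists z, exists y, [&& z \in C, e z y, y \notin S & y \notin C]]; last first.
  exists C; split=> // z y zC zy yS; apply: contraNT closed => yC.
  by apply/existsP; exists z; apply/existsP; exists y; rewrite zC zy yS.
apply: (IH (y |: C)).
- rewrite -ltnS; apply: leq_trans Cn; rewrite ltnS; apply: proper_card; rewrite properE.
  apply/andP; split.
    by apply/subsetP => x; rewrite !inE negb_or -andbA => /and3P[_ -> ->].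
  by apply/subsetPn; exists y; rewrite !inE ?eqxx ?yC.
- split; first exact: subset_trans iC (subsetUr _ _).
  move=> D iD DyC DnyC; have [CD|CnD] := boolP (C \subset D).
    exists z, y; split=> //; first exact: (subsetP CD).
    rewrite inE setU11 andbT; apply: contra DnyC => yD.
    by rewrite eqEsubset DyC subUset sub1set yD.
  have [|||z1 [y1 [z1D y1D zy1]]] := cutC (C :&: D).
  + by rewrite subsetI iC.
  + exact: subsetIl.
  + by apply: contraNneq CnD => <-; apply: subsetIr.
  exists z1, y1; split=> //; first by move: z1D; rewrite inE => /andP[].
  by move: y1D; rewrite !inE negb_and => /andP[/orP[/negPf->//|->] ->]; rewrite orbT.
- by rewrite subUset sub1set inE yS.
Qed.

(** The unfrozen clusters are independent blocks, so the factor lost is exponential in the size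
    of the largest cluster instead of the number of unfrozen sites. *)
Lemma cvar_small_clusters S f (m : nat) :
  (forall i C, cut_connected e [set i] C -> C \subset ~: S -> (#|C| <= m)%N) ->
  cvar f S <= k ^+ m * \sum_(i in ~: S) cvar f (~: [set i]).
Proof.
have [n] := ubnP #|~: S|; elim: n S => // n IH S Sn small.
have [/eqP S0|[i]] := set_0Vmem (~: S).
  move: S0; rewrite -setCT (inj_eq (@setC_inj _)) => /eqP ->.
  by rewrite cvar_full setCT big_set0 mulr0.
move=> iS; have iS' : i \notin S by rewrite inE in iS.
have [C [conC CS closedC]] := cut_connected_cluster iS'.
have iC : i \in C by case: conC; rewrite sub1set.
have SE : ~: S = C :|: (~: S :\: C).
  apply/setP => x; rewrite !inE; have := subsetP CS x; rewrite inE.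
  by case: (x \in C) => //= /(_ isT).
have dC : [disjoint C & ~: S :\: C].
  by rewrite -setI_eq0; apply/eqP/setP => x; rewrite !inE; case: (x \in C).
have bC : bdry C \subset S.
  apply/subsetP => u; rewrite !inE => /andP[uC /exists_inP[v vC uv]].
  by apply: contraNT uC; apply: closedC vC _; rewrite e_sym.
apply: le_trans (cvar_blocks f SE dC bC) _.
have CE : ~: (S :|: (~: S :\: C)) = C.
  apply/setP => x; rewrite !inE; have := subsetP CS x; rewrite inE.
  by case: (x \in C) (x \in S) => [] [] // /(_ isT).
have DE : ~: (S :|: C) = ~: S :\: C.
  by apply/setP => x; rewrite !inE negb_or andbC.
rewrite (big_setID C) /= (setIidPr CS) mulrDr addrC; apply: lerD.
  apply: le_trans (cvar_sites _ _) _; rewrite CE; apply: ler_wpM2r.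
    by apply: sumr_ge0 => j _; apply: cvar_ge0.
  by apply: ler_weXn2l; [exact: k_ge1|exact: small conC CS].
rewrite -DE; apply: IH.
  rewrite -ltnS; apply: leq_trans Sn; rewrite ltnS DE; apply: proper_card; rewrite properE.
  rewrite subsetDl; apply/subsetPn; exists i => //; by rewrite inE iC.
move=> j D conD DS; apply: small conD _; apply: subset_trans DS _.
by rewrite DE subsetDl.
Qed.

(** The Dirichlet form of the dynamics that resamples each site at rate 1. *)
Definition dirichlet f := \sum_i cvar f (~: [set i]).

Variable Delta : nat.
Hypothesis degree : forall x, (#|e x| <= Delta)%N.
Hypothesis L0 : (0 < #|L|)%N.

(** A cluster of more than [r] unfrozen sites contains the [r.+1] distinct sites visited by a
    closed walk of [2 * r] steps, all of which have to be spared at every freezing step. *)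
Lemma freeze_percolation m r f (a w x : R) : (forall t, a <= f t <= a + w) ->
  0 <= x -> 1 - r.+1%:R / (4 * #|L|%:R) <= x ->
  iter m (@freeze R L) (cvar f) set0 <= k ^+ r * dirichlet f
    + w ^+ 2 * (#|L|%:R * (Delta ^ (2 * r))%:R * x ^+ m).
Proof.
move=> fw x0 rx; have k0r : 0 <= k ^+ r by rewrite exprn_ge0 // (le_trans ler01 k_ge1).
have spread1 i C : cut_connected e [set i] C -> (r < #|C|)%N ->
    exists p, [/\ p \in walks e (2 * r) i, trace i p \subset C & spread eq_op r i p].
  move=> conC rC; apply: (@spread_walk _ e eq_op e 1 _ _ _ _ C) => //.
  - by move=> y; rewrite -(cards1 y) subset_leq_card //; apply/subsetP => z; rewrite !inE eq_sym.
  - by move=> y z z' /eqP <- yz; rewrite yz e_sym.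
  - by rewrite mul1n.
pose bad S : R := \sum_i \sum_(p <- walks e (2 * r) i | spread eq_op r i p) [disjoint trace i p & S]%:R.
have cvar_bad S : cvar f S <= k ^+ r * dirichlet f * 1 + w ^+ 2 * bad S.
  have bad0 : 0 <= bad S by apply: sumr_ge0 => i _; apply: sumr_ge0 => p _; apply: ler0n.
  have D0 : 0 <= dirichlet f by apply: sumr_ge0 => i _; apply: cvar_ge0.
  have [/existsP[i /existsP[p /and3P[pw sp dp]]]|good] :=
      boolP [exists i, [exists n : 'I_(size (walks e (2 * r) i)),
        [&& nth [::] (walks e (2 * r) i) n \in walks e (2 * r) i,
        spread eq_op r i (nth [::] (walks e (2 * r) i) n) &
        [disjoint trace i (nth [::] (walks e (2 * r) i) n) & S]]]].
    apply: le_trans (cvar_osc mu_gt0 mu_sum1 S fw) _.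
    apply: le_trans (_ : w ^+ 2 * bad S <= _); last first.
      by rewrite lerDr mulr1 mulr_ge0.
    rewrite ler_peMr ?sqr_ge0 // /bad (bigD1 i) //= (big_rem _ pw) /= sp dp -addrA lerDl.
    apply: addr_ge0; first by apply: sumr_ge0 => p' _; apply: ler0n.
    by apply: sumr_ge0 => j _; apply: sumr_ge0 => p' _; apply: ler0n.
  apply: le_trans (_ : k ^+ r * dirichlet f <= _); last first.
    by rewrite mulr1 lerDl mulr_ge0 ?sqr_ge0.
  apply: le_trans (cvar_small_clusters f (m := r) _) _.
    move=> i C conC CS; rewrite leqNgt; apply/negP => /(spread1 _ _ conC)[p [pw pC sp]].
    move/negP: good; apply; apply/existsP; exists i; apply/existsP.
    have ip : (index p (walks e (2 * r) i) < size (walks e (2 * r) i))%N by rewrite index_mem.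
    exists (Ordinal ip); rewrite /= !nth_index // pw sp /=.
    rewrite disjoints_subset; exact: subset_trans pC CS.
  rewrite ler_wpM2l // /dirichlet [leRHS](bigID (mem (~: S))) /= lerDl.
  by apply: sumr_ge0 => i _; apply: cvar_ge0.
apply: le_trans (ler_freeze _ _ cvar_bad) _.
rewrite freezeD freeze_cst // mulr1 lerD2l ler_wpM2l ?sqr_ge0 //.
have disjointsU1 (A S : {set L}) i : [disjoint A & i |: S] = (i \notin A) && [disjoint A & S].
  by rewrite !disjoints_subset setCU subsetI subsetC sub1set inE.
have chi (A : {set L}) n S : iter n (@freeze R L) (fun T => [disjoint A & T]%:R) S =
    [disjoint A & S]%:R * (1 - #|A|%:R / (4 * #|L|%:R)) ^+ n.
  elim: n S => [|n IH] S /=; first by rewrite mulr1.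
  rewrite /freeze IH (eq_bigr _ (fun i _ => IH (i |: S))) -mulr_suml.
  have -> : \sum_i [disjoint A & i |: S]%:R = [disjoint A & S]%:R * (#|L|%:R - #|A|%:R) :> R.
    rewrite (bigID (mem A)) /= big1 ?add0r => [|i iA]; last first.
      by rewrite disjointsU1 iA.
    rewrite (eq_bigr (fun=> [disjoint A & S]%:R)) => [|i iA]; last first.
      by rewrite disjointsU1 iA.
    rewrite sumr_const -[LHS]mulr_natr -natrB ?max_card //.
    by congr (_ * _); congr (_%:R); rewrite -(cardC (mem A)) addKn.
  by rewrite exprS; field; rewrite pnatr_eq0 -lt0n.
rewrite /bad freeze_sum //.
apply: le_trans (_ : \sum_(i : L) (Delta ^ (2 * r))%:R * x ^+ m <= _); last first.
  by rewrite sumr_const -[leLHS]mulr_natl mulrA.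
apply: ler_sum => i _; rewrite freeze_sum //.
apply: le_trans (_ : \sum_(p <- walks e (2 * r) i) x ^+ m <= _).
  rewrite [leLHS]big_mkcond /=; apply: ler_sum => p _; case: ifP => [/andP[/eqP sp _]|_].
    have rN : (r.+1 <= #|L|)%N by rewrite -sp max_card.
    rewrite chi disjoints_subset setC0 subsetT mul1r sp lerXn2r ?nnegrE // subr_ge0.
    by rewrite ler_pdivrMr ?mul1r -?natrM ?ler_nat ?ltr0n; lia.
  exact: exprn_ge0.
rewrite big_const_seq count_predT iter_addr_0 -[leLHS]mulr_natl ler_wpM2r ?exprn_ge0 //.
by rewrite ler_nat size_walks.
Qed.

End Clusters.

(** * A discrete resampling chain *)

Section DiscreteChain.
Variables (R : realFieldType) (L : finType) (mu : {ffun L -> bool} -> R).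
Local Notation config := {ffun L -> bool}.
Hypotheses (mu_gt0 : forall s, 0 < mu s) (mu_sum1 : \sum_s mu s = 1).
Implicit Types (f g : config -> R) (s : config).

Local Notation mean := (mean mu).
Local Notation cexp := (cexp mu).
Local Notation variance f := (cvar mu f finset.set0).
Local Notation N := (#|L|%:R : R).

Lemma varianceE f : variance f = mean (fun s => f s ^+ 2) - mean f ^+ 2.
Proof.
congr (_ - _); rewrite -(mean_cst mu_gt0 mu_sum1 (mean f ^+ 2)); apply: eq_mean => s.
by rewrite -meanE.
Qed.

Lemma variance_osc f (a w : R) : (forall s, a <= f s <= a + w) -> variance f <= w ^+ 2.
Proof. exact: cvar_osc. Qed.

Lemma variance_mix f g (p : R) : 0 <= p <= 1 ->
  variance (fun s => p * f s + (1 - p) * g s) <= p * variance f + (1 - p) * variance g.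
Proof.
move=> /andP[p0 p1]; have := cvar_ge0 mu_gt0 mu_sum1 finset.set0 (fun s => f s - g s).
rewrite !varianceE !(meanB, meanD, meanZ) //.
rewrite (eq_mean _ (g := fun s => f s ^+ 2 + (g s ^+ 2 - 2 * (f s * g s)))); last by move=> s; ring.
rewrite (eq_mean _ (f := fun s => (p * f s + (1 - p) * g s) ^+ 2)
  (g := fun s => p ^+ 2 * f s ^+ 2 + ((1 - p) ^+ 2 * g s ^+ 2 + 2 * p * (1 - p) * (f s * g s)))); last first.
  by move=> s; ring.
rewrite !(meanB, meanD, meanZ) //.
set a := mean f; set b := mean g; set c := mean (fun s => f s ^+ 2); set e := mean _; set h := mean _.
move=> fg; have pq : 0 <= p * (1 - p) by rewrite mulr_ge0 ?subr_ge0.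
by have := mulr_ge0 pq fg; lra.
Qed.

Variable eta : R.
Hypothesis eta0 : 0 < eta.

(** One step of a chain that stays put or resamples a site, each site with weight [eta]. *)
Definition resample f s := (f s + eta * \sum_i cexp (~: [set i])%SET f s) / (1 + eta * N).

Let Z0 : 0 < 1 + eta * N.
Proof. by rewrite ltr_pwDl // mulr_ge0 ?ler0n // ltW. Qed.

Lemma resample_bounds f (a b : R) : (forall s, a <= f s <= b) -> forall s, a <= resample f s <= b.
Proof.
move=> fab s; have K i : a <= cexp (~: [set i])%SET f s <= b.
  apply/andP; split.
    rewrite -(cexp_cst mu_gt0 (~: [set i])%SET a s); apply: ler_cexp => // t _.
    by case/andP: (fab t).
  rewrite -[leRHS](cexp_cst mu_gt0 (~: [set i])%SET b s); apply: ler_cexp => // t _.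
  by case/andP: (fab t).
have /andP[fa fb] := fab s.
have SN (c : R) : \sum_(i : L) c = N * c by rewrite sumr_const mulr_natl.
rewrite /resample; apply/andP; split.
  rewrite ler_pdivlMr //.
  have : \sum_(i : L) a <= \sum_i cexp (~: [set i])%SET f s.
    by apply: ler_sum => i _; case/andP: (K i).
  by rewrite SN => /(ler_wpM2l (ltW eta0)); lra.
rewrite ler_pdivrMr //.
have : \sum_i cexp (~: [set i])%SET f s <= \sum_(i : L) b.
  by apply: ler_sum => i _; case/andP: (K i).
by rewrite SN => /(ler_wpM2l (ltW eta0)); lra.
Qed.

Lemma resample_mean f : mean (resample f) = mean f.
Proof.
pose S s := \sum_i cexp (~: [set i])%SET f s.
have SE : mean S = N * mean f.
  transitivity (\sum_i mean (cexp (~: [set i])%SET f)); first exact: mean_sum.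
  by rewrite (eq_bigr (fun=> mean f)) => [|i _]; rewrite ?mean_cexp // sumr_const mulr_natl.
rewrite (eq_mean _ (g := fun s => (1 + eta * N)^-1 * f s + (1 + eta * N)^-1 * (eta * S s))); last first.
  by move=> s; rewrite -mulrDr mulrC.
by rewrite (meanD mu_sum1) !(meanZ mu_sum1) SE; field; rewrite gt_eqF.
Qed.

(** A step is a weighted average of the identity and of [#|L|] projections, so by convexity the
    second moment loses at least the weighted average of what the projections remove. *)
Lemma resample_variance f :
  variance (resample f) <= variance f - eta / (1 + eta * N) * dirichlet mu f.
Proof.
pose Kf i := cexp (~: [set i])%SET f; pose S2 s := \sum_i Kf i s ^+ 2.
have jensen s : resample f s ^+ 2 <= (1 + eta * N)^-1 * f s ^+ 2 + (1 + eta * N)^-1 * (eta * S2 s).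
  set a := resample f s; rewrite -mulrDr mulrC ler_pdivlMr //.
  have aE : a * (1 + eta * N) = f s + eta * \sum_i Kf i s by rewrite divfK // gt_eqF.
  have : 0 <= (f s - a) ^+ 2 + eta * \sum_i (Kf i s - a) ^+ 2.
    apply: addr_ge0; first exact: sqr_ge0.
    by apply: mulr_ge0; [exact: ltW|apply: sumr_ge0 => i _; apply: sqr_ge0].
  have -> : \sum_i (Kf i s - a) ^+ 2 = S2 s - 2 * a * \sum_i Kf i s + N * a ^+ 2.
    rewrite /S2 mulr_sumr -sumrB.
    have -> : N * a ^+ 2 = \sum_(i : L) a ^+ 2 by rewrite sumr_const mulr_natl.
    by rewrite -big_split /=; apply: eq_bigr => i _; ring.
  have a2 := congr1 (fun z => a * z) aE; rewrite /= in a2.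
  by move: (S2 s) (\sum_i Kf i s) a2 => s2 s1 a2; nra.
rewrite !varianceE resample_mean.
have : mean (fun s => resample f s ^+ 2) <=
    (1 + eta * N)^-1 * mean (fun s => f s ^+ 2)
    + (1 + eta * N)^-1 * (eta * \sum_i mean (fun s => Kf i s ^+ 2)).
  apply: le_trans (ler_mean mu_gt0 mu_sum1 jensen) _.
  rewrite (meanD mu_sum1) !(meanZ mu_sum1) lerD2l ler_wpM2l ?invr_ge0 ?(ltW Z0) // ler_wpM2l ?(ltW eta0) //.
  by rewrite le_eqVlt; apply/orP; left; apply/eqP; apply: mean_sum.
have -> : dirichlet mu f = N * mean (fun s => f s ^+ 2) - \sum_i mean (fun s => Kf i s ^+ 2).
  by rewrite /dirichlet /cvar sumrB sumr_const mulr_natl.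
move: (mean (fun s => resample f s ^+ 2)) (mean (fun s => f s ^+ 2)) => M1 M2.
move: (\sum_i _) => S H; apply: le_trans (lerB H (lexx _)) _.
by rewrite le_eqVlt; apply/orP; left; apply/eqP; field; rewrite gt_eqF.
Qed.

(** As long as the variance exceeds the level of the weak Poincaré inequality, it decreases by
    a fixed amount at each step. *)
Lemma resample_decay f (a w x D : R) m : (forall s, a <= f s <= a + w) ->
  (forall g, (forall s, a <= g s <= a + w) -> x * w ^+ 2 <= variance g -> w ^+ 2 * D <= dirichlet mu g) ->
  0 <= x -> 1 < m%:R * (eta / (1 + eta * N)) * D -> variance (iter m resample f) <= x * w ^+ 2.
Proof.
move=> fw wp x0 fast; set c := eta / (1 + eta * N) in fast.
have c0 : 0 < c by rewrite divr_gt0.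
have iw j s : a <= iter j resample f s <= a + w.
  by elim: j s => [|j IH] s //=; apply: resample_bounds.
have D0 g : 0 <= dirichlet mu g by apply: sumr_ge0 => i _; apply: cvar_ge0.
rewrite leNgt; apply/negP => big.
have mono j : variance (iter j.+1 resample f) <= variance (iter j resample f).
  apply: le_trans (resample_variance _) _.
  by rewrite gerBl mulr_ge0 // ltW.
have anti i j : variance (iter (i + j) resample f) <= variance (iter j resample f).
  by elim: i => [|i IH]; [exact: lexx|apply: le_trans (mono _) IH].
have large j : (j <= m)%N -> x * w ^+ 2 <= variance (iter j resample f).
  by move=> jm; apply: le_trans (ltW big) _; rewrite -{1}(subnK jm); apply: anti.
have drop j : (j <= m)%N -> variance (iter j resample f) <= w ^+ 2 - j%:R * (c * (w ^+ 2 * D)).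
  elim: j => [_|j IH jm]; first by rewrite mul0r subr0; apply: variance_osc (iw 0%N).
  have le1 := IH (ltnW jm); have le2 := wp _ (iw j) (large _ (ltnW jm)).
  have le3 := resample_variance (iter j resample f).
  have le4 := ler_wpM2l (ltW c0) le2.
  apply: le_trans le3 _; rewrite -/c -natr1 mulrDl mul1r; lra.
have := le_trans (ltW big) (drop m (leqnn m)).
have [w0|w0] := eqVneq (w ^+ 2) 0.
  by have := lt_le_trans big (variance_osc (iw m)); rewrite w0 mulr0 ltxx.
have {}w0 : 0 < w ^+ 2 by rewrite lt_neqAle eq_sym w0 sqr_ge0.
have -> : w ^+ 2 - m%:R * (c * (w ^+ 2 * D)) = (1 - m%:R * c * D) * w ^+ 2 by ring.
rewrite ler_pM2r // => xneg; lra.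
Qed.

End DiscreteChain.

Section ChainKernel.
Variables (R : realFieldType) (L : finType) (mu : {ffun L -> bool} -> R) (eta : R).
Local Notation config := {ffun L -> bool}.

(** The chain is a linear operator, given by a kernel. *)
Lemma iter_resample_sum m (f : config -> R) s :
  iter m (resample mu eta) f s = \sum_t iter m (resample mu eta) (fun u => (u == t)%:R) s * f t.
Proof.
elim: m s => [|m IH] s.
  rewrite (bigD1 s) //= eqxx mul1r big1 ?addr0 // => t ts.
  by rewrite eq_sym (negbTE ts) mul0r.
set g := fun t => iter m (resample mu eta) (fun u => (u == t)%:R) in IH *.
rewrite (eq_bigr (fun t => resample mu eta (g t) s * f t)); last by [].
have cexp_sum V : cexp mu V (iter m (resample mu eta) f) s = \sum_t cexp mu V (g t) s * f t.
  rewrite /cexp [in LHS](eq_bigr (fun u => \sum_t mu u * (g t u * f t))); last first.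
    by move=> u _; rewrite IH mulr_sumr.
  rewrite exchange_big /= mulr_suml; apply: eq_bigr => t _.
  rewrite mulrAC [in RHS]mulr_suml; congr (_ * _); apply: eq_bigr => u _.
  by rewrite mulrA.
rewrite iterS {1}/resample IH.
rewrite (eq_bigr (fun i => \sum_t cexp mu (~: [set i])%SET (g t) s * f t)); last by [].
rewrite exchange_big /= mulr_sumr -big_split /= mulr_suml; apply: eq_bigr => t _.
by rewrite -mulr_suml mulrA -mulrDl mulrAC.
Qed.

Lemma iter_resample_cst m (c : R) (s : config) : (forall s, 0 < mu s) -> 0 < eta ->
  iter m (resample mu eta) (fun=> c) s = c.
Proof.
move=> mu_gt0 eta0; apply/eqP; rewrite eq_le andbC.
by elim: m s => [|m IH] s /=; [rewrite lexx|apply: resample_bounds].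
Qed.

Lemma exprn_ge1B (y : R) m : 0 <= y <= 1 -> 1 - m%:R * (1 - y) <= y ^+ m.
Proof.
move=> /andP[y0 y1]; elim: m => [|m IH]; first by rewrite mul0r subr0 expr0.
rewrite exprS; apply: le_trans (ler_wpM2l y0 IH).
have : 0 <= m%:R * (1 - y) ^+ 2 by rewrite mulr_ge0 ?ler0n ?sqr_ge0.
by rewrite -natr1; move: (m%:R) => z; lra.
Qed.

End ChainKernel.

(* From here on [setT], [setU], etc. and their lemmas are those of classical sets. *)
From mathcomp Require Import classical_sets.

(** * The weak Poincaré inequality *)

Section WeakPoincare.
Variables (R : realType) (L : finType) (e near hop : rel L) (K Delta : nat) (k0 : R).
Local Notation config := {ffun L -> bool}.
Variables (mu : config -> R) (ball : L -> {set L}).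
Hypotheses (mu_gt0 : forall s, 0 < mu s) (mu_sum1 : \sum_s mu s = 1).
Hypotheses (mu_lattice : fkg_lattice mu) (mu_swap : markov_swap e mu).
Hypotheses (e_sym : symmetric e) (degree : forall x, (#|e x| <= Delta)%N).
Hypothesis plus_ratio : forall i s t,
  plus mu (~: [set i])%SET s i <= k0 * plus mu (~: [set i])%SET t i /\
  1 - plus mu (~: [set i])%SET s i <= k0 * (1 - plus mu (~: [set i])%SET t i).
Hypotheses (near_refl : reflexive near) (near_sym : symmetric near).
Hypothesis near_card : forall a, (#|[set z | near a z]%SET| <= K)%N.
Hypothesis near_hop : forall a z z', near a z -> e z z' -> hop a z' && hop z' a.
Hypothesis ball_self : forall x, x \in ball x.
Hypothesis ball_near : forall x y, ~~ near x y -> [disjoint ball x & ball y].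
Hypothesis L0 : (0 < #|L|)%N.

Local Notation set0 := (@finset.set0 L).
Local Notation cvar := (cvar mu).
Local Notation k := (1 + 2 * k0 ^+ 2).

(** In the [4 * (Delta ^ 2 + 1) * #|L|] freezing steps after which unfrozen clusters are small,
    the logarithm of the variance is multiplied by at most this factor. *)
Definition freeze_exponent : R := expR (2 * (Delta ^ 2).+1 * (4 * K).+1)%:R.

(** The second term accounts for the factor [k] lost per site in the unfrozen clusters. *)
Definition poincare_exponent : R := freeze_exponent * (1 + ln k).

Lemma expR_subr_le (z : R) : 0 <= z -> z <= 1 / 2 -> expR (- (2 * z)) <= 1 - z.
Proof.
move=> z0 z1; rewrite expRN; apply: le_trans (_ : (1 + 2 * z)^-1 <= _).
  by rewrite lef_pV2 ?posrE ?expR_gt0 ?expR_ge1Dx //; lra.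
rewrite invf_ple ?posrE; [|lra|lra].
rewrite -[(1 - z)^-1]mul1r ler_pdivrMr; last by lra.
by nra.
Qed.

Variables (G : R) (s0 : config).
Hypothesis G_large : expR 1 <= #|L|%:R * G.
Hypothesis walk_tail : forall J, (0 < J)%N ->
  \sum_o walk_sum near hop J o (gap e mu ball set0 s0 s0) <= G * expR (- J%:R).

Let N : R := #|L|%:R.
Let B : R := N ^+ 2 * G.

Let N1 : 1 <= N. Proof. by rewrite /N ler1n. Qed.

Let B_ge : expR 1 * N <= B.
Proof. by rewrite /B expr2 -mulrA [leRHS]mulrC ler_wpM2r // (le_trans _ N1). Qed.

Let e2 : 2 <= expR 1 :> R. Proof. by apply: le_trans (expR_ge1Dx _); lra. Qed.

Let B0 : 0 < B.
Proof.
by apply: lt_le_trans B_ge; rewrite mulr_gt0 ?expR_gt0 // (lt_le_trans _ N1).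
Qed.

Let K0 : (0 < K)%N.
Proof.
have /card_gt0P[ o _] := L0.
by apply: leq_trans (near_card o); apply/card_gt0P; exists o; rewrite inE.
Qed.

(** With the threshold of the row sums adapted to the variance still present, each freezing
    step costs a factor whose logarithm is proportional to the logarithm of that variance;
    hence a polynomially small variance remains polynomially small. *)
Lemma freeze_lower_bound f (a w y : R) m : (forall t, a <= f t <= a + w) -> 1 <= y ->
  B * w ^+ 2 * expR (- y) <= cvar f set0 ->
  B * w ^+ 2 * expR (- (y * (1 + (4 * K).+1%:R / 2 / N) ^+ m)) <= iter m (@freeze R L) (cvar f) set0.
Proof.
move=> fw y1 start; set A := (4 * K).+1%:R / 2; have A0 : 0 <= A by rewrite divr_ge0 ?ler0n.
have N0 : 0 < N by apply: lt_le_trans N1.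
elim: m => [|m IH]; first by rewrite expr0 mulr1.
set ym := y * (1 + A / N) ^+ m in IH.
have ym1 : 1 <= ym.
  by rewrite mulr_ege1 // exprn_ege1 // lerDl divr_ge0 // ltW.
(* The row sums exceed [2 * K * J] with a probability small compared to the variance left. *)
pose J := (Num.truncn ym).+1.
have /andP[J1 J2] := truncn_itv (le_trans ler01 ym1).
have {}J1 : J%:R <= ym + 1 by rewrite /J -addn1 natrD lerD2r.
have b0 : 0 <= N * (G * expR (- J%:R)).
  apply: mulr_ge0; first exact: ltW.
  apply: mulr_ge0; last exact: expR_ge0.
  by have : 0 <= N * G := le_trans (expR_ge0 1) G_large; rewrite pmulr_rge0.
have bad (S : {set L}) : mean mu (fun s => [exists o, (o \notin S) && ((2 * K * J)%:R < rowsum mu S s o)]%:R)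
    <= N * (G * expR (- J%:R)).
  apply: le_trans (rowsum_tail mu_gt0 mu_sum1 mu_lattice mu_swap near_refl near_sym near_card
    near_hop ball_self ball_near S s0 (isT : (0 < J)%N)) _.
  by rewrite ler_wpM2l ?walk_tail ?ltW.
have lam0 : 0 < (2 * K * J)%:R :> R by rewrite ltr0n !muln_gt0 K0.
apply: le_trans (freeze_cvar mu_gt0 mu_sum1 mu_lattice L0 m lam0 fw b0 bad).
set v := iter m _ _ _ in IH *; set lam := (2 * K * J)%:R in lam0 *.
have Bw : 0 <= B * w ^+ 2 by apply: mulr_ge0; [exact: ltW|exact: sqr_ge0].
have v0 : 0 <= v by apply: le_trans IH; apply: mulr_ge0 => //; apply: expR_ge0.
have err : w ^+ 2 * (N * (G * expR (- J%:R))) <= v / N.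
  rewrite ler_pdivlMr //; apply: le_trans IH.
  have -> : w ^+ 2 * (N * (G * expR (- J%:R))) * N = B * w ^+ 2 * expR (- J%:R).
    by rewrite /B; ring.
  by rewrite ler_wpM2l // ler_expR lerN2 ltW.
pose z := (Num.min lam N + 1) / (4 * N).
have N4 : 0 < 4 * N by rewrite mulr_gt0.
have z0 : 0 <= z.
  by rewrite divr_ge0 ?(ltW N4) // addr_ge0 // le_min (ltW lam0) (ltW N0).
have z_half : z <= 1 / 2.
  rewrite ler_pdivrMr //; apply: le_trans (_ : N + 1 <= _); last by move: N1; lra.
  by rewrite lerD2r ge_min lexx orbT.
have z_ym : 2 * z <= A * ym / N.
  have -> : A * ym / N = 2 * ((2 * A * ym) / (4 * N)) by field; rewrite gt_eqF.
  rewrite ler_wpM2l // ler_pM2r ?invr_gt0 //; apply: le_trans (_ : lam + 1 <= _).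
    by rewrite lerD2r ge_min lexx.
  have -> : 2 * A = 4 * K%:R + 1 by rewrite /A -[(4 * K).+1]addn1 natrD natrM; field.
  have K1 : 1 <= K%:R :> R by rewrite ler1n.
  rewrite /lam !natrM; nra.
have -> : y * (1 + A / N) ^+ m.+1 = ym + A * ym / N by rewrite /ym exprS; field; rewrite gt_eqF.
rewrite opprD expRD mulrA.
apply: le_trans (_ : v * expR (- (2 * z)) <= _).
  apply: ler_pM => //; rewrite ?expR_ge0 ?ler_expR ?lerN2 //.
  by apply: mulr_ge0 => //; apply: expR_ge0.
apply: le_trans (_ : v * (1 - z) <= _); first by rewrite ler_wpM2l ?expR_subr_le.
have -> : v * (1 - z) = (1 - Num.min lam N / (4 * N)) * v - v / N / 4.
  by rewrite /z; field; rewrite gt_eqF.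
by rewrite lerD2l lerN2 ler_wpM2r // invr_ge0.
Qed.

(** Freezing almost all sites keeps a power of the variance,
    and only logarithmically large clusters of unfrozen sites are left to mix. *)
Lemma weak_poincare f (a w x : R) : (forall t, a <= f t <= a + w) -> 0 < x -> x <= 1 ->
  x * w ^+ 2 <= cvar f set0 ->
  w ^+ 2 * expR (- (poincare_exponent * ln (B / x))) <= dirichlet mu f.
Proof.
move=> fw x0 x1 start; have N0 : 0 < N by apply: lt_le_trans N1.
have Bx : 0 < B / x by rewrite divr_gt0.
set y := ln (B / x); have y1 : 1 <= y.
  rewrite -[1]expRK ler_ln ?posrE ?expR_gt0 // ler_pdivlMr //.
  apply: le_trans B_ge; rewrite ler_wpM2l ?expR_ge0 //; exact: le_trans x1 N1.
pose T := (Delta ^ 2).+1; pose m := (4 * T * #|L|)%N.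
have v_lo : B * w ^+ 2 * expR (- (freeze_exponent * y)) <= iter m (@freeze R L) (cvar f) set0.
  apply: le_trans (freeze_lower_bound m fw y1 _); last first.
    rewrite expRN lnK ?posrE // invf_div; apply: le_trans start.
    by rewrite le_eqVlt; apply/orP; left; apply/eqP; field; rewrite gt_eqF.
  apply: ler_wpM2l; first by apply: mulr_ge0; [exact: ltW|exact: sqr_ge0].
  rewrite ler_expR lerN2 mulrC; apply: ler_wpM2r; first exact: le_trans y1.
  have AN : 0 <= (4 * K).+1%:R / 2 / N by rewrite !divr_ge0 ?ler0n // ltW.
  apply: le_trans (_ : expR ((4 * K).+1%:R / 2 / N) ^+ m <= _).
    by rewrite lerXn2r ?nnegrE ?expR_ge0 ?addr_ge0 // expR_ge1Dx.
  rewrite -expRM_natl ler_expR /m !natrM le_eqVlt; apply/orP; left; apply/eqP.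
  by rewrite -/N /T; field; rewrite gt_eqF.
(* Clusters of more than [r] sites contribute at most half of the surviving variance. *)
pose r := Num.truncn (freeze_exponent * y).
have fy0 : 0 <= freeze_exponent * y by rewrite mulr_ge0 ?expR_ge0 ?(le_trans ler01).
have /andP[r1 r2] := truncn_itv fy0.
have X0 : 0 <= expR (- (r.+1%:R / (4 * N))) by apply: expR_ge0.
have X1 : 1 - r.+1%:R / (4 * N) <= expR (- (r.+1%:R / (4 * N))) by apply: expR_ge1Dx.
have v_hi := freeze_percolation mu_gt0 mu_sum1 e_sym mu_swap plus_ratio degree L0 m fw X0 X1.
have small : N * (Delta ^ (2 * r))%:R * expR (- (r.+1%:R / (4 * N))) ^+ m
    <= B / 2 * expR (- (freeze_exponent * y)).
  have -> : expR (- (r.+1%:R / (4 * N))) ^+ m = expR (- (r.+1 * Delta ^ 2)%:R) * expR (- r.+1%:R).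
    rewrite -expRM_natl -expRD; congr expR; rewrite /m /T !natrM -[(Delta ^ 2).+1]addn1 natrD.
    by rewrite -/N; field; rewrite gt_eqF.
  set E1 := expR (- (_ * _)%:R); set E2 := expR _.
  rewrite mulrA -[N * _ * E1]mulrA.
  apply: ler_pM; rewrite ?expR_ge0 //.
  - apply: mulr_ge0; first exact: ltW.
    by apply: mulr_ge0; [apply: ler0n|apply: expR_ge0].
  - apply: le_trans (_ : N * 1 <= _); last first.
      by rewrite mulr1 ler_pdivlMr // mulrC; apply: le_trans B_ge; rewrite ler_wpM2r // ltW.
    apply: ler_wpM2l; first exact: ltW.
    rewrite /E1 expRN ler_pdivrMr ?expR_gt0 // mul1r.
    have D2 : (Delta ^ 2)%:R <= expR (Delta ^ 2)%:R :> R.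
      by apply: le_trans (expR_ge1Dx _); rewrite lerDr.
    rewrite natrM expRM_natl expnM natrX.
    apply: le_trans (_ : expR (Delta ^ 2)%:R ^+ r <= _); first by rewrite lerXn2r ?nnegrE ?ler0n ?expR_ge0.
    by apply: ler_weXn2l => //; apply: le_trans (expR_ge1Dx _); rewrite lerDl ler0n.
  - by rewrite ler_expR lerN2 ltW.
have kgt0 : 0 < k by apply: lt_le_trans ltr01 (k_ge1 k0).
have kr : k ^+ r <= expR (freeze_exponent * y * ln k).
  rewrite -[k in k ^+ r]lnK ?posrE // -expRM_natl ler_expR ler_wpM2r // ln_ge0 //; exact: k_ge1.
have lower : w ^+ 2 * (B / 2 * expR (- (freeze_exponent * y))) <= k ^+ r * dirichlet mu f.
  set E := expR _ in v_lo small *.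
  have -> : w ^+ 2 * (B / 2 * E) = B * w ^+ 2 * E - w ^+ 2 * (B / 2 * E) by field.
  rewrite lerBlDr; apply: le_trans (le_trans v_lo v_hi) _; rewrite lerD2l.
  exact: (ler_wpM2l (sqr_ge0 w) small).
have D0 : 0 <= dirichlet mu f by apply: sumr_ge0 => i _; apply: cvar_ge0.
have {}lower := le_trans lower (ler_wpM2r D0 kr).
have -> : poincare_exponent * y = freeze_exponent * y + freeze_exponent * y * ln k.
  by rewrite /poincare_exponent; ring.
rewrite opprD expRD [X in _ * (_ * X)]expRN mulrA ler_pdivrMr ?expR_gt0 // [leRHS]mulrC.
apply: le_trans lower; apply: ler_wpM2l; first exact: sqr_ge0.
apply: ler_peMl; first exact: expR_ge0.
rewrite ler_pdivlMr // mul1r; apply: le_trans B_ge; apply: le_trans e2 _.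
by rewrite ler_peMr ?expR_ge0.
Qed.

End WeakPoincare.

(** * The Gibbs measure of the random field Ising model *)

Section Lattice.
Variables (d : nat) (L : {fset site d}).
Implicit Types x y z : L.
Local Open Scope nat_scope.

Definition edge : rel L := fun x y => adj (val x) (val y).

Definition within (r : nat) : rel L :=
  fun x y => [forall i, `|val x i - val y i|%R <= r%:Z]%R.

Lemma edge_sym : symmetric edge.
Proof.
move=> x y; rewrite /edge /adj; congr (_ == _); apply: eq_bigr => i _.
by rewrite distrC.
Qed.

Lemma within_refl r : reflexive (within r).
Proof. by move=> x; apply/forallP => i; rewrite subrr normr0. Qed.

Lemma within_sym r : symmetric (within r).
Proof. by move=> x y; apply: eq_forallb => i; rewrite distrC. Qed.

Lemma within_trans r s x y z : within r x y -> within s y z -> within (r + s) x z.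
Proof.
move=> /forallP xy /forallP yz; apply/forallP => i; have := xy i; have := yz i; lia.
Qed.

Lemma edge_within x y : edge x y -> within 1 x y.
Proof.
rewrite /edge /adj => /eqP xy; apply/forallP => i.
apply: (@le_trans _ _ (\sum_j `|val x j - val y j|)%R); last by rewrite xy.
rewrite (bigD1 i) //= lerDl; apply: sumr_ge0 => j _; apply: normr_ge0.
Qed.

Lemma card_within r x : #|[set y | within r x y]%SET| <= r.*2.+1 ^ d.
Proof.
have -> : r.*2.+1 ^ d = #|{: {ffun 'I_d -> 'I_(r.*2.+1)}}| by rewrite card_ffun !card_ord.
pose code y : {ffun 'I_d -> 'I_(r.*2.+1)} := [ffun i => inord (absz (val y i - val x i + r%:Z)%R)].
rewrite -(card_in_imset (f := code)); first exact: max_card.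
move=> y z; rewrite !inE => /forallP xy /forallP xz /ffunP yz.
apply/val_inj/ffunP => i; have := yz i; rewrite !ffunE => /(congr1 val) /=.
move: (xy i) (xz i); move: (val x i) (val y i) (val z i) => a b c ab ac.
have bound u : (`|a - u| <= r%:Z)%R -> absz (u - a + r%:Z)%R < r.*2.+1 by lia.
rewrite !inordK ?bound //; lia.
Qed.

Lemma edge_degree x : #|edge x| <= 3 ^ d.
Proof.
apply: leq_trans (card_within 1 x); rewrite -cardsE; apply: subset_leq_card.
by apply/fintype.subsetP => y; rewrite !inE => /edge_within.
Qed.

Lemma within_edge_hop r x y z : within r x y -> edge y z -> within r.+1 x z && within r.+1 z x.
Proof.
move=> xy /edge_within yz; have := within_trans xy yz; rewrite addn1 => xz.
by rewrite xz within_sym.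
Qed.

Lemma linf_ball_self r x : x \in linf_ball x r.
Proof. by rewrite inE; apply: within_refl. Qed.

Lemma linf_ball_disjoint r x y : ~~ within (r + r) x y -> [disjoint linf_ball x r & linf_ball y r].
Proof.
move=> xy; rewrite -finset.setI_eq0; apply/eqP/finset.setP => z; rewrite !inE.
apply/negP => /andP[zx zy]; case/negP: xy; apply: (@within_trans _ _ _ z) => //.
by rewrite within_sym.
Qed.

End Lattice.

Section GibbsProperties.
Variables (R : realType) (d : nat) (L : {fset site d}) (beta : R).
Hypothesis beta0 : 0 <= beta.
Implicit Types (h : L -> R) (s t : conf L) (x y z : L) (V A B : {set L}).

Local Notation gibbs := (gibbs beta).
Local Notation weight := (weight beta).

Lemma weight_gt0 h s : 0 < weight h s.
Proof. exact: expR_gt0. Qed.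

Lemma partition_gt0 h : 0 < \sum_s weight h s.
Proof.
rewrite (bigD1 (constc L true)) //= ltr_pwDl ?weight_gt0 //.
by apply: sumr_ge0 => s _; apply: ltW (weight_gt0 _ _).
Qed.

Lemma gibbs_gt0 h s : 0 < gibbs h s.
Proof. by rewrite divr_gt0 ?weight_gt0 ?partition_gt0. Qed.

Lemma gibbs_sum1 h : \sum_s gibbs h s = 1.
Proof. by rewrite -mulr_suml divff // gt_eqF // partition_gt0. Qed.

Definition energy h s : R := beta * (2^-1 * \sum_u \sum_(v | edge u v) spin R (s u) * spin R (s v))
  + \sum_u h u * spin R (s u).

Lemma weightE h s : weight h s = expR (energy h s).
Proof. by []. Qed.

Lemma ler_energy2 h s t s' t' :
  (forall u v, spin R (s u) * spin R (s v) + spin R (t u) * spin R (t v)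
     <= spin R (s' u) * spin R (s' v) + spin R (t' u) * spin R (t' v)) ->
  (forall u, spin R (s u) + spin R (t u) = spin R (s' u) + spin R (t' u)) ->
  energy h s + energy h t <= energy h s' + energy h t'.
Proof.
move=> quad lin; rewrite /energy addrACA [leRHS]addrACA; apply: lerD.
  rewrite -!mulrDr ler_wpM2l // ler_wpM2l ?invr_ge0 // -!big_split /=.
  apply: ler_sum => u _; rewrite -!big_split /=; exact: ler_sum.
rewrite -!big_split /= le_eqVlt; apply/orP; left; apply/eqP; apply: eq_bigr => u _.
by rewrite -!mulrDr lin.
Qed.

Lemma gibbs_mul_le_exp h s t s' t' (c : R) : energy h s + energy h t <= energy h s' + energy h t' + c ->
  gibbs h s * gibbs h t <= expR c * (gibbs h s' * gibbs h t').
Proof.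
have gE r : gibbs h r = (\sum_r' weight h r')^-1 * weight h r by rewrite mulrC.
have Z0 : 0 <= (\sum_r weight h r)^-1 by rewrite invr_ge0 ltW // partition_gt0.
move=> le; rewrite !gE; move: (_^-1) Z0 => Z Z0.
have -> : Z * weight h s * (Z * weight h t) = Z * Z * (weight h s * weight h t) by ring.
have -> : expR c * (Z * weight h s' * (Z * weight h t')) = Z * Z * (weight h s' * weight h t' * expR c).
  by ring.
by apply: ler_wpM2l; [exact: mulr_ge0|rewrite !weightE -!expRD ler_expR].
Qed.

Lemma gibbs_mul_le h s t s' t' : energy h s + energy h t <= energy h s' + energy h t' ->
  gibbs h s * gibbs h t <= gibbs h s' * gibbs h t'.
Proof.
by move=> le; rewrite -[leRHS]mul1r -expR0; apply: gibbs_mul_le_exp; rewrite addr0.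
Qed.

Lemma gibbs_lattice h : fkg_lattice (gibbs h).
Proof.
move=> s t; apply/gibbs_mul_le/ler_energy2 => [u v|u]; rewrite !ffunE.
  by case: (s u) (t u) (s v) (t v) => [] [] [] [] /=; rewrite /spin; lra.
by case: (s u) (t u) => [] [] /=; rewrite /spin; ring.
Qed.

Lemma gibbs_swap h : markov_swap (@edge d L) (gibbs h).
Proof.
move=> B s t /agreeP st.
have E : energy h s + energy h t = energy h (mix B s t) + energy h (mix B t s).
  rewrite /energy addrACA [RHS]addrACA; congr (_ + _).
    rewrite -!mulrDr -!big_split /=; congr (_ * (_ * _)); apply: eq_bigr => u _.
    rewrite -!big_split /=; apply: eq_bigr => v uv; rewrite !ffunE.
    case: ifP => uB; case: ifP => vB; [by []| | |by rewrite addrC].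
    - have vbd : v \in bdry (@edge d L) B.
        by rewrite inE vB; apply/exists_inP; exists u; rewrite // edge_sym.
      by rewrite (st v vbd).
    - have ubd : u \in bdry (@edge d L) B.
        by rewrite inE uB; apply/exists_inP; exists v.
      by rewrite (st u ubd).
  rewrite -!big_split /=; apply: eq_bigr => u _; rewrite !ffunE.
  by case: ifP => // _; rewrite addrC.
by apply/eqP; rewrite eq_le !gibbs_mul_le ?E.
Qed.

Definition ratio_bound : R := expR (beta * (4 * 3 ^ d)%:R).

(** The field terms are the same on the two sides, and so are the interactions except along the
    at most [3 ^ d] edges at [i]. *)
Lemma energy_flip h s t i : energy h (upd s i true) + energy h (upd t i false)
  <= energy h (upd t i true) + energy h (upd s i false) + beta * (4 * 3 ^ d)%:R.
Proof.
pose D s u v : R := spin R (upd s i true u) * spin R (upd s i true v)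
  - spin R (upd s i false u) * spin R (upd s i false v).
have Db r u v : `|D r u v| <= 2 * ((u == i)%:R + (v == i)%:R).
  rewrite /D !ffunE; case: eqVneq => _; case: eqVneq => _ /=;
  by rewrite ler_norml /spin; case: (r u) (r v) => [] [] /=; lra.
pose F r := \sum_u \sum_(v | edge u v) D r u v.
have Fb r : `|F r| <= (4 * 3 ^ d)%:R.
  apply: le_trans (_ : \sum_u \sum_(v | edge u v) (2 * (u == i)%:R + 2 * (v == i)%:R) <= _).
    apply: le_trans (ler_norm_sum _ _ _) _; apply: ler_sum => u _.
    apply: le_trans (ler_norm_sum _ _ _) _; apply: ler_sum => v _.
    by rewrite -mulrDr.
  under eq_bigr => u _ do rewrite big_split /=.
  rewrite big_split /= [X in _ + X](exchange_big_dep xpredT) //=.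
  have half (w : L) : \sum_(v | edge w v) (2 : R) <= (2 * 3 ^ d)%:R.
    by rewrite sumr_const -mulrnA -[leLHS]/(_%:R) ler_nat leq_mul2l /= edge_degree.
  have -> : (4 * 3 ^ d)%:R = (2 * 3 ^ d)%:R + (2 * 3 ^ d)%:R :> R by rewrite -natrD; congr _%:R; lia.
  apply: lerD.
    rewrite (bigD1 i) //= [X in _ + X]big1 ?addr0.
      by under eq_bigr => v _ do rewrite eqxx mulr1; apply: half.
    by move=> u /negPf ui; rewrite big1 // => v _; rewrite ui mulr0.
  rewrite (bigD1 i) //= [X in _ + X]big1 ?addr0.
    under eq_bigr => v _ do rewrite eqxx mulr1.
    by apply: le_trans (half i); rewrite le_eqVlt; apply/orP; left; apply/eqP; apply: eq_bigl => v; rewrite edge_sym.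
  by move=> u /negPf ui; rewrite big1 // => v _; rewrite ui mulr0.
have E r : energy h (upd r i true) - energy h (upd r i false) = beta * (2^-1 * F r) + h i * 2.
  rewrite /energy opprD addrACA -mulrBr -mulrBr; congr (_ * (_ * _) + _).
    by rewrite /F -sumrB; apply: eq_bigr => u _; rewrite -sumrB.
  rewrite -sumrB (bigD1 i) //= big1 ?addr0; first by rewrite !updE /spin; ring.
  by move=> u /negPf ui; rewrite !ffunE ui subrr.
have Es := E s; have Et := E t; move: (Fb s) (Fb t) Es Et; move: ((4 * 3 ^ d)%:R : R) => c.
rewrite !ler_norml => /andP[s1 s2] /andP[t1 t2].
have : beta * (2^-1 * F s - 2^-1 * F t) <= beta * c by rewrite ler_wpM2l //; lra.
rewrite mulrBr; move: (energy h _) (energy h _) (energy h _) (energy h _) => e1 e2 e3 e4.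
by move: (beta * (2^-1 * _)) (beta * (2^-1 * _)) (beta * c) (h i) => x1 x2 x3 x4; lra.
Qed.

(** The external field cancels from the comparison, hence a bound uniform in the disorder. *)
Lemma gibbs_ratio h i s t :
  plus (gibbs h) (~: [set i])%SET s i <= ratio_bound * plus (gibbs h) (~: [set i])%SET t i /\
  1 - plus (gibbs h) (~: [set i])%SET s i <= ratio_bound * (1 - plus (gibbs h) (~: [set i])%SET t i).
Proof.
have mgt0 := gibbs_gt0 h; set V := (~: [set i])%SET.
have iV : i \notin V by rewrite !inE eqxx.
have iT : (i |: V)%SET = [set: L]%SET by rewrite finset.setUCr.
have mE r b : marginal (gibbs h) (i |: V)%SET (upd r i b) = gibbs h (upd r i b).
  rewrite /marginal iT (big_pred1 (upd r i b)) // => r'; apply/agreeP/eqP => [rr|-> //].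
  by apply/ffunP => x; apply: rr.
have pE r : plus (gibbs h) V r i
    = gibbs h (upd r i true) / (gibbs h (upd r i true) + gibbs h (upd r i false)).
  by rewrite plus_marginal // (marginal_reveal _ _ iV) !mE.
have swap r r' : gibbs h (upd r i true) * gibbs h (upd r' i false)
    <= ratio_bound * (gibbs h (upd r' i true) * gibbs h (upd r i false)).
  exact: gibbs_mul_le_exp (energy_flip _ _ _ _).
have r1 : 1 <= ratio_bound.
  by apply: le_trans (expR_ge1Dx _); rewrite lerDl mulr_ge0.
rewrite !pE.
have := swap s t; have := swap t s.
move: (mgt0 (upd s i true)) (mgt0 (upd s i false)) (mgt0 (upd t i true)) (mgt0 (upd t i false)).
move: (gibbs h (upd s i true)) (gibbs h (upd s i false)) (gibbs h (upd t i true))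
  (gibbs h (upd t i false)) r1 => s1 s0 t1 t0; move: ratio_bound => k.
move=> k1 s1p s0p t1p t0p ts st.
have sp : 0 < s1 + s0 by lra. have tp : 0 < t1 + t0 by lra.
have -> : 1 - s1 / (s1 + s0) = s0 / (s1 + s0) by field; rewrite gt_eqF.
have -> : 1 - t1 / (t1 + t0) = t0 / (t1 + t0) by field; rewrite gt_eqF.
split; rewrite mulrA ler_pdivrMr // mulrAC ler_pdivlMr //.
  have := mulr_ge0 (ltW s1p) (ltW t1p); nra.
have := mulr_ge0 (ltW s0p) (ltW t0p); nra.
Qed.

Lemma spin_law_cond h V s o : spin_law (cond_law (gibbs h) [set t | agree V t s]%SET) o true
  = plus (gibbs h) V s o.
Proof.
rewrite /spin_law /plus /cexp mulr_suml big_mkcond [RHS]big_mkcond /=.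
apply: eq_bigr => t _; rewrite /cond_law inE eqb_id.
have -> : \sum_(s' in [set t | agree V t s]%SET) gibbs h s' = marginal (gibbs h) V s.
  by apply: eq_bigl => t'; rewrite inE.
by case: (agree V t s) (t o) => [] []; rewrite ?(mul1r, mulr1, mul0r, mulr0).
Qed.

Local Notation bgap h r := (gap (@edge d L) (gibbs h) (fun x => linf_ball x r)).

Definition tv_gap h o r : R :=
  dTV (spin_law (gibbs_bc beta h (linf_ball o r) (constc L true)) o)
      (spin_law (gibbs_bc beta h (linf_ball o r) (constc L false)) o).

Lemma shell0 h b r s o : shell (@edge d L) (gibbs h) b (linf_ball o r) finset.set0 s o
  = spin_law (gibbs_bc beta h (linf_ball o r) (constc L b)) o true.
Proof.
rewrite spin_law_cond /shell finset.set0I finset.setU0; apply: cexp_agree.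
by apply/agreeP => y yB; rewrite ffunE yB.
Qed.

Lemma gap_le_tv h r s o : bgap h r finset.set0 s s o <= tv_gap h o r.
Proof.
rewrite /gap !shell0; apply: le_trans (ler_norm _) _.
rewrite /tv_gap /dTV (bigD1 [set true]%SET) //= !finset.big_set1 le_max lexx.
by [].
Qed.

(** Given the spins outside the ball, the field outside contributes a constant factor. *)
Lemma gap_local h h' r s o : {in linf_ball o r, h =1 h'} ->
  bgap h r finset.set0 s s o = bgap h' r finset.set0 s s o.
Proof.
move=> hh; set B := linf_ball o r.
suff main b : shell (@edge d L) (gibbs h) b B finset.set0 s o
            = shell (@edge d L) (gibbs h') b B finset.set0 s o.
  by rewrite /gap !main.
have out g : shell (@edge d L) (gibbs g) b B finset.set0 s o =
    plus (gibbs g) (~: B)%SET (mix (bdry (@edge d L) B) (cst L b) s) o.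
  rewrite /shell finset.set0I finset.setU0; symmetry.
  apply: (plus_markov (gibbs_gt0 g) (@gibbs_swap g) (B := B)) => //.
  - by apply/fintype.subsetP => u; rewrite !inE => /andP[].
  - by rewrite finset.setIC finset.setICr finset.sub0set.
  - exact: linf_ball_self.
rewrite !out; set t := mix _ _ _.
pose c := expR (\sum_(u | u \notin B) (h u - h' u) * spin R (t u))
   * (\sum_s weight h' s) / (\sum_s weight h s).
have c0 : c != 0.
  by rewrite gt_eqF // divr_gt0 ?partition_gt0 // mulr_gt0 ?expR_gt0 ?partition_gt0.
have mE r' : agree (~: B)%SET r' t -> gibbs h r' = c * gibbs h' r'.
  move=> /agreeP rt; rewrite /gibbs /c !weightE.
  have -> : energy h r' = \sum_(u | u \notin B) (h u - h' u) * spin R (t u) + energy h' r'.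
    rewrite /energy [RHS]addrCA; congr (_ + _).
    rewrite (bigID (mem B)) /= [X in _ = _ + X](bigID (mem B)) /= [RHS]addrCA; congr (_ + _).
      by apply: eq_bigr => u uB; rewrite hh.
    by rewrite -big_split /=; apply: eq_bigr => u uB; rewrite rt ?finset.in_setC //; ring.
  rewrite expRD; field; rewrite !gt_eqF ?partition_gt0 //.
rewrite /plus /cexp /marginal (eq_bigr (fun r' => c * (gibbs h' r' * (r' o)%:R))); last first.
  by move=> r' /mE ->; rewrite mulrA.
rewrite (eq_bigr _ mE) -!mulr_sumr invfM mulrACA divff // mul1r //.
Qed.

End GibbsProperties.

(** * Typical disorder *)

Section BlockIndependence.
Local Open Scope classical_set_scope.
Variables (R : realType) (I : choiceType) (J0 : {fset I}).
Local Notation L := (fset_sub_type J0).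
Variables (d : measure_display) (T : measurableType d) (P : probability T R).
Variable H : L -> {RV P >-> R}.
Hypothesis indep : mutually_independent P (fun u => H u : T -> R).
Implicit Types A : {set L}.

Definition cylinder A : set (set T) := [set E | exists2 B : L -> set R,
  forall i, measurable (B i) & E = [set w | forall i, i \in A -> B i (H i w)]].

(** Events that depend on the variables of the block [A] only. *)
Definition block A : set (set T) := <<s cylinder A >>.

Lemma cylinder_prob A (B : L -> set R) : (forall i, measurable (B i)) ->
  P [set w | forall i, i \in A -> B i (H i w)] = (\prod_(i in A) P (H i @^-1` B i))%E.
Proof.
move=> mB; have := indep [fset i | i in A]%fset mB.
have -> : \bigcap_(i in [set` [fset i | i in A]%fset]) (H i @^-1` B i)
    = [set w | forall i, i \in A -> B i (H i w)].
  apply/seteqP; split => w Bw i iA; apply: Bw; first by rewrite /= inE.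
  by move: iA; rewrite /= inE.
move=> ->; rewrite big_uniq ?fset_uniq //; apply: eq_bigl => i.
by rewrite inE.
Qed.

Lemma cylinder_measurable A : cylinder A `<=` measurable.
Proof.
move=> _ [B mB ->].
have -> : [set w | forall i, i \in A -> B i (H i w)] = \bigcap_(i in [set` A]) (H i @^-1` B i).
  by apply/seteqP; split => w Bw i iA; apply: Bw.
by apply: fin_bigcap_measurable => // i _; apply: measurable_funPTI.
Qed.

Lemma cylinder_setI A : setI_closed (cylinder A).
Proof.
move=> _ _ [B1 mB1 ->] [B2 mB2 ->]; exists (fun i => B1 i `&` B2 i).
  by move=> i; apply: measurableI.
apply/seteqP; split => w /=.
  by case=> Bw1 Bw2 i iA; split; [exact: Bw1|exact: Bw2].
by move=> Bw; split => i /Bw[].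
Qed.

Lemma cylinder_setT A : cylinder A setT.
Proof. by exists (fun=> setT) => //; apply/seteqP; split. Qed.

Lemma cylinderS A A' : A \subset A' -> cylinder A `<=` cylinder A'.
Proof.
move=> /fintype.subsetP AA' _ [B mB ->]; exists (fun i => if i \in A then B i else setT).
  by move=> i; case: ifP.
apply/seteqP; split => w Bw i iA; first by case: ifP => // /Bw.
by have := Bw i (AA' i iA); rewrite iA.
Qed.

Lemma blockS A A' : A \subset A' -> block A `<=` block A'.
Proof. by move=> /cylinderS AA'; apply: sub_smallest2r. Qed.

Lemma block_measurable A : block A `<=` measurable.
Proof.
apply: smallest_sub; first exact: sigma_algebra_measurable.
exact: cylinder_measurable.
Qed.

Lemma cylinder_indep A1 A2 E1 E2 : [disjoint A1 & A2]%B -> cylinder A1 E1 -> cylinder A2 E2 ->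
  P (E1 `&` E2) = (P E1 * P E2)%E.
Proof.
move=> dA [B1 mB1 ->] [B2 mB2 ->].
pose B i := if i \in A1 then B1 i else B2 i.
have mB i : measurable (B i) by rewrite /B; case: ifP.
have -> : [set w | forall i, i \in A1 -> B1 i (H i w)] `&` [set w | forall i, i \in A2 -> B2 i (H i w)]
    = [set w | forall i, i \in (A1 :|: A2)%SET -> B i (H i w)].
  apply/seteqP; split => w /=.
    case=> Bw1 Bw2 i; rewrite finset.in_setU /B; case: ifP => [iA _|_ /=]; first exact: Bw1.
    exact: Bw2.
  move=> Bw; split=> i iA.
    by have := Bw i; rewrite finset.in_setU iA /B iA; apply.
  by have := Bw i; rewrite finset.in_setU iA orbT /B (disjointFl dA iA); apply.
rewrite !cylinder_prob // (eq_bigl (mem [predU A1 & A2])); last first.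
  by move=> i; rewrite finset.in_setU.
rewrite bigU //=; congr (_ * _)%E; apply: eq_bigr => i iA; rewrite /B ?iA //.
by rewrite (disjointFl dA iA).
Qed.

(** Cylinders are stable under intersection and generate the events of a block, so
    independence extends from cylinders, one block at a time. *)
Lemma block_indep A1 A2 E1 E2 : [disjoint A1 & A2]%B -> block A1 E1 -> block A2 E2 ->
  P (E1 `&` E2) = (P E1 * P E2)%E.
Proof.
move=> dA; have extend A (F : set T) : measurable F ->
    (forall E, cylinder A E -> P (E `&` F) = (P E * P F)%E) ->
    forall E, block A E -> P (E `&` F) = (P E * P F)%E.
  move=> mF cyl E AE; have PF0 : 0 <= fine (P F) by apply: fine_ge0.
  have PF : P F = (fine (P F))%:E by rewrite fineK // fin_num_measure.
  have scaleE G : mscale (NngNum PF0) P G = (P G * P F)%E.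
    by transitivity ((fine (P F))%:E * P G)%E => //; rewrite -PF muleC.
  suff key : mrestr P mF E = mscale (NngNum PF0) P E by rewrite -scaleE -key.
  apply: (g_sigma_algebra_measure_unique (cylinder A) (@cylinder_measurable A)
    (fun=> setT)) => //.
  - by move=> _; apply: cylinder_setT.
  - by apply/seteqP; split => // w _; exists 0%N.
  - exact: cylinder_setI.
  - by move=> G AG; apply: eq_trans (cyl _ AG) (esym (scaleE G)).
  - move=> _; suff : (P (setT `&` F) < +oo)%E by [].
    by rewrite setTI; apply: le_lt_trans (probability_le1 P mF) _; rewrite ltry.
move=> E1A E2A; apply: (extend A1) => //; first exact: block_measurable E2A.
move=> G1 G1A; rewrite setIC muleC; apply: (extend A2) => //.
  exact: cylinder_measurable G1A.
by move=> G2 G2A; rewrite setIC muleC; apply: cylinder_indep dA _ _.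
Qed.

Lemma block_setI A E1 E2 : block A E1 -> block A E2 -> block A (E1 `&` E2).
Proof. exact: (@measurableI _ (g_sigma_algebraType (cylinder A))). Qed.

(** By induction on [X], as the events of several blocks are events of their union. *)
Lemma blocks_indep (K : finType) (V : K -> {set L}) (E : K -> set T) (X : {set K}) :
  {in X &, forall x y, x != y -> [disjoint V x & V y]%B} -> (forall x, block (V x) (E x)) ->
  P [set w | forall x, x \in X -> E x w] = (\prod_(x in X) P (E x))%E.
Proof.
move=> dis bE.
suff [_ ->] : block (\bigcup_(x in X) V x)%SET [set w | forall x, x \in X -> E x w] /\
    P [set w | forall x, x \in X -> E x w] = (\prod_(x in X) P (E x))%E by [].
have [n] := ubnP #|X|; elim: n X dis => // n IH X dis Xn.
have [->|[x xX]] := finset.set_0Vmem X.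
  rewrite finset.big_set0 [X in block _ X](_ : _ = setT); last first.
    by apply/seteqP; split => // w _ x; rewrite finset.in_set0.
  rewrite [X in P X](_ : _ = setT); last first.
    by apply/seteqP; split => // w _ x; rewrite finset.in_set0.
  rewrite finset.big_set0 probability_setT; split=> //.
  exact: (@measurableT _ (g_sigma_algebraType (cylinder _))).
have [||block' prob'] := IH (X :\ x)%SET.
  - by move=> y z; rewrite !finset.in_setD1 => /andP[_ yX] /andP[_ zX]; apply: dis.
  - by move: Xn; rewrite (cardsD1 x X) xX.
have split : [set w | forall y, y \in X -> E y w] =
    E x `&` [set w | forall y, y \in (X :\ x)%SET -> E y w].
  apply/seteqP; split => w /=.
    by move=> Ew; split=> [|y]; rewrite ?finset.in_setD1; [exact: Ew|move=> /andP[_ /Ew]].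
  case=> Ex Ew y yX; have [->//|yx] := eqVneq y x.
  by apply: Ew; rewrite finset.in_setD1 yx.
have dx : [disjoint V x & (\bigcup_(y in (X :\ x)%SET) V y)%SET]%B.
  apply/bigcup_disjointP => y.
  by rewrite finset.in_setD1 eq_sym => /andP[yx yX]; apply: dis.
rewrite split (finset.big_setD1 x xX) /= (finset.big_setD1 x xX) /=; split.
  apply: block_setI; last by apply: blockS block'; apply: finset.subsetUr.
  by apply: blockS (bE x); apply: finset.subsetUl.
by rewrite (block_indep dx (bE x) block') prob'.
Qed.

End BlockIndependence.

Section FiniteLaw.
Local Open Scope classical_set_scope.
Variables (R : realType) (d : measure_display) (T : measurableType d) (P : probability T R).
Variables (F : finType) (g : T -> F).
Hypothesis mg : forall t, measurable [set w | g w = t].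

Definition law t : R := fine (P [set w | g w = t]).

Lemma fiber_measurable (Q : pred F) : measurable [set w | Q (g w)].
Proof.
have -> : [set w | Q (g w)] = \bigcup_(t in [set t | Q t]) [set w | g w = t].
  by apply/seteqP; split => w /= => [Qw|[t Qt ->//]]; exists (g w).
by apply: fin_bigcup_measurable => //; apply: finite_finset.
Qed.

Lemma law_sum (Q : pred F) : P [set w | Q (g w)] = (\sum_(t | Q t) law t)%:E.
Proof.
have -> : [set w | Q (g w)] = \bigcup_(t in [set` [seq t <- enum F | Q t]]) [set w | g w = t].
  apply/seteqP; split => w /= => [Qw|[t]].
    by exists (g w); rewrite //= mem_filter Qw mem_enum.
  by rewrite /= mem_filter => /andP[Qt _] ->.
have ur : uniq [seq t <- enum F | Q t] by rewrite filter_uniq // enum_uniq.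
rewrite measure_fin_bigcup //.
- rewrite -fsbig_seq //.
  transitivity (\sum_(t <- enum F | Q t) P [set w | g w = t])%E; first exact: big_filter.
  rewrite big_enum_cond /= -sumEFin.
  by apply: eq_bigr => t _; rewrite fineK // fin_num_measure.
- by move=> t t' _ _ [w [/= -> ->]].
Qed.

Lemma law_ge0 t : 0 <= law t.
Proof. exact: fine_ge0. Qed.

Lemma law_sum1 : \sum_t law t = 1.
Proof.
apply: EFin_inj; rewrite -(law_sum xpredT) -(probability_setT P); congr (P _).
by apply/seteqP; split.
Qed.

Lemma law_markov (Y : F -> R) (m c : R) : (forall t, 0 <= Y t) -> 0 < c ->
  \sum_t law t * Y t <= m -> (P [set w | (c < Y (g w))%R] <= (m / c)%:E)%E.
Proof.
move=> Y0 c0 EY; rewrite (law_sum (fun t => (c < Y t)%R)) lee_fin ler_pdivlMr // mulr_suml.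
apply: le_trans EY; rewrite [leRHS](bigID (fun t => (c < Y t)%R)) /=.
apply: ler_wpDr; first by apply: sumr_ge0 => t _; rewrite mulr_ge0 ?law_ge0.
by apply: ler_sum => t /ltW cY; rewrite ler_wpM2l ?law_ge0.
Qed.

End FiniteLaw.

Section Measurability.
Variables (R : realType) (d : nat) (L : {fset site d}) (beta : R).
Variables (dT : measure_display) (T : measurableType dT) (g : L -> T -> R).
Hypothesis mg : forall u, measurable_fun setT (g u).

Lemma measurable_inv (f : T -> R) : measurable_fun setT f -> (forall w, 0 < f w) ->
  measurable_fun setT (fun w => (f w)^-1).
Proof.
move=> mf f0; have -> : (fun w => (f w)^-1) = expR \o (fun w => - ln (f w)).
  by apply/funext => w /=; rewrite expRN lnK ?posrE.
apply: measurableT_comp; first exact: measurable_expR.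
by apply: measurable_funN; apply: measurableT_comp => //; apply: measurable_ln.
Qed.

Lemma measurable_sum_cond (I : finType) (Q : pred I) (F : I -> T -> R) :
  (forall i, measurable_fun setT (F i)) -> measurable_fun setT (fun w => \sum_(i | Q i) F i w).
Proof.
move=> mF; under eq_fun do rewrite big_mkcond /=; apply: measurable_sum => i.
by case: (Q i) => //; apply: measurable_cst.
Qed.

Lemma measurable_weight s : measurable_fun setT (fun w => weight beta (fun u => g u w) s).
Proof.
apply: measurableT_comp; first exact: measurable_expR.
apply: measurable_funD; first exact: measurable_cst.
by apply: measurable_sum => u; apply: measurable_funM; [exact: mg|exact: measurable_cst].
Qed.

Lemma measurable_gibbs s : measurable_fun setT (fun w => gibbs beta (fun u => g u w) s).
Proof.
apply: measurable_funM; first exact: measurable_weight.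
apply: measurable_inv => [|w]; last exact: partition_gt0.
by apply: measurable_sum => t; apply: measurable_weight.
Qed.

Lemma measurable_gibbs_bc A s o b :
  measurable_fun setT (fun w => spin_law (gibbs_bc beta (fun u => g u w) A s) o b).
Proof.
apply: measurable_sum_cond => t; apply: measurable_funM.
  by apply: measurable_funM; [apply: measurable_cst|apply: measurable_gibbs].
apply: measurable_inv => [|w]; first by apply: measurable_sum_cond => t'; apply: measurable_gibbs.
rewrite (bigD1 s) /=; last by rewrite inE; apply/forall_inP.
by rewrite ltr_pwDl ?gibbs_gt0 // sumr_ge0 // => t' _; apply/ltW/gibbs_gt0.
Qed.

Lemma measurable_gap r s o : measurable_fun setT (fun w =>
  gap (@edge d L) (gibbs beta (fun u => g u w)) (fun x => linf_ball x r) finset.set0 s s o).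
Proof.
have -> : (fun w => gap (@edge d L) (gibbs beta (fun u => g u w)) (fun x => linf_ball x r)
      finset.set0 s s o)
   = (fun w => spin_law (gibbs_bc beta (fun u => g u w) (linf_ball o r) (constc L true)) o true
      - spin_law (gibbs_bc beta (fun u => g u w) (linf_ball o r) (constc L false)) o true).
  by apply/funext => w; rewrite /gap !shell0.
by apply: measurable_funB; apply: measurable_gibbs_bc.
Qed.

Lemma measurable_tv_gap r o : measurable_fun setT (fun w => tv_gap beta (fun u => g u w) o r).
Proof.
rewrite /tv_gap /dTV; elim: (index_enum _) => [|A l IH].
  by under eq_fun do rewrite big_nil; apply: measurable_cst.
under eq_fun do rewrite big_cons; apply: measurable_maxr => //.
apply: measurableT_comp; first exact: normr_measurable.
by apply: measurable_funB; apply: measurable_sum_cond => b; apply: measurable_gibbs_bc.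
Qed.

End Measurability.

Section Disorder.
Local Open Scope classical_set_scope.
Variables (R : realType) (d : nat) (L : {fset site d}) (beta C : R).
Hypothesis beta0 : 0 <= beta.
Variables (d0 : measure_display) (Omega : measurableType d0) (P : probability Omega R).
Variable H : L -> {RV P >-> R}.
Hypotheses (indep : mutually_independent P (fun u => H u : Omega -> R)) (wsm : WSM beta H C).
Variable r : nat.
Hypothesis r1 : (1 <= r)%N.
Implicit Types (A X : {set L}) (x y o : L).

Local Notation field w := (fun u => H u w).
Local Notation ball := (fun x => linf_ball x r).
Local Notation near := (@within d L (r + r)).
Local Notation hop := (@within d L (r + r).+1).
Local Notation s0 := (constc L true).
Local Notation gap0 w := (gap (@edge d L) (gibbs beta (field w)) ball finset.set0 s0 s0).

Lemma field_measurable u : measurable_fun setT (fun w => H u w).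
Proof. exact: measurable_funPT. Qed.

Variable eps : R.
Hypothesis eps0 : 0 < eps.

(** Sites at which the field fails to provide mixing at the scale [r]. *)
Definition bad_sites w := [set x | eps < gap0 w x]%SET.

(** The gap at [x] only depends on the field in the ball, so it is unchanged if the field is
    replaced by 0 outside. *)
Lemma bad_block x : block H (linf_ball x r) [set w | x \in bad_sites w].
Proof.
pose B := linf_ball x r; pose T' := g_sigma_algebraType (cylinder H B).
pose h' u (w : T') : R := if u \in B then H u w else 0.
have mh' u : measurable_fun setT (h' u).
  rewrite /h'; case uB : (u \in B); last exact: measurable_cst.
  move=> _ Y mY; rewrite setTI; apply: sub_sigma_algebra.
  exists (fun i => if i == u then Y else setT).
    by move=> i; case: ifP.
  apply/seteqP; split => w /= => [Yw i _|]; first by case: eqP => // ->.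
  by move=> /(_ u uB); rewrite eqxx.
have := @measurable_gap R d L beta _ T' h' mh' r s0 x measurableT `]eps, +oo[ (measurable_itv _).
rewrite setTI; congr (_ _); apply/seteqP; split => w /=;
  rewrite in_itv /= andbT inE (@gap_local R d L beta _ (field w)) // => u uB;
  by rewrite /h' uB.
Qed.

Lemma bad_measurable x : measurable [set w | x \in bad_sites w].
Proof. exact: block_measurable (@bad_block x). Qed.

Lemma bad_prob x : P [set w | x \in bad_sites w] = (fine (P [set w | x \in bad_sites w]))%:E.
Proof. by rewrite fineK // fin_num_measure //; apply: bad_measurable. Qed.

(** Markov's inequality, the gap being at most the total variation distance of weak mixing. *)
Lemma bad_prob_le x : (P [set w | x \in bad_sites w] <= (C * expR (- (r%:R / C)) / eps)%:E)%E.
Proof.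
have := wsm x r1; rewrite unlock => tail.
have : (\int[P]_w (eps * \1_[set w | x \in bad_sites w] w)%:E <= (C * expR (- (r%:R / C)))%:E)%E.
  apply: le_trans tail; apply: ge0_le_integral => //.
  - by move=> w _; rewrite lee_fin mulr_ge0 // ltW.
  - apply/measurable_EFinP; apply: measurable_funM; first exact: measurable_cst.
    by apply: measurable_indic; apply: bad_measurable.
  - by apply/measurable_EFinP; apply: (measurable_tv_gap beta field_measurable r x).
  move=> w _; rewrite lee_fin; apply: le_trans (gap_le_tv beta (field w) r s0 x).
  rewrite indicE; have [wx|wx] := boolP (x \in bad_sites w).
    by rewrite mem_set // mulr1 ltW //; move: wx; rewrite inE.
  rewrite memNset; last exact/negP.
  by rewrite mulr0; apply: gap_ge0 => //; [exact: gibbs_gt0|exact: gibbs_lattice].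
under eq_integral do rewrite EFinM.
rewrite ge0_integralZl_EFin //; last 2 first.
- by apply/measurable_EFinP; apply: measurable_indic; apply: bad_measurable.
- exact: ltW.
rewrite integral_indic ?setIT //; last exact: bad_measurable.
move=> epsP; have PE := bad_prob x.
have : ((eps * fine (P [set w | x \in bad_sites w]))%:E <= (C * expR (- (r%:R / C)))%:E)%E.
  by rewrite EFinM -PE; exact: epsP.
by rewrite PE !lee_fin ler_pdivlMr // mulrC.
Qed.

Lemma bad_sites_measurable X : measurable [set w | bad_sites w = X].
Proof.
have -> : [set w | bad_sites w = X] =
    \bigcap_(x in [set: L]) [set w | (x \in bad_sites w) = (x \in X)].
  apply/seteqP; split => w /= => [bX x _ /=|bX]; first by rewrite bX.
  by apply/finset.setP => x; apply: bX.
apply: fin_bigcap_measurable => // x _; case: (x \in X); first exact: bad_measurable.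
have -> : [set w | (x \in bad_sites w) = false] = ~` [set w | x \in bad_sites w].
  by apply/seteqP; split => w /= => [->//|/negP/negbTE].
exact: measurableC (bad_measurable x).
Qed.

Local Notation law := (law P bad_sites).

Lemma law_bad_subset (pi : R) X : separated ball X ->
  (forall x, (P [set w | x \in bad_sites w] <= pi%:E)%E) ->
  \sum_(Y : {set L} | X \subset Y) law Y <= pi ^+ #|X|.
Proof.
move=> sepX bad; rewrite -lee_fin -(law_sum _ bad_sites_measurable (fun Y => X \subset Y)).
have -> : [set w | X \subset bad_sites w] = [set w | forall x, x \in X -> [set w | x \in bad_sites w] w].
  by apply/seteqP; split => w /= /fintype.subsetP.
rewrite (blocks_indep indep (V := ball)) //; last exact: bad_block.
under eq_bigr => x _ do rewrite bad_prob.
rewrite prodEFin lee_fin -prodr_const; apply: ler_prod => x _.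
by rewrite fine_ge0 //= -lee_fin -bad_prob.
Qed.

(** Expanding the product, each site of [Y] is either charged [eps] or required to be bad; the
    sites of [X] are those already required to be bad. *)
Lemma mean_bad_prod (pi : R) X Y : separated ball (X :|: Y)%SET -> [disjoint X & Y]%B ->
  (forall x, (P [set w | x \in bad_sites w] <= pi%:E)%E) ->
  \sum_(Z : {set L} | X \subset Z) law Z * \prod_(x in Y) (eps + (x \in Z)%:R)
  <= pi ^+ #|X| * (eps + pi) ^+ #|Y|.
Proof.
move=> + + bad; have [n] := ubnP #|Y|; elim: n X Y => // n IH X Y Yn sep dis.
have [Y0|[y yY]] := finset.set_0Vmem Y.
  rewrite Y0 finset.cards0 expr0 mulr1; under eq_bigr => Z _ do rewrite finset.big_set0 mulr1.
  by apply: law_bad_subset => // x y xX yX; apply: sep; rewrite finset.in_setU ?xX ?yX.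
have yX : y \notin X by rewrite (disjointFl dis yY).
have Yn' : (#|(Y :\ y)%SET| < n)%N by move: Yn; rewrite (cardsD1 y Y) yY.
have sep1 : separated ball (X :|: (Y :\ y))%SET.
  by move=> x z; rewrite !finset.in_setU !finset.in_setD1 => xXY zXY; apply: sep;
    rewrite finset.in_setU; [case/orP: xXY => [->//|/andP[_ ->]]|case/orP: zXY => [->//|/andP[_ ->]]];
    rewrite orbT.
have dis1 : [disjoint X & (Y :\ y)%SET]%B by apply: disjointWr dis; apply: finset.subsetDl.
have sep2 : separated ball ((y |: X) :|: (Y :\ y))%SET.
  by apply: sub_in2 sep => x; rewrite !finset.in_setU finset.in_set1 finset.in_setD1;
    case: eqP => [->|_] /=; rewrite ?yY ?orbT.
have dis2 : [disjoint (y |: X)%SET & (Y :\ y)%SET]%B.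
  rewrite -finset.setI_eq0; apply/eqP/finset.setP => x.
  rewrite !finset.inE; case: eqP => //= _; have := disjointFr dis (x := x).
  by case: (x \in X) => //= ->.
have {sep1 dis1} IH1 := IH _ _ Yn' sep1 dis1; have {sep2 dis2} IH2 := IH _ _ Yn' sep2 dis2.
have E : \sum_(Z : {set L} | X \subset Z) law Z * \prod_(x in Y) (eps + (x \in Z)%:R)
  = eps * (\sum_(Z : {set L} | X \subset Z) law Z * \prod_(x in (Y :\ y)%SET) (eps + (x \in Z)%:R))
  + \sum_(Z : {set L} | (y |: X)%SET \subset Z) law Z * \prod_(x in (Y :\ y)%SET) (eps + (x \in Z)%:R).
  rewrite mulr_sumr [X in _ = _ + X]big_mkcond [X in _ = X + _]big_mkcond -big_split /=.
  rewrite big_mkcond; apply: eq_bigr => Z _.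
  rewrite finset.subUset finset.sub1set (finset.big_setD1 y yY) /=.
  by case: (X \subset Z) (y \in Z) => [] [] /=; ring.
have epsi : 0 <= eps by apply: ltW.
rewrite E (cardsD1 y Y) yY exprS; rewrite (cardsU1 y X) yX exprS /= in IH2.
apply: le_trans (lerD (ler_wpM2l epsi IH1) IH2) _.
move: (pi ^+ #|X|) ((eps + pi) ^+ _) => p q.
by have -> : p * ((eps + pi) * q) = eps * (p * q) + pi * p * q by ring.
Qed.

Let N : R := #|{: L}|%:R.

(** There are at most [Delta ^ (2 * J)] walks of [2 * J] steps, while the expectation of the
    product of [J] separated gaps is at most [(eps + pi) ^ J], which is small enough for the sums
    weighted by [expR J] to have a bounded expectation. *)
Lemma disorder_event (pi : R) (Delta : nat) (delta : R) : (0 < #|{: L}|)%N -> 0 < delta ->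
  (forall x, #|hop x| <= Delta)%N ->
  (forall x, (P [set w | x \in bad_sites w] <= pi%:E)%E) ->
  expR 1 * (Delta ^ 2)%:R * (eps + pi) <= 1 / 2 ->
  exists E : set Omega, [/\ measurable E, ((1 - delta)%:E <= P E)%E &
    forall w, E w -> forall J, \sum_o walk_sum near hop J o (gap0 w)
      <= expR 1 * N / delta * expR (- J%:R)].
Proof.
move=> L0 delta0 deg bad small; have N0 : 0 < N by rewrite ltr0n.
pose wt (Z : {set L}) x := eps + (x \in Z)%:R.
have wt0 Z x : 0 <= wt Z x by rewrite addr_ge0 ?ler0n // ltW.
pose Y (Z : {set L}) := \sum_(J < #|{: L}|) expR J%:R * \sum_o walk_sum near hop J o (wt Z).
have Y0 Z : 0 <= Y Z.
  apply: sumr_ge0 => J _; apply: mulr_ge0; first exact: expR_ge0.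
  by apply: sumr_ge0 => o _; apply: walk_sum_ge0.
have pi0 : 0 <= pi.
  have /card_gt0P[ o _] := L0; rewrite -lee_fin; apply: le_trans (bad o); exact: measure_ge0.
have EY : \sum_Z law Z * Y Z <= 2 * N.
  have walk J o : \sum_Z law Z * walk_sum near hop J o (wt Z) <= ((Delta ^ 2)%:R * (eps + pi)) ^+ J.
    under eq_bigr => Z _ do rewrite mulr_sumr.
    rewrite exchange_big /=.
    apply: le_trans (_ : \sum_(p <- walks hop (2 * J) o) (eps + pi) ^+ J <= _).
      rewrite [leLHS]big_mkcond /=; apply: ler_sum => p _; case: ifP => [sp|_]; last first.
        by rewrite exprn_ge0 // addr_ge0 // ltW.
      have sepp := spread_separated (@linf_ball_disjoint d L r) sp.
      have := @mean_bad_prod pi finset.set0 (trace o p :\ o)%SET.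
      rewrite finset.set0U finset.cards0 expr0 mul1r.
      have -> : #|(trace o p :\ o)%SET| = J.
        have /andP[/eqP + _] := sp; rewrite (cardsD1 o) !inE eqxx /= add1n => [[]] //.
      move=> H1; apply: le_trans (H1 _ _ bad).
      - rewrite le_eqVlt; apply/orP; left; apply/eqP; apply: eq_bigl => Z.
        by rewrite finset.sub0set.
      - by apply: sub_in2 sepp => x; rewrite finset.in_setD1 => /andP[].
      - by rewrite -finset.setI_eq0 finset.set0I.
    rewrite big_const_seq count_predT iter_addr_0 -[leLHS]mulr_natl exprMn.
    apply: ler_wpM2r; first by rewrite exprn_ge0 // addr_ge0 // ltW.
    by rewrite -natrX ler_nat -expnM size_walks.
  have -> : \sum_Z law Z * Y Z =
      \sum_(J < #|{: L}|) expR J%:R * \sum_o \sum_Z law Z * walk_sum near hop J o (wt Z).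
    under eq_bigr => Z _ do rewrite mulr_sumr.
    rewrite exchange_big /=; apply: eq_bigr => J _.
    rewrite exchange_big /= mulr_sumr; apply: eq_bigr => Z _.
    by rewrite mulrCA mulr_sumr.
  apply: le_trans (_ : \sum_(J < #|{: L}|) N * (1 / 2) ^+ J <= _).
    apply: ler_sum => J _.
    apply: le_trans (_ : expR J%:R * \sum_(o : L) ((Delta ^ 2)%:R * (eps + pi)) ^+ J <= _).
      by apply: ler_wpM2l; [exact: expR_ge0|apply: ler_sum => o _; apply: walk].
    rewrite sumr_const -[X in _ * X <= _]mulr_natl mulrCA; apply: ler_wpM2l; first exact: ltW.
    rewrite -[J%:R]mulr1 expRM_natl -exprMn mulrA; apply: lerXn2r; rewrite ?nnegrE //.
    apply: mulr_ge0; last by apply: addr_ge0 => //; apply: ltW.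
    by apply: mulr_ge0; [apply: expR_ge0|apply: ler0n].
  rewrite -mulr_sumr mulrC; apply: ler_wpM2r; first exact: ltW.
  have geo n : \sum_(J < n) (1 / 2) ^+ J <= 2 - 2 * (1 / 2) ^+ n :> R.
    elim: n => [|n IHn]; first by rewrite big_ord0 expr0; lra.
    by rewrite big_ord_recr /= exprS; lra.
  by apply: le_trans (geo _) _; rewrite gerBl mulr_ge0 // exprn_ge0.
have c0 : 0 < 2 * N / delta by rewrite divr_gt0 // mulr_gt0.
pose F := [set w | (2 * N / delta < Y (bad_sites w))%R].
have mF : measurable F.
  exact: (fiber_measurable bad_sites_measurable (fun Z => (2 * N / delta < Y Z)%R)).
have PF : (P F <= delta%:E)%E.
  have := law_markov bad_sites_measurable Y0 c0 EY; congr (_ <= _%:E)%E.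
  by field; rewrite !gt_eqF.
exists (~` F); split.
- exact: measurableC.
- by rewrite probability_setC // EFinB leeB.
move=> w /negP; rewrite -leNgt => Yw J.
have [JN|JN] := ltnP J #|{: L}|; last first.
  rewrite big1 => [|o _].
    apply: mulr_ge0; last exact: expR_ge0.
    by apply: divr_ge0; [apply: mulr_ge0; [exact: expR_ge0|exact: ltW]|exact: ltW].
  rewrite /walk_sum big_pred0 // => p; apply/negbTE/negP => /andP[/eqP tp _].
  have : (#|trace o p| <= #|{: L}|)%N by apply: max_card.
  by rewrite tp ltnNge JN.
have gap_wt x : 0 <= gap0 w x <= wt (bad_sites w) x.
  apply/andP; split; first by apply: gap_ge0 => //; [exact: gibbs_gt0|exact: gibbs_lattice].
  rewrite /wt inE; case: ltP => [_|/=]; last by rewrite addr0.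
  apply: le_trans (_ : 1 <= _); last by rewrite lerDr ltW.
  rewrite /gap lerBlDr; apply: le_trans (plus_le1 _ _ _ _) _; first exact: gibbs_gt0.
  by rewrite lerDl plus_ge0 //; exact: gibbs_gt0.
rewrite expRN ler_pdivlMr ?expR_gt0 //.
apply: le_trans (_ : 2 * N / delta <= _).
  apply: le_trans Yw; rewrite /Y (bigD1 (Ordinal JN)) //= mulrC.
  apply: ler_wpDr.
    apply: sumr_ge0 => J' _; apply: mulr_ge0; first exact: expR_ge0.
    by apply: sumr_ge0 => o _; apply: walk_sum_ge0.
  apply: ler_wpM2l; first exact: expR_ge0.
  apply: ler_sum => o _; apply: ler_sum => p _; apply: ler_prod => x _; exact: gap_wt.
rewrite ler_wpM2r ?invr_ge0 ?(ltW delta0) // ler_wpM2r ?(ltW N0) //.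
by apply: le_trans (expR_ge1Dx _); lra.
Qed.

End Disorder.

(** * Glauber dynamics on short time intervals *)

Section Paths.
Local Open Scope classical_set_scope.
Variables (R : realType) (d : nat) (L : {fset site d}) (beta : R) (h : L -> R).
Variables (d1 : measure_display) (S : measurableType d1) (Q : probability S R).
Variables (N : L -> R -> {RV Q >-> nat}) (U : L -> nat -> {RV Q >-> R}).
Variable X : conf L -> R -> S -> conf L.
Hypothesis dyn : glauber beta h N U X.
Implicit Types (v : L) (w : S).

Lemma glauber_still (s0 : conf L) w (t1 t2 : R) : 0 <= t1 <= t2 -> (forall v, N v t1 w = N v t2 w) ->
  X s0 t2 w = X s0 t1 w.
Proof.
move=> t12 same; apply/ffunP => v; exact: glauber_constant dyn _ _ _ _ _ t12 (same v).
Qed.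

Let paths : clock_paths N.
Proof. exact: poisson_paths (glauber_clocks dyn). Qed.

Let mono v w (s t : R) : 0 <= s -> s <= t -> (N v s w <= N v t w)%N.
Proof. by move=> s0 st; apply: (clock_nondecreasing paths); rewrite s0. Qed.

(** The ring takes place at the infimum of the times at which the counter of [v] exceeds its
    initial value: by right-continuity the counter has jumped at that time, and the state is
    constant before and after it. *)
Lemma glauber_one_ring (s0 : conf L) v w (t1 t2 : R) : 0 <= t1 -> t1 < t2 ->
  (forall u, u != v -> N u t2 w = N u t1 w) -> N v t2 w = (N v t1 w).+1 ->
  X s0 t2 w = upd (X s0 t1 w) v (U v (N v t2 w) w < plus_prob beta h v (X s0 t1 w)).
Proof.
move=> t10 t12 others one.
pose A := [set s | t1 <= s /\ (N v t1 w < N v s w)%N]; pose r := inf A.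
have At2 : A t2 by split; [exact: ltW|rewrite one].
have lbA : lbound A t1 by move=> s [].
have hA : has_inf A by split; [exists t2|exists t1].
have t1r : t1 <= r by apply: lb_le_inf => //; exists t2.
have rt2 : r <= t2 by apply: ge_inf => //; exists t1.
have r0 : 0 <= r by apply: le_trans t1r.
have Nr : N v r w = N v t2 w.
  have [e /= e0 re] := clock_right_continuous paths v w r0.
  have [s As sre] := inf_adherent e0 hA.
  have rs : r <= s by apply: ge_inf => //; exists t1.
  have NrNs : N v r w = N v s w.
    have [->//|rs'] := eqVneq r s.
    apply/esym; apply: re => /=; last by rewrite lt_neqAle rs'.
    by rewrite distrC ger0_norm ?subr_ge0 // ltrBlDl.
  apply/eqP; rewrite eqn_leq mono //= one NrNs.
  by case: As.
have tr : t1 < r.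
  rewrite lt_neqAle t1r andbT; apply/eqP => t1r'.
  by move: Nr; rewrite -t1r' one => /eqP; rewrite -addn1 -{1}(addn0 (N v t1 w)) eqn_add2l.
have before s : t1 <= s -> s < r -> N v s w = N v t1 w.
  move=> ts sr; apply/eqP; rewrite eqn_leq (mono _ _ t10 ts) andbT leqNgt.
  apply/negP => big; have : r <= s by apply: ge_inf; [exists t1|split].
  by rewrite leNgt sr.
have others' u s : u != v -> t1 <= s -> s <= t2 -> N u s w = N u t1 w.
  move=> uv ts st; apply/eqP; rewrite eqn_leq (mono _ _ t10 ts) andbT -(others u uv).
  by apply: mono => //; apply: le_trans ts.
have left_r : \forall s \near r^'-, t1 < s < r.
  near=> s; apply/andP; split; near: s; [exact: nbhs_left_gt|exact: nbhs_left_lt].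
have ring : rings_at N v r w.
  split; first exact: le_lt_trans tr.
  by apply: filterS left_r => s /andP[ts sr]; rewrite before // 1?ltW // Nr one.
have still s : t1 <= s -> s < r -> X s0 s w = X s0 t1 w.
  move=> ts sr; apply: glauber_still; rewrite ?t10 // => u.
  have [->|uv] := eqVneq u v; first by rewrite before.
  by rewrite others' // (le_trans (ltW sr)).
have -> : X s0 t2 w = X s0 r w.
  apply: glauber_still; rewrite ?r0 // => u.
  have [->//|uv] := eqVneq u v.
  by rewrite !others' // ltW.
apply/ffunP => u; rewrite ffunE; case: eqP => [->|/eqP uv].
  have [s [/andP[ts sr] ->]] :=
    filter_ex (filterI left_r (glauber_resample dyn s0 ring)).
  by rewrite Nr still // ltW.
apply: (glauber_constant dyn); first by rewrite t10.
by apply/esym/others'.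
Unshelve. all: by end_near. Qed.

End Paths.

Section IndependentConstraints.
Local Open Scope classical_set_scope.
Variables (R : realType) (d1 : measure_display) (S : measurableType d1) (Q : probability S R).
Variables (I : choiceType) (K : eqType) (Y : I -> S -> R) (A : K -> set R).
Hypothesis indep : mutually_independent Q Y.
Hypothesis mA : forall k, measurable (A k).

Definition satisfies (l : seq (I * K)) : set S :=
  [set w | forall c, c \in l -> A c.2 (Y c.1 w)].

Lemma prob_satisfies l : uniq (unzip1 l) ->
  Q (satisfies l) = (\prod_(c <- l) Q (Y c.1 @^-1` A c.2))%E.
Proof.
case: l => [|c0 l'].
  have -> : satisfies [::] = setT by apply/seteqP; split.
  by rewrite big_nil probability_setT.
move: (c0 :: l') => {l'}l ul.
pose B i := A (nth c0 l (index i (unzip1 l))).2.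
have BE c : c \in l -> B c.1 = A c.2.
  move=> cl; rewrite /B.
  have {2}<- : nth c0 l (index c l) = c by rewrite nth_index.
  congr (A (nth _ _ _).2).
  rewrite -[RHS](index_uniq c0.1 _ ul); last by rewrite size_map index_mem.
  by rewrite (nth_map c0) ?index_mem // nth_index.
have mB i : measurable (B i) by apply: mA.
have := indep [fset i in unzip1 l]%fset mB.
have -> : \bigcap_(i in [set` [fset i in unzip1 l]%fset]) (Y i @^-1` B i) = satisfies l.
  apply/seteqP; split => w /= sat.
    move=> c cl; rewrite -BE //; apply: sat => /=.
    by rewrite inE; apply: map_f.
  move=> i; rewrite /= inE => /mapP[c cl ->]; rewrite BE //; exact: sat.
move=> ->; rewrite (perm_big (unzip1 l)) /=; last first.
  by apply: uniq_perm; rewrite ?fset_uniq // => i; rewrite inE.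
rewrite [LHS]big_map [LHS]big_seq [RHS]big_seq.
by apply: eq_bigr => c cl; rewrite BE.
Qed.

End IndependentConstraints.

Section UniformMark.
Local Open Scope classical_set_scope.
Variable R : realType.

Lemma uniform_prob_lt (p : R) : 0 <= p <= 1 ->
  uniform_prob (@ltr01 R) [set x | x < p] = p%:E.
Proof.
move=> /andP[p0 p1]; rewrite /uniform_prob integral_uniform_pdf.
have -> : [set x | x < p] `&` `[0, 1] = `[0, p[ :> set R.
  apply/seteqP; split => x /=; rewrite !in_itv /=.
    by case=> -> /andP[-> _].
  by case/andP=> -> xp; split=> //; apply: ltW (lt_le_trans xp p1).
rewrite (eq_integral (fun=> 1%:E)); last first.
  move=> x; rewrite inE /= in_itv /= /uniform_pdf => /andP[-> xp].
  by rewrite (ltW (lt_le_trans xp p1)) subr0 invr1.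
rewrite integral_cst //= lebesgue_measure_itv /= lte_fin mul1e.
by case: ltP => [_|p0']; rewrite ?oppr0 ?adde0 ?sube0 //; congr _%:E; apply/eqP; rewrite eq_le p0.
Qed.

End UniformMark.

Section DiscreteHistory.
Local Open Scope classical_set_scope.
Variables (R : realType) (d : nat) (L : {fset site d}) (beta : R) (h : L -> R).
Variable eta : R.
Hypothesis eta0 : 0 < eta.
Local Notation conf := (conf L).
Local Notation mu := (gibbs beta h).
Local Notation nsites := (#|{: L}|%:R : R).
Implicit Types (s : conf) (v : L).

(** What happens during a short time interval: no ring, or one ring of the given clock after
    which its site takes the given spin. *)
Definition step := option (L * bool).

Definition rings (st : step) v := if st is Some (u, _) then u == v else false.

Definition after s (st : step) : conf := if st is Some (v, b) then upd s v b else s.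

Definition step_weight s (st : step) : R :=
  if st is Some (v, b) then
    eta * (if b then plus_prob beta h v s else 1 - plus_prob beta h v s)
  else 1.

Lemma plus_probE v s : plus_prob beta h v s = plus mu (~: [set v])%SET s v.
Proof.
rewrite -spin_law_cond /plus_prob; congr (spin_law (cond_law _ _) v true).
apply/setP => t; rewrite !inE; apply/eq_forallb => u.
by rewrite !inE.
Qed.

Lemma plus_prob01 v s : 0 <= plus_prob beta h v s <= 1.
Proof.
by rewrite plus_probE plus_ge0 ?plus_le1 //; apply: gibbs_gt0.
Qed.

Lemma sum_steps (F : step -> R) :
  \sum_st F st = F None + \sum_v (F (Some (v, true)) + F (Some (v, false))).
Proof.
rewrite (bigD1 None) //=; congr (_ + _).
rewrite (reindex_omap (Some : L * bool -> step) id) /=; last by case.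
rewrite (eq_bigl xpredT) => [|vb]; last by rewrite eqxx.
transitivity (\sum_v \sum_b F (Some (v, b))).
  by rewrite pair_bigA; apply: eq_bigr => -[].
by apply: eq_bigr => v _; rewrite big_bool.
Qed.

Lemma sum_step_weight (f : conf -> R) s :
  \sum_st step_weight s st * f (after s st) = (1 + eta * nsites) * resample mu eta f s.
Proof.
have Z0 : 0 < 1 + eta * nsites by rewrite ltr_pwDl // mulr_ge0 ?ler0n // ltW.
rewrite mulrC divfK ?gt_eqF // sum_steps /= mul1r mulr_sumr; congr (_ + _).
apply: eq_bigr => v _; rewrite (cexp_reveal (gibbs_gt0 beta h) _ f s v) -plus_probE.
have full b : cexp mu (v |: ~: [set v])%SET f (upd s v b) = f (upd s v b).
  by rewrite finset.setUCr (cexp_id (gibbs_gt0 beta h)) // => t /agreeP ts;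
    congr f; apply/ffunP => u; apply: ts.
by rewrite !full [RHS]mulrDr !mulrA.
Qed.

End DiscreteHistory.

Section History.
Local Open Scope classical_set_scope.
Variables (R : realType) (d : nat) (L : {fset site d}) (beta : R) (h : L -> R).
Variables (d1 : measure_display) (S : measurableType d1) (Q : probability S R).
Variables (N : L -> R -> {RV Q >-> nat}) (U : L -> nat -> {RV Q >-> R}).
Variable X : conf L -> R -> S -> conf L.
Hypothesis dyn : glauber beta h N U X.
Variable eta : R.
Hypothesis eta0 : 0 < eta.
Variable start : conf L.
Local Notation conf := (conf L).
Local Notation mu := (gibbs beta h).
Local Notation nsites := (#|{: L}|%:R : R).
Local Notation step := (step L).
Local Notation step_weight := (step_weight beta h eta).
Implicit Types (s : conf) (v : L) (l : seq step).

Local Notation index := ((L * nat) + (L * nat))%type.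
Local Notation code := (bool + R * bool)%type.

(** Constraints are encoded by a boolean for an increment, and by a threshold and the result of
    the comparison with it for a mark. *)
Definition code_set (k : code) : set R :=
  match k with
  | inl b => [set b%:R]
  | inr (p, b) => [set x | (x < p) = b]
  end.

Lemma measurable_code_set k : measurable (code_set k).
Proof.
case: k => [b|[p b]]; first exact: measurable_set1.
have mp : measurable [set x : R | x < p].
  by rewrite [X in measurable X](_ : _ = `]-oo, p[) //; apply/seteqP; split => x; rewrite /= in_itv.
case: b => //=; rewrite [X in measurable X](_ : _ = ~` [set x : R | x < p]); first exact: measurableC.
by apply/seteqP; split => x /=; [move=> ->|move/negP/negbTE].
Qed.

Let tt (j : nat) : R := j%:R * eta.

Let ttS j : tt j.+1 - tt j = eta.
Proof. by rewrite /tt -natr1 mulrDl mul1r addrC addKr. Qed.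

Let tt_ge0 j : 0 <= tt j.
Proof. by rewrite mulr_ge0 ?ler0n // ltW. Qed.

Let tt_lt j : tt j < tt j.+1.
Proof. by rewrite -subr_gt0 ttS. Qed.

Local Notation obs := (increments_and_marks N U tt).

Let indep : mutually_independent Q obs.
Proof.
apply: (clocks_marks_independent (glauber_clocks dyn)); first exact: tt_ge0.
by move=> i j ij; rewrite ler_wpM2r ?ler_nat // ltW.
Qed.

(** Histories list the most recent step first. *)
Definition current l : conf := foldr (fun st s => after s st) start l.

Definition ring_count v l := count (fun st => rings st v) l.

Definition clock_constraints (st : step) (j : nat) : seq (index * code) :=
  [seq (inl (v, j), inl (rings st v)) | v <- enum {: L}].

(** Marks are indexed by the value of the counter just after the ring. *)
Definition mark_constraint (st : step) l : seq (index * code) :=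
  if st is Some (v, b) then
    [:: (inr (v, (ring_count v l).+1), inr (plus_prob beta h v (current l), b))]
  else [::].

Fixpoint constraints l : seq (index * code) :=
  if l is st :: l' then mark_constraint st l' ++ clock_constraints st (size l') ++ constraints l'
  else [::].

(** The event that the steps during the first [size l] intervals of length [eta] are those of
    [l]. Its constraints involve distinct increments and marks, which are independent. *)
Definition history l : set S := satisfies obs code_set (constraints l).

Lemma history_cons st l w : history (st :: l) w <->
  [/\ satisfies obs code_set (mark_constraint st l) w,
      forall v, N v (tt (size l).+1) w = (N v (tt (size l)) w + rings st v)%N & history l w].
Proof.
have clockE : satisfies obs code_set (clock_constraints st (size l)) w <->
    forall v, N v (tt (size l).+1) w = (N v (tt (size l)) w + rings st v)%N.
  split=> [sat v|Nv _ /mapP[v _ ->] /=]; last by rewrite Nv natrD addrAC subrr add0r.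
  have /= : code_set (inl (rings st v)) (obs (inl (v, size l)) w).
    by apply: (sat (inl (v, size l), inl (rings st v))); apply/mapP; exists v; rewrite ?mem_enum.
  by move=> /eqP; rewrite subr_eq addrC -natrD eqr_nat => /eqP.
split => [sat|[sat1 /clockE sat2 sat3] c].
  by split; [|apply/clockE|] => c cl; apply: sat; rewrite !mem_cat cl ?orbT.
by rewrite !mem_cat => /or3P[]; [exact: sat1|exact: sat2|exact: sat3].
Qed.

(** The marks are compared with thresholds that depend on the earlier steps of the history only,
    so a history prescribes the state step by step. *)
Lemma history_state l w : history l w ->
  (forall v, N v (tt (size l)) w = ring_count v l) /\ X start (tt (size l)) w = current l.
Proof.
have paths := poisson_paths (glauber_clocks dyn).
elim: l => [_|st l IH /history_cons[mark Nst /IH[Nl Xl]]].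
  by rewrite /tt mul0r; split=> [v|]; [exact: clock0 paths _ _|exact: glauber_start dyn _ _].
have NS v : N v (tt (size l).+1) w = ring_count v (st :: l).
  by rewrite Nst Nl /= addnC.
split=> [//|]; case: st mark Nst NS => [[v b]|] mark Nst NS /=; rewrite -Xl; last first.
  apply: (glauber_still dyn) => [|v]; first by rewrite tt_ge0 ltW ?tt_lt.
  by rewrite Nst addn0.
rewrite (glauber_one_ring dyn (v := v) _ (tt_ge0 _) (tt_lt _)); first last.
- by rewrite Nst /= eqxx addn1.
- by move=> u uv; rewrite Nst /= eq_sym (negbTE uv) addn0.
rewrite NS /= eqxx add1n Xl; congr upd.
exact: (mark (inr (v, (ring_count v l).+1), inr (plus_prob beta h v (current l), b)) (mem_head _ _)).
Qed.

Lemma mem_mark_constraint st l (i : index) : i \in unzip1 (mark_constraint st l) ->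
  exists2 v, i = inr (v, (ring_count v l).+1) & rings st v.
Proof.
by case: st => [[v b]|//]; rewrite /= inE => /eqP ->; exists v; rewrite ?eqxx.
Qed.

Lemma mem_clock_constraints st j (i : index) : i \in unzip1 (clock_constraints st j) ->
  exists v, i = inl (v, j).
Proof. by rewrite /unzip1 -map_comp => /mapP[v _ ->]; exists v. Qed.

Lemma unzip1_constraints st l : unzip1 (constraints (st :: l)) =
  unzip1 (mark_constraint st l) ++ unzip1 (clock_constraints st (size l)) ++ unzip1 (constraints l).
Proof. by rewrite /unzip1 !map_cat. Qed.

Lemma mem_constraints l (i : index) : i \in unzip1 (constraints l) ->
  match i with
  | inl (v, j) => (j < size l)%N
  | inr (v, k) => (k <= ring_count v l)%N
  end.
Proof.
elim: l i => [//|st l IH] i; rewrite unzip1_constraints !mem_cat => /or3P[].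
- by move=> /mem_mark_constraint[v -> stv] /=; rewrite /ring_count /= stv.
- by move=> /mem_clock_constraints[v ->] /=.
- move=> /IH; case: i => [[v j]|[v k]] /=; first exact: ltnW.
  by move=> le; apply: leq_trans le (leq_addl _ _).
Qed.

Lemma constraints_uniq l : uniq (unzip1 (constraints l)).
Proof.
elim: l => [//|st l IH]; rewrite unzip1_constraints !cat_uniq IH andbT.
apply/and4P; split.
- by case: st => [[v b]|].
- apply/hasPn => i; rewrite mem_cat => /orP[/mem_clock_constraints[v ->]|/mem_constraints il].
    by apply/negP => /mem_mark_constraint[].
  by apply/negP => /mem_mark_constraint[v iv _]; rewrite iv ltnn in il.
- by rewrite /unzip1 -map_comp map_inj_uniq ?enum_uniq // => u v [].
- apply/hasPn => i /mem_constraints il.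
  by apply/negP => /mem_clock_constraints[v iv]; rewrite iv ltnn in il.
Qed.

Let c := expR (- (eta * nsites)).

Lemma clock_constraint_prob v j b :
  Q (obs (inl (v, j)) @^-1` code_set (inl b)) = (expR (- eta) * (if b then eta else 1))%:E.
Proof.
have -> : obs (inl (v, j)) @^-1` code_set (inl b)
    = [set w | N v (tt j.+1) w = (N v (tt j) w + b)%N].
  apply/seteqP; split => w /=.
    by move=> /eqP; rewrite subr_eq addrC -natrD eqr_nat => /eqP.
  by move=> ->; rewrite natrD addrAC subrr add0r.
rewrite (poisson_increments (glauber_clocks dyn)); last by rewrite tt_ge0 tt_lt.
rewrite ttS /poisson_pmf eta0; congr _%:E.
have -> : (b`! = 1)%N by case: b.
by rewrite invr1 mulr1 mulrC; case: b.
Qed.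

Lemma mark_constraint_prob v k p b : 0 <= p <= 1 ->
  Q (obs (inr (v, k)) @^-1` code_set (inr (p, b))) = (if b then p else 1 - p)%:E.
Proof.
move=> p01; have low : Q (obs (inr (v, k)) @^-1` code_set (inr (p, true))) = p%:E.
  rewrite -(uniform_prob_lt p01) -(marks_uniform (glauber_clocks dyn) v k); last first.
    exact: measurable_code_set (inr (p, true)).
  by [].
case: b => //; have -> : obs (inr (v, k)) @^-1` code_set (inr (p, false))
    = ~` (obs (inr (v, k)) @^-1` code_set (inr (p, true))).
  by apply/seteqP; split => w /=; [move=> ->|move/negP/negbTE].
rewrite probability_setC ?low -?EFinB //.
exact: (measurable_funPTI (U v k) (measurable_code_set (inr (p, true)))).
Qed.

Lemma history_prob st l :
  Q (history (st :: l)) = ((c * step_weight (current l) st)%:E * Q (history l))%E.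
Proof.
rewrite /history !(prob_satisfies indep measurable_code_set) ?constraints_uniq //=.
rewrite !big_cat /= muleA; congr (_ * _)%E.
have -> : (\prod_(i <- clock_constraints st (size l)) Q (obs i.1 @^-1` code_set i.2))%E
    = (c * (if st is Some _ then eta else 1))%:E.
  rewrite big_map big_enum /=.
  rewrite (eq_bigr (fun v => (expR (- eta) * (if rings st v then eta else 1))%:E)); last first.
    by move=> v _; apply: clock_constraint_prob.
  rewrite prodEFin; congr _%:E; rewrite big_split /= prodr_const /c; congr (_ * _).
    by rewrite -expRM_natl mulrN mulrC.
  case: st => [[v b]|] /=; last by rewrite big1.
  by rewrite -big_mkcond /= (big_pred1 v) // => u; rewrite eq_sym.
case: st => [[v b]|] /=; last by rewrite big_nil mul1e.
rewrite big_seq1 mark_constraint_prob ?plus_prob01 // -EFinM; congr _%:E.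
by rewrite [RHS]mulrA mulrC.
Qed.

Lemma measurable_history l : measurable (history l).
Proof.
have mobs i : measurable_fun setT (obs i).
  case: i => [[v j]|[v k]]; last exact: measurable_funPT.
  have mN t : measurable_fun setT (fun w => (N v t w)%:R : R).
    by apply: (@measurableT_comp _ _ _ _ _ _ (fun k : nat => k%:R : R)).
  by apply: measurable_funB.
have -> : history l = \bigcap_(x in [set` constraints l]) (obs x.1 @^-1` code_set x.2).
  by apply/seteqP; split => w sat x xl; apply: sat.
apply: fin_bigcap_measurable => // x _; rewrite -[X in measurable X]setTI.
by apply: mobs => //; apply: measurable_code_set.
Qed.

Lemma history_inj l st st' w : history (st :: l) w -> history (st' :: l) w -> st = st'.
Proof.
move=> /history_cons[m N1 _] /history_cons[m' N2 _].
have same v : rings st v = rings st' v.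
  by have := N2 v; rewrite N1 => /addnI; case: rings; case: rings.
case: st st' m m' same {N1 N2} => [[v b]|] [[v' b']|] //= m m' same.
- have vv : v' = v by have := same v; rewrite eqxx => /esym/eqP.
  rewrite vv in m'; congr (Some (_, _)); first by [].
  have /= <- := m _ (mem_head _ _).
  by have /= <- := m' _ (mem_head _ _).
- by have := same v; rewrite eqxx.
- by have := same v'; rewrite eqxx.
Qed.

(** Only the realisations with at most one ring in each interval of length [eta] are kept. Their
    total weight, a power of [c * (1 + eta * nsites)], tends to 1 as [eta] tends to 0. *)
Lemma history_law_ge m l s :
  fine (Q (history l)) * (c * (1 + eta * nsites)) ^+ m * iter m (resample mu eta) (fun t => (t == s)%:R) (current l)
  <= fine (Q (history l `&` [set w | X start (tt (size l + m)) w = s])).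
Proof.
have mX j : measurable [set w | X start (tt j) w = s] by apply: (glauber_measurable dyn).
elim: m l => [|m IH] l.
  rewrite expr0 mulr1 /= addn0; case: eqP => [<-|_]; last by rewrite mulr0 fine_ge0.
  rewrite mulr1 le_eqVlt; apply/orP; left; apply/eqP; congr (fine (Q _)).
  by apply/seteqP; split => w /= => [hw|[]//]; have [_ ->] := history_state hw.
set f := iter m _ _ in IH *.
have IHst st := IH (st :: l).
rewrite iterS -/f.
have E : fine (Q (history l)) * (c * (1 + eta * nsites)) ^+ m.+1 * resample mu eta f (current l)
    = \sum_st fine (Q (history (st :: l))) * (c * (1 + eta * nsites)) ^+ m * f (current (st :: l)).
  have := sum_step_weight beta h eta0 f (current l) => /(congr1 (fun z =>
    fine (Q (history l)) * c * (c * (1 + eta * nsites)) ^+ m * z)) => Ew.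
  transitivity (fine (Q (history l)) * c * (c * (1 + eta * nsites)) ^+ m *
     ((1 + eta * nsites) * resample mu eta f (current l))).
    by rewrite exprS; move: (_ ^+ m) (resample _ _ _ _) (fine _) => x y z; ring.
  rewrite -Ew mulr_sumr; apply: eq_bigr => st _.
  rewrite history_prob -(fineK (fin_num_measure Q _ (measurable_history l))) -EFinM /=.
  by move: (_ ^+ m) (f _) (fine _) (step_weight _ _) => x y z t; ring.
rewrite E; apply: le_trans (ler_sum _ (fun st _ => IHst st)) _.
pose F st := history (st :: l) `&` [set w | X start (tt (size l + m.+1)) w = s].
have mF st : measurable (F st) by apply: measurableI => //; apply: measurable_history.
have -> : \sum_st fine (Q (history (st :: l) `&` [set w | X start (tt (size (st :: l) + m)) w = s]))
    = fine (Q (\bigcup_(st in [set` enum {: step}]) F st)).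
  rewrite measure_fin_bigcup //; last first.
    by move=> st st' _ _ [w [[h1 _] [h2 _]]]; apply: history_inj h1 h2.
  rewrite -fsbig_seq ?enum_uniq // big_enum /= -sum_fine; last first.
    by move=> st _; apply: fin_num_measure.
  by apply: eq_bigr => st _; rewrite /F /= addSnnS.
have mU : measurable (\bigcup_(st in [set` enum {: step}]) F st) by apply: fin_bigcup_measurable.
have mH : measurable (history l `&` [set w | X start (tt (size l + m.+1)) w = s]).
  by apply: measurableI => //; apply: measurable_history.
apply: fine_le; rewrite ?fin_num_measure //.
apply: le_measure; rewrite ?inE //.
by move=> w [st _ [/history_cons[_ _ hw] Xw]].
Qed.

End History.

(** * Decay of the variance under the dynamics *)

Section Semigroup.
Local Open Scope classical_set_scope.
Variables (R : realType) (d : nat) (L : {fset site d}) (beta : R) (h : L -> R).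
Variables (d1 : measure_display) (S : measurableType d1) (Q : probability S R).
Variables (N : L -> R -> {RV Q >-> nat}) (U : L -> nat -> {RV Q >-> R}).
Variable X : conf L -> R -> S -> conf L.
Hypothesis dyn : glauber beta h N U X.
Local Notation conf := (conf L).
Local Notation mu := (gibbs beta h).
Local Notation nsites := (#|{: L}|%:R : R).
Implicit Types (s : conf) (phi : conf -> R).

Lemma semigroupE (t : R) phi s0 : 0 <= t ->
  semigroup Q X t phi s0 = \sum_s law Q (X s0 t) s * phi s.
Proof.
move=> t0; have mX s : measurable [set w | X s0 t w = s] by apply: (glauber_measurable dyn).
rewrite /semigroup unlock.
rewrite (eq_integral (fun w => \sum_s (phi s)%:E * (\1_[set w | X s0 t w = s] w)%:E)%E); last first.
  move=> w _; rewrite (bigD1 (X s0 t w)) //= big1 => [|s sX].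
    by rewrite adde0 indicE mem_set // mule1.
  by rewrite indicE memNset ?mule0 // => /= E; rewrite E eqxx in sX.
have int1 s : Q.-integrable setT (fun w => (\1_[set w | X s0 t w = s] w)%:E : \bar R).
  exact: integrable_indic.
rewrite integral_sum //; last by move=> s; apply: integrableZl.
rewrite -sum_fine; last first.
  move=> s _; rewrite integralZl // integral_indic // setIT.
  by rewrite fin_numM // fin_num_measure.
apply: eq_bigr => s _; rewrite integralZl // integral_indic // setIT mulrC.
by rewrite fineM // fin_num_measure.
Qed.

(** The semigroup is a mixture of [m] steps of the chain [resample], with a weight that tends to 1
    as [m] grows, and of another averaging operator; the variance is convex. *)
Lemma semigroup_variance (t : R) (m : nat) (a w : R) phi :
  (0 < #|{: L}|)%N -> 0 < t -> (0 < m)%N -> t * nsites <= m%:R ->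
  (forall s, a <= phi s <= a + w) ->
  cvar mu (semigroup Q X t phi) finset.set0 <=
  cvar mu (iter m (resample mu (t / m%:R)) phi) finset.set0 + (t * nsites) ^+ 2 / m%:R * w ^+ 2.
Proof.
move=> L0 t0 m0 tm phiw; set eta := t / m%:R.
have mR : 0 < m%:R :> R by rewrite ltr0n.
have eta0 : 0 < eta by rewrite divr_gt0.
set x := eta * nsites; have x0 : 0 < x by rewrite mulr_gt0 ?ltr0n.
have x1 : x <= 1 by rewrite /x /eta mulrAC ler_pdivrMr // mul1r.
set y := expR (- x) * (1 + x); pose kappa := y ^+ m.
have y0 : 0 < y by rewrite mulr_gt0 ?expR_gt0 // ltr_pwDl // ltW.
have y1 : y < 1.
  by rewrite /y expRN mulrC ltr_pdivrMr ?expR_gt0 // mul1r expR_gt1Dx // gt_eqF.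
have yx : 1 - y <= x ^+ 2.
  have : (1 - x) * (1 + x) <= y.
    by rewrite /y ler_pM2r; [exact: expR_ge1Dx|rewrite ltr_pwDl // ltW].
  by lra.
have k0 : 0 <= kappa by apply: exprn_ge0; exact: ltW.
have k1 : kappa < 1 by rewrite exprn_ilt1 ?ltW // -lt0n.
have kx : 1 - kappa <= (t * nsites) ^+ 2 / m%:R.
  have y01 : 0 <= y <= 1 by rewrite !ltW.
  have := exprn_ge1B m y01; rewrite -/kappa => k_ge.
  have : m%:R * (1 - y) <= m%:R * x ^+ 2 by rewrite ler_pM2l.
  have -> : m%:R * x ^+ 2 = (t * nsites) ^+ 2 / m%:R.
    by rewrite /x /eta; field; rewrite gt_eqF.
  move: k_ge; move: ((t * nsites) ^+ 2 / m%:R) (m%:R * (1 - y)) => ? ?; lra.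
pose T s0 s := iter m (resample mu eta) (fun u => (u == s)%:R) s0.
have tE : m%:R * eta = t by rewrite /eta mulrC divfK // gt_eqF.
have dom s0 s : kappa * T s0 s <= law Q (X s0 t) s.
  have := history_law_ge dyn eta0 s0 m [::] s; rewrite /= add0n tE -/x -/y -/kappa.
  rewrite /history (_ : satisfies _ _ _ = setT); last by apply/seteqP; split.
  by rewrite probability_setT mul1r setTI.
have mX s0 s : measurable [set w | X s0 t w = s] by apply: (glauber_measurable dyn); apply: ltW.
have T1 s0 : \sum_s T s0 s = 1.
  rewrite -[RHS](iter_resample_cst m 1 s0 (gibbs_gt0 beta h) eta0) [RHS]iter_resample_sum.
  by apply: eq_bigr => s _; rewrite mulr1.
have k1' : 0 < 1 - kappa by rewrite subr_gt0.
pose r s0 := (semigroup Q X t phi s0 - kappa * iter m (resample mu eta) phi s0) / (1 - kappa).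
pose q s0 s := (law Q (X s0 t) s - kappa * T s0 s) / (1 - kappa).
have rE s0 : r s0 = \sum_s q s0 s * phi s.
  rewrite /r semigroupE ?ltW // iter_resample_sum mulr_sumr -sumrB mulr_suml.
  by apply: eq_bigr => s _; rewrite mulrA -mulrBl mulrAC.
have q0 s0 s : 0 <= q s0 s by rewrite divr_ge0 ?subr_ge0 // ltW.
have q_mean s0 (b : R) : b = \sum_s q s0 s * b.
  by rewrite -!mulr_suml sumrB -mulr_sumr T1 law_sum1 // mulr1 divff ?mul1r // gt_eqF //.
have rw s0 : a <= r s0 <= a + w.
  rewrite rE [a in a <= _](q_mean s0) [a + w](q_mean s0).
  by apply/andP; split; apply: ler_sum => s _; rewrite ler_wpM2l //; case/andP: (phiw s).
have -> : semigroup Q X t phi = fun s => kappa * iter m (resample mu eta) phi s + (1 - kappa) * r s.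
  apply/funext => s; rewrite /r mulrCA divff ?gt_eqF // mulr1; ring.
apply: le_trans (variance_mix (gibbs_gt0 beta h) (gibbs_sum1 beta h) _ _ _) _.
  by rewrite k0 ltW.
have vr := variance_osc (gibbs_gt0 beta h) (gibbs_sum1 beta h) rw.
have vr0 := cvar_ge0 (gibbs_gt0 beta h) (gibbs_sum1 beta h) finset.set0 (iter m (resample mu eta) phi).
apply: lerD; first by rewrite ler_piMl // ltW.
apply: le_trans (ler_wpM2l (ltW k1') vr) _.
by rewrite ler_wpM2r ?sqr_ge0.
Qed.

End Semigroup.

(** * The polynomial bound *)

Section Radius.
Variable R : realType.

(** The exponential decay of weak spatial mixing beats the volume growth: at a large enough radius
    the constraint of the walk count is met. *)
Lemma exists_scale (d : nat) (C : R) : 0 < C -> exists (r : nat) (eps : R),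
  [/\ (0 < r)%N, 0 < eps &
    expR 1 * (((r + r).+1.*2.+1 ^ d) ^ 2)%:R * (eps + C * expR (- (r%:R / C)) / eps) <= 1 / 2].
Proof.
move=> C0; pose k := (d * 4)%N.
pose M := 16 * expR 1 ^+ 2 * C * 7 ^+ k * (k.+1)`!%:R * C ^+ k.+1.
pose r := (Num.truncn M).+1.
have rM : M < r%:R by apply: truncnS_gt.
have r1 : (0 < r)%N by [].
set V := ((r + r).+1.*2.+1 ^ d)%N.
have e1 : 0 < expR 1 :> R by rewrite expR_gt0.
have V0 : 0 < V%:R :> R by rewrite ltr0n expn_gt0.
pose y : R := expR 1 * (V ^ 2)%:R.
have y0 : 0 < y by rewrite mulr_gt0 // ltr0n expn_gt0 /= expn_gt0.
(* This choice of [eps] makes the first half of the bound equal to 1/4. *)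
exists r, (4 * y)^-1; split=> //; first by rewrite invr_gt0 mulr_gt0.
rewrite -/y invrK.
have rC : 0 < r%:R / C by rewrite divr_gt0 // ltr0n.
(* [y ^+ 2] grows like the power [k] of [r], and the exponential exceeds the power [k.+1]. *)
have main : 16 * y ^+ 2 * C <= expR (r%:R / C).
  have Vr : (V ^ 2)%:R ^+ 2 <= 7 ^+ k * r%:R ^+ k :> R.
    rewrite -!natrX -natrM ler_nat -expnM -expnMn /V -expnM.
    have -> : (d * (2 * 2) = k)%N by [].
    case: (posnP k) => [->//|k0]; rewrite leq_exp2r //.
    by move: r1; clearbody r; lia.
  apply: le_trans (_ : (r%:R / C) ^+ k.+1 / (k.+1)`!%:R <= _); last first.
    by apply: le_trans (expR_ge1Dxn k (ltW rC)); rewrite lerDr.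
  rewrite ler_pdivlMr ?ltr0n ?fact_gt0 // expr_div_n ler_pdivlMr ?exprn_gt0 //.
  apply: le_trans (_ : M * r%:R ^+ k <= _); last by rewrite exprS ler_wpM2r ?exprn_ge0 ?ler0n // ltW.
  rewrite /M /y exprMn.
  move: Vr; set v := (V ^ 2)%:R ^+ 2; set z := 7 ^+ k; set q := r%:R ^+ k => Vr.
  have c0 : 0 <= 16 * expR 1 ^+ 2 * C * ((k.+1)`!%:R * C ^+ k.+1).
    by rewrite !mulr_ge0 ?exprn_ge0 ?ler0n ?ltW.
  have := ler_wpM2l c0 Vr.
  by move: (expR 1 ^+ 2) ((k.+1)`!%:R) (C ^+ k.+1) => a b c; lra.
rewrite mulrDr.
have -> : y * (4 * y)^-1 = 1 / 4 by rewrite invfM mulrCA divff ?gt_eqF // mulr1 mul1r.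
have : y * (C * expR (- (r%:R / C)) * (4 * y)) <= 1 / 4.
  rewrite expRN; set X := expR _ in main *.
  have X0 : 0 < X by rewrite expR_gt0.
  have -> : y * (C / X * (4 * y)) = (4 * y ^+ 2 * C) / X by ring.
  by rewrite ler_pdivrMr //; lra.
by lra.
Qed.

End Radius.

Section Decay.
Local Open Scope classical_set_scope.
Variables (R : realType) (d : nat) (L : {fset site d}) (beta : R) (h : L -> R).
Hypothesis beta0 : 0 <= beta.
Hypothesis L0 : (0 < #|{: L}|)%N.
Variables (d1 : measure_display) (S : measurableType d1) (Q : probability S R).
Variables (N : L -> R -> {RV Q >-> nat}) (U : L -> nat -> {RV Q >-> R}).
Variable X : conf L -> R -> S -> conf L.
Hypothesis dyn : glauber beta h N U X.
Local Notation mu := (gibbs beta h).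
Local Notation nsites := (#|{: L}|%:R : R).
Variables (B Theta : R).
Hypotheses (B0 : 0 < B) (Theta0 : 0 < Theta).
Hypothesis weak_poincare : forall (f : conf L -> R) (a w x : R),
  (forall s, a <= f s <= a + w) -> 0 < x -> x <= 1 -> x * w ^+ 2 <= cvar mu f finset.set0 ->
  w ^+ 2 * expR (- (Theta * ln (B / x))) <= dirichlet mu f.

(** By time [t] the variance has reached the level at which the Dirichlet form may be as small as
    [3 / t]; above this level it decreases at a rate of at least [3 / t]. *)
Lemma variance_decay (phi : conf L -> R) (a w t : R) : 0 < t -> (forall s, a <= phi s <= a + w) ->
  cvar mu (semigroup Q X t phi) finset.set0 <= B * (3 / t) `^ Theta^-1 * w ^+ 2.
Proof.
move=> t0 phiw; set x := B * (3 / t) `^ Theta^-1.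
have t3 : 0 < 3 / t by rewrite divr_gt0.
have x0 : 0 < x by rewrite mulr_gt0 // powR_gt0.
have mX s0 s : measurable [set w | X s0 t w = s] by apply: (glauber_measurable dyn); apply: ltW.
(* Above the level 1, the variance is bounded by the squared oscillation. *)
have [x1|x1] := leP x 1; last first.
  have Pw s0 : a <= semigroup Q X t phi s0 <= a + w.
    have q_mean (b : R) : b = \sum_s law Q (X s0 t) s * b by rewrite -mulr_suml law_sum1 // mul1r.
    rewrite (semigroupE dyn _ _ (ltW t0)) [a in a <= _]q_mean [a + w]q_mean.
    apply/andP; split; apply: ler_sum => s _; by rewrite ler_wpM2l ?law_ge0 //; case/andP: (phiw s).
  apply: le_trans (variance_osc (gibbs_gt0 beta h) (gibbs_sum1 beta h) Pw) _.
  by rewrite ler_peMl ?sqr_ge0 // ltW.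
apply/ler_addgt0Pr => e e0.
pose c := (t * nsites) ^+ 2 * w ^+ 2.
have c0 : 0 <= c by rewrite mulr_ge0 ?sqr_ge0.
(* So many steps bring the error of the discretisation below [e]. *)
pose m := (Num.truncn (t * nsites + c / e)).+1.
have tN : 0 <= t * nsites by rewrite mulr_ge0 ?ler0n // ltW.
have ce : 0 <= c / e by rewrite divr_ge0 // ltW.
have mlarge : t * nsites + c / e < m%:R by apply: truncnS_gt.
have m0 : 0 < m%:R :> R by rewrite ltr0n.
have tm : t * nsites <= m%:R by lra.
apply: le_trans (semigroup_variance dyn L0 t0 _ tm phiw) _ => //.
apply: lerD; last first.
  rewrite mulrAC -/c ler_pdivrMr // mulrC -ler_pdivrMr //; lra.
have eta0 : 0 < t / m%:R by rewrite divr_gt0.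
apply: (resample_decay (gibbs_gt0 beta h) (gibbs_sum1 beta h) eta0 (D := 3 / t) phiw).
- move=> g gw gx; have := weak_poincare gw x0 x1 gx.
  have -> : expR (- (Theta * ln (B / x))) = 3 / t.
    rewrite /x invfM mulrA divff ?gt_eqF // mul1r lnV ?posrE ?powR_gt0 // ln_powR mulrN opprK.
    by rewrite mulrA divff ?gt_eqF // mul1r lnK.
  by [].
- exact: ltW.
have -> : m%:R * (t / m%:R / (1 + t / m%:R * nsites)) * (3 / t) = 3 / (1 + t * nsites / m%:R).
  have Z : 0 < 1 + t * nsites / m%:R by rewrite ltr_pwDl // divr_ge0 // ltW.
  have E : t / m%:R * nsites = t * nsites / m%:R by rewrite mulrAC.
  rewrite E; move: (t * nsites / m%:R) Z => z Z.
  by field; rewrite !gt_eqF.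
have : t * nsites / m%:R <= 1 by rewrite ler_pdivrMr // mul1r.
have : 0 <= t * nsites / m%:R by rewrite divr_ge0 // ltW.
move: (t * nsites / m%:R) => z z0 z1.
by rewrite ltr_pdivlMr ?mul1r; lra.
Qed.

End Decay.

Section Box.

Lemma card_box d n : (0 < n)%N -> (0 < #|{: box d n}| <= (3 * n) ^ d)%N.
Proof.
move=> n0; rewrite -cardfE; apply/andP; split.
  rewrite cardfs_gt0; apply/fset0Pn; exists [ffun=> 0]; rewrite in_box.
  by apply/forallP => i; rewrite ffunE normr0.
apply: leq_trans (leq_imfset_card _ _ _) _.
rewrite -cardE card_ffun !card_ord.
by case: (posnP d) => [->//|d0]; rewrite leq_exp2r //; lia.
Qed.

Lemma osc_bounds (R : realType) d (L : {fset site d}) (phi : conf L -> R) :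
  exists a, forall s, a <= phi s <= a + osc phi.
Proof.
exists (\big[Num.min/phi (constc L true)]_s phi s) => s; rewrite /osc addrC subrK.
by rewrite bigmin_le_cond // le_bigmax_cond.
Qed.

End Box.

Local Open Scope classical_set_scope.

Theorem theorem1p2 (R : realType) (d : nat) (beta C : R) :
  (2 <= d)%N -> 0 < beta -> 0 < C ->
  exists K alpha kappa : R, [/\ 0 < K, 0 < alpha, 0 < kappa &
  forall n : nat, (1 <= n)%N ->
  forall (d0 : measure_display) (Omega : measurableType d0)
    (P : probability Omega R) (H : box d n -> {RV P >-> R}),
  iid_symmetric H ->
  WSM beta H C ->
  forall delta : R, 0 < delta ->
  exists E : set Omega, [/\ measurable E, ((1 - delta)%:E <= P E)%E &
  forall w, E w ->
  forall (d1 : measure_display) (S : measurableType d1) (Q : probability S R)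
    (N : box d n -> R -> {RV Q >-> nat}) (U : box d n -> nat -> {RV Q >-> R})
    (X : conf (box d n) -> R -> S -> conf (box d n)),
  glauber beta (fun u => H u w) N U X ->
  forall (phi : conf (box d n) -> R) (t : R), 0 < t ->
    gibbs_var (gibbs beta (fun u => H u w)) (semigroup Q X t phi)
    <= K * n%:R `^ kappa * osc phi ^+ 2 / (delta * t `^ alpha)]].
Proof.
move=> d2 /ltW beta0 C0; have [r [eps [r0 eps0 scale]]] := exists_scale d C0.
pose k0 := ratio_bound d beta; pose V := ((r + r).*2.+1 ^ d)%N.
pose Theta := poincare_exponent V (3 ^ d) k0.
have Theta0 : 0 < Theta.
  by rewrite mulr_gt0 ?expR_gt0 // ltr_pwDl // ln_ge0 // lerDl mulr_ge0 // sqr_ge0.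
exists (expR 1 * 27 ^+ d * 3 `^ Theta^-1), Theta^-1, (3 * d)%:R; split.
- by rewrite !mulr_gt0 ?expR_gt0 ?exprn_gt0 ?powR_gt0.
- by rewrite invr_gt0.
- by rewrite ltr0n muln_gt0 /= ltnW.
move=> n n0 d0 Omega P H iid wsm delta delta0.
have /andP[L0 cardL] := card_box d n0.
have [delta1|delta1] := leP 1 delta.
  exists set0; split=> //; by rewrite measure0 lee_fin subr_le0.
have [E [mE PE tail]] := disorder_event beta0 (iid_independent iid) eps0 L0 delta0
  (fun x => leq_trans (eq_leq (esym (cardsE _))) (card_within _ x)) (bad_prob_le beta0 wsm r0 eps0) scale.
exists E; split=> // w Ew d1 S Q N U X dyn phi t t0.
set h := fun u => H u w; set nsites := #|{: box d n}| in tail *.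
have N1 : 1 <= nsites%:R :> R by rewrite ler1n.
pose G : R := expR 1 * nsites%:R / delta.
have Glarge : expR 1 <= nsites%:R * G.
  rewrite /G mulrA ler_pdivlMr // mulrCA ler_wpM2l ?expR_ge0 //.
  apply: le_trans (ltW delta1) _; rewrite -[leLHS]mulr1.
  by rewrite ler_pM.
have [a phiw] := osc_bounds phi.
have wp := weak_poincare (gibbs_gt0 beta h) (gibbs_sum1 beta h) (gibbs_lattice beta0 h)
  (gibbs_swap beta h) (@edge_sym _ _) (@edge_degree _ _) (gibbs_ratio beta0 h)
  (@within_refl _ _ _) (@within_sym _ _ _) (card_within (r + r)) (@within_edge_hop _ _ _)
  (linf_ball_self r) (@linf_ball_disjoint _ _ _) L0 Glarge (fun J _ => tail w Ew J).
have B0 : 0 < nsites%:R ^+ 2 * G.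
  by rewrite mulr_gt0 ?exprn_gt0 ?divr_gt0 ?mulr_gt0 ?expR_gt0 ?ltr0n.
have := variance_decay L0 dyn B0 Theta0 (fun f a w x fw x0 x1 => wp f a w x fw x0 x1) t0 phiw.
rewrite (varianceE (gibbs_gt0 beta h) (gibbs_sum1 beta h)) => decay; apply: le_trans decay _.
have -> : (3 / t) `^ Theta^-1 = 3 `^ Theta^-1 / t `^ Theta^-1.
  apply: (canRL (mulfK _)); first by rewrite gt_eqF // powR_gt0.
  by rewrite -powRM ?divfK ?gt_eqF // ltW // divr_gt0.
have nN : nsites%:R ^+ 3 <= 27 ^+ d * n%:R `^ (3 * d)%:R :> R.
  rewrite powR_mulrn ?ler0n // exprM -exprMn -!natrX -!natrM -natrX ler_nat.
  have -> : (27 * n ^ 3 = (3 * n) ^ 3)%N by rewrite expnMn.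
  by rewrite -expnM (mulnC 3%N d) expnM leq_exp2r.
have tT : 0 < t `^ Theta^-1 by rewrite powR_gt0.
have T3 : 0 < 3 `^ Theta^-1 :> R by rewrite powR_gt0.
rewrite /G; move: (t `^ _) (3 `^ _) (27 ^+ d) (n%:R `^ _) (nsites%:R) (expR 1) (expR_gt0 (1 : R)) tT T3 nN (osc phi).
move=> tT T3 b c z e e0 tT0 T30 zbc o.
have -> : z ^+ 2 * (e * z / delta) * (T3 / tT) * o ^+ 2 = e * T3 * o ^+ 2 / (delta * tT) * z ^+ 3.
  by field; rewrite !gt_eqF.
have -> : e * b * T3 * c * o ^+ 2 / (delta * tT) = e * T3 * o ^+ 2 / (delta * tT) * (b * c).
  by field; rewrite !gt_eqF.
apply: ler_wpM2l => //; apply: divr_ge0; last by rewrite ltW // mulr_gt0.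
by rewrite mulr_ge0 ?sqr_ge0 // mulr_ge0 // ltW.
Qed.
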